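(* Let $0\le n\le\infty$. The strict monoidal functor $((\mathbf Z/2\mathbf Z)^n)_{\mathrm{disc}}\to\mathrm{Aut}(\Theta_n)$, $\delta\mapsto\mathrm{op}_\delta$, is an isomorphism of monoidal categories.
   Context: For a category $\mathcal C$, $\mathrm{Aut}(\mathcal C)$ is the category of autoequivalences of $\mathcal C$ (full subcategory, on the equivalences, of the category of endofunctors and natural transformations), with strict monoidal structure given by composition. For $n=\infty$, $(\mathbf Z/2\mathbf Z)^\infty=\prod_{k\ge1}\mathbf Z/2\mathbf Z$. $((\mathbf Z/2\mathbf Z)^n)_{\mathrm{disc}}$ is the discrete category on this set, with strict monoidal structure given by the group law. $n\text{-}\mathrm{Cat}$ is the category of small strict $n$-categories and strict $n$-functors. A strict $k$-category is regarded as a strict $m$-category ($m\ge k$) whose $i$-arrows are identities for $i>k$. The $k$-disk $D_k$ is the strict $\infty$-category corepresenting the functor $\mathrm{Ar}_k$ ''set of $k$-arrows''; it is a $k$-category. For $k>k'\ge0$, $\sigma,\tau:D_{k'}\to D_k$ corepresent the iterated source and target $\mathrm{Ar}_k\to\mathrm{Ar}_{k'}$. A table of dimensions is a sequence $T=(k_1,k'_1,k_2,k'_2,\dots,k'_{m-1},k_m)$, $m\ge1$, of non-negative integers with $k_i>k'_i$ and $k_{i+1}>k'_i$ for $0<i<m$; its height is its greatest entry. $\Theta(T)$ is the colimit in $\infty\text{-}\mathrm{Cat}$ of the zigzag $D_{k_1}\xleftarrow{\sigma}D_{k'_1}\xrightarrow{\tau}D_{k_2}\xleftarrow{\sigma}\cdots\xrightarrow{\tau}D_{k_m}$.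 $\Theta_n$ has as objects the tables of dimensions of height at most $n$, and $\Theta_n(S,T)=n\text{-}\mathrm{Cat}(\Theta(S),\Theta(T))$; it is regarded as a full subcategory of $n\text{-}\mathrm{Cat}$. Distinct objects of $\Theta_n$ are non-isomorphic and objects of $\Theta_n$ have no non-trivial automorphisms. For $\delta=(\delta_i)\in(\mathbf Z/2\mathbf Z)^n$, $\mathrm{op}_\delta$ is the autoequivalence of $n\text{-}\mathrm{Cat}$ reversing the orientation of the $i$-arrows for all $i$ with $\delta_i=1$. It sends objects of $\Theta_n$ to strict $n$-categories isomorphic to objects of $\Theta_n$, hence induces an autoequivalence, still denoted $\mathrm{op}_\delta$, of $\Theta_n$. *)

(* Defs.v *)
From mathcomp Require Import all_boot all_order all_algebra.
From mathcomp Require Import boolp functions.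
Set Implicit Arguments.
Unset Strict Implicit.
Unset Printing Implicit Defensive.
Import GRing.Theory.

Record category := Category {
  ob :> Type;
  hom : ob -> ob -> Type;
  idm : forall a, hom a a;
  cmp : forall a b c, hom b c -> hom a b -> hom a c;
  cmp1m : forall a b (f : hom a b), cmp (idm b) f = f;
  cmpm1 : forall a b (f : hom a b), cmp f (idm a) = f;
  cmpA : forall a b c d (f : hom c d) (g : hom b c) (h : hom a b),
    cmp f (cmp g h) = cmp (cmp f g) h }.

Record functor (C D : category) := Functor {
  fob :> C -> D;
  fhom : forall a b, hom a b -> hom (fob a) (fob b);
  fhom1 : forall a, fhom (idm a) = idm (fob a);
  fhomM : forall a b c (f : hom b c) (g : hom a b),
    fhom (cmp f g) = cmp (fhom f) (fhom g) }.

Lemma functor_eq C D (F G : functor C D) (e : fob F = fob G) :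
  (forall a b (f : hom a b),
     ecast h (hom (h a) (h b)) e (fhom F f) = fhom G f) ->
  F = G.
Proof.
case: F G e => [F0 F1 p q] [G0 G1 p' q'] /= e.
case: _ / e G1 p' q' => G1 p' q' h.
have e : F1 = G1.
  apply: functional_extensionality_dep => a.
  apply: functional_extensionality_dep => b.
  by apply: functional_extensionality_dep => f; exact: h.
by case: _ / e p' q' {h} => p' q'; congr Functor; exact: Prop_irrelevance.
Qed.

Definition fid C : functor C C :=
  @Functor C C id (fun _ _ f => f) (fun=> erefl) (fun _ _ _ _ _ => erefl).

Definition fcomp C D E (F : functor D E) (G : functor C D) : functor C E.
Proof.
exists (fun x => F (G x)) (fun _ _ f => fhom F (fhom G f)).
- by move=> a; rewrite !fhom1.
- by move=> a b c f g; rewrite !fhomM.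
Defined.

Lemma fcompA B C D E (F : functor D E) (G : functor C D) (H : functor B C) :
  fcomp F (fcomp G H) = fcomp (fcomp F G) H.
Proof. by unshelve (eapply functor_eq). Qed.

Lemma fcomp1F C D (F : functor C D) : fcomp (fid D) F = F.
Proof. by unshelve (eapply functor_eq). Qed.

Lemma fcompF1 C D (F : functor C D) : fcomp F (fid C) = F.
Proof. by unshelve (eapply functor_eq). Qed.

Record nattrans C D (F G : functor C D) := NatTrans {
  nt :> forall x, hom (F x) (G x);
  ntP : forall a b (f : hom a b), cmp (nt b) (fhom F f) = cmp (fhom G f) (nt a) }.

Lemma nattrans_eq C D (F G : functor C D) (s t : nattrans F G) :
  (forall x, s x = t x) -> s = t.
Proof.
case: s t => [s p] [t q] /= h.
have e : s = t by apply: functional_extensionality_dep.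
by case: _ / e q {h} => q; congr NatTrans; exact: Prop_irrelevance.
Qed.

Definition ntid C D (F : functor C D) : nattrans F F.
Proof.
by exists (fun x => idm (F x)) => a b f; rewrite cmp1m cmpm1.
Defined.

Definition ntcomp C D (F G H : functor C D) (s : nattrans G H)
  (t : nattrans F G) : nattrans F H.
Proof.
exists (fun x => cmp (s x) (t x)) => a b f.
by rewrite -cmpA ntP cmpA ntP cmpA.
Defined.

Definition Fun (C D : category) : category.
Proof.
exists (functor C D) (@nattrans C D) (@ntid C D) (@ntcomp C D).
- by move=> F G s; apply: nattrans_eq => x; exact: cmp1m.
- by move=> F G s; apply: nattrans_eq => x; exact: cmpm1.
- by move=> F G H K s t u; apply: nattrans_eq => x; exact: cmpA.
Defined.

Definition is_iso (C : category) (a b : C) (f : hom a b) :=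
  exists g : hom b a, cmp g f = idm a /\ cmp f g = idm b.

Definition nat_iso C D (F G : functor C D) :=
  exists s : nattrans F G, forall x, is_iso (s x).

Definition is_equivalence C D (F : functor C D) :=
  exists G : functor D C, nat_iso (fcomp G F) (fid C) /\ nat_iso (fcomp F G) (fid D).

(* Pulling back the hom-sets of C along f : X -> C; for X a set of objects
   (given by a subtype or by a family), the full subcategory of C on X. *)
Definition full (C : category) (X : Type) (f : X -> C) : category :=
  @Category X (fun x y => hom (f x) (f y)) (fun x => idm (f x))
    (fun x y z => @cmp C (f x) (f y) (f z))
    (fun x y => @cmp1m C (f x) (f y)) (fun x y => @cmpm1 C (f x) (f y))
    (fun x y z t => @cmpA C (f x) (f y) (f z) (f t)).

Definition full_incl (C : category) (X : Type) (f : X -> C) : functor (full f) C :=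
  @Functor (full f) C f (fun _ _ h => h) (fun=> erefl) (fun _ _ _ _ _ => erefl).

Definition prodcat (C D : category) : category.
Proof.
exists (C * D)%type (fun x y => (hom x.1 y.1 * hom x.2 y.2)%type)
  (fun x => (idm x.1, idm x.2)) (fun _ _ _ f g => (cmp f.1 g.1, cmp f.2 g.2)).
- by move=> a b [f g]; rewrite !cmp1m.
- by move=> a b [f g]; rewrite !cmpm1.
- by move=> a b c d f g h; rewrite !cmpA.
Defined.

(* Equality of arrows that are not known a priori to be parallel. *)
Inductive arr_eq (C : category) (a b : C) (f : hom a b) :
  forall c d : C, hom c d -> Prop := ArrEq : arr_eq f f.

Record smcategory := SMCategory {
  smcat :> category;
  tens : functor (prodcat smcat smcat) smcat;
  sunit : smcat;
  tensA : forall x y z, tens (x, tens (y, z)) = tens (tens (x, y), z);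
  tens1x : forall x, tens (sunit, x) = x;
  tensx1 : forall x, tens (x, sunit) = x;
  tensA_hom : forall x y z x' y' z'
    (f : hom x x') (g : hom y y') (h : hom z z'),
    arr_eq (@fhom _ _ tens (x, tens (y, z)) (x', tens (y', z'))
              (f, @fhom _ _ tens (y, z) (y', z') (g, h)))
           (@fhom _ _ tens (tens (x, y), z) (tens (x', y'), z')
              (@fhom _ _ tens (x, y) (x', y') (f, g), h));
  tens1x_hom : forall x x' (f : hom x x'),
    arr_eq (@fhom _ _ tens (sunit, x) (sunit, x') (idm sunit, f)) f;
  tensx1_hom : forall x x' (f : hom x x'),
    arr_eq (@fhom _ _ tens (x, sunit) (x', sunit) (f, idm sunit)) f }.

Record smfunctor (M N : smcategory) := SMFunctor {
  smf :> functor M N;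
  smf_unit : smf (sunit M) = sunit N;
  smf_tens : forall x y, smf (tens M (x, y)) = tens N (smf x, smf y);
  smf_tens_hom : forall x y x' y' (f : hom x x') (g : hom y y'),
    arr_eq (fhom smf (@fhom _ _ (tens M) (x, y) (x', y') (f, g)))
           (@fhom _ _ (tens N) (smf x, smf y) (smf x', smf y')
              (fhom smf f, fhom smf g)) }.

Definition is_smiso (M N : smcategory) (F : smfunctor M N) :=
  exists G : smfunctor N M, fcomp G F = fid M /\ fcomp F G = fid N.

Definition disc (X : Type) : category.
Proof.
by exists X (fun x y => x = y) (fun=> erefl) (fun _ _ _ e e' => etrans e' e);
  move=> *; exact: Prop_irrelevance.
Defined.

Definition disc_tens (G : zmodType) : functor (prodcat (disc G) (disc G)) (disc G).
Proof.
exists (fun x => (x.1 + x.2)%R : disc G)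
  (fun (x y : prodcat (disc G) (disc G)) e => congr2 +%R e.1 e.2).
- by move=> * /=; exact: Prop_irrelevance.
- by move=> * /=; exact: Prop_irrelevance.
Defined.

Lemma disc_arr_eq X (a b c d : disc X) (f : hom a b) (g : hom c d) :
  a = c -> arr_eq f g.
Proof. by case: _ / f; case: _ / g => ->. Qed.

Definition disc_sm (G : zmodType) : smcategory.
Proof.
exists (disc G) (disc_tens G) 0%R.
- exact: addrA.
- exact: add0r.
- exact: addr0.
- by move=> *; apply: disc_arr_eq; exact: addrA.
- by move=> *; apply: disc_arr_eq; exact: add0r.
- by move=> *; apply: disc_arr_eq; exact: addr0.
Defined.

Lemma is_iso_id (C : category) (a : C) : is_iso (idm a).
Proof. by exists (idm a); rewrite cmp1m. Qed.

Lemma is_iso_cmp (C : category) (a b c : C) (f : hom b c) (g : hom a b) :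
  is_iso f -> is_iso g -> is_iso (cmp f g).
Proof.
move=> [f' [p p']] [g' [q q']]; exists (cmp g' f'); split.
- by rewrite -cmpA (cmpA f') p cmp1m.
- by rewrite -cmpA (cmpA g) q' cmp1m.
Qed.

Lemma is_iso_fhom C D (F : functor C D) (a b : C) (f : hom a b) :
  is_iso f -> is_iso (fhom F f).
Proof.
by move=> [g [p q]]; exists (fhom F g); rewrite -!fhomM p q !fhom1.
Qed.

Lemma is_equivalence_id C : is_equivalence (fid C).
Proof.
by exists (fid C); split; exists (ntid _) => x; exact: is_iso_id.
Qed.

Lemma nat_iso_conj C D (F : functor C D) (G : functor D C)
    (A : functor D D) :
  nat_iso (fcomp G F) (fid C) -> nat_iso A (fid D) ->
  nat_iso (fcomp G (fcomp A F)) (fid C).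
Proof.
move=> [s sI] [t tI].
have nP a b (f : hom a b) :
    cmp (cmp (s b) (fhom G (t (F b)))) (fhom (fcomp G (fcomp A F)) f) =
    cmp (fhom (fid C) f) (cmp (s a) (fhom G (t (F a)))).
  by rewrite /= -cmpA -fhomM (ntP t) fhomM cmpA (ntP s) cmpA.
exists (NatTrans nP) => x /=.
by apply: is_iso_cmp (sI x) (@is_iso_fhom _ _ G _ _ (t (F x)) (tI (F x))).
Qed.

Lemma is_equivalence_comp C D E (F : functor D E) (G : functor C D) :
  is_equivalence F -> is_equivalence G -> is_equivalence (fcomp F G).
Proof.
move=> [F' [p p']] [G' [q q']]; exists (fcomp G' F'); split.
- have -> : fcomp (fcomp G' F') (fcomp F G) = fcomp G' (fcomp (fcomp F' F) G).
    by rewrite !fcompA.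
  exact: nat_iso_conj.
- have -> : fcomp (fcomp F G) (fcomp G' F') = fcomp F (fcomp (fcomp G G') F').
    by rewrite !fcompA.
  exact: nat_iso_conj.
Qed.

Section Aut.
Variable C : category.

Definition autoeq := {F : functor C C | is_equivalence F}.

Definition Aut : category := @full (Fun C C) autoeq sval.

Lemma autoeq_eq (F G : autoeq) : sval F = sval G -> F = G.
Proof.
case: F G => [F p] [G q] /= e; case: _ / e q => q.
by congr exist; exact: Prop_irrelevance.
Qed.

Definition aut_tens_ob (x : autoeq * autoeq) : autoeq :=
  exist _ (fcomp (sval x.1) (sval x.2))
    (is_equivalence_comp (svalP x.1) (svalP x.2)).

Definition nt_hcomp (F F' G G' : functor C C) (s : nattrans F F')
  (t : nattrans G G') : nattrans (fcomp F G) (fcomp F' G').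
Proof.
exists (fun x => cmp (s (G' x)) (fhom F (t x))) => a b f /=.
by rewrite -cmpA -fhomM (ntP t) fhomM cmpA (ntP s) cmpA.
Defined.

Definition aut_tens : functor (prodcat Aut Aut) Aut.
Proof.
exists (aut_tens_ob : prodcat Aut Aut -> Aut)
  (fun (x y : prodcat Aut Aut) st => nt_hcomp st.1 st.2).
- by move=> [F G]; apply: nattrans_eq => x /=; rewrite fhom1 cmp1m.
- move=> a b c s t; apply: nattrans_eq => x /=.
  rewrite fhomM -!cmpA; congr cmp.
  by rewrite !cmpA; congr cmp; rewrite (ntP t.1).
Defined.

Lemma aut_arr_eq (F F' G G' : Aut) (s : hom F F') (t : hom G G') :
  sval F = sval G -> sval F' = sval G' ->
  (forall x, arr_eq ((s : nattrans _ _) x) ((t : nattrans _ _) x)) ->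
  arr_eq s t.
Proof.
move=> /autoeq_eq e /autoeq_eq e'; case: _ / e t; case: _ / e' => t h.
suff -> : s = t by [].
apply: nattrans_eq => x; have := h x.
move: (nt s x) (nt t x); rewrite /= => u v uv.
pose P c d (w : hom c d) := forall (e1 : c = sval F x) (e2 : d = sval F' x),
  u = ecast z (hom (sval F x) z) e2 (ecast z (hom z d) e1 w).
suff: P _ _ v by move=> /(_ erefl erefl).
case: _ _ _ / uv => e1 e2.
by rewrite (Prop_irrelevance e1 erefl) (Prop_irrelevance e2 erefl).
Qed.

Definition Aut_sm : smcategory.
Proof.
exists Aut aut_tens (exist _ (fid C) (is_equivalence_id C)).
- by move=> *; apply: autoeq_eq; exact: fcompA.
- by move=> *; apply: autoeq_eq; exact: fcomp1F.
- by move=> *; apply: autoeq_eq; exact: fcompF1.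
- move=> F G H F' G' H' s t u; apply: aut_arr_eq; try exact: fcompA.
  by move=> x; rewrite /= fhomM cmpA.
- move=> F F' s; apply: aut_arr_eq; try exact: fcomp1F.
  by move=> x; rewrite /= cmp1m.
- move=> F F' s; apply: aut_arr_eq; try exact: fcompF1.
  by move=> x; rewrite /= fhom1 cmpm1.
Defined.

End Aut.

(* src j k and tgt j k are the iterated source and target Ar_k -> Ar_j, idt the
   iterated identity Ar_j -> Ar_k, and comp j k x y is the composite x *_j y of
   two k-arrows, defined when the j-source of x is the j-target of y.
   Hypotheses of the form src _ _ = tgt _ _ on the conclusion side of an axiom
   follow from those making the other side meaningful. *)
Record omegacat := OmegaCat {
  ar : nat -> Type;
  src : forall j k, j < k -> ar k -> ar j;
  tgt : forall j k, j < k -> ar k -> ar j;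
  idt : forall j k, j < k -> ar j -> ar k;
  comp : forall j k (jk : j < k) (x y : ar k), src jk x = tgt jk y -> ar k;
  src_src : forall i j k (ij : i < j) (jk : j < k) (ik : i < k) x,
    src ij (src jk x) = src ik x;
  src_tgt : forall i j k (ij : i < j) (jk : j < k) (ik : i < k) x,
    src ij (tgt jk x) = src ik x;
  tgt_src : forall i j k (ij : i < j) (jk : j < k) (ik : i < k) x,
    tgt ij (src jk x) = tgt ik x;
  tgt_tgt : forall i j k (ij : i < j) (jk : j < k) (ik : i < k) x,
    tgt ij (tgt jk x) = tgt ik x;
  idt_idt : forall i j k (ij : i < j) (jk : j < k) (ik : i < k) x,
    idt jk (idt ij x) = idt ik x;
  src_idt : forall j k (jk : j < k) x, src jk (idt jk x) = x;
  tgt_idt : forall j k (jk : j < k) x, tgt jk (idt jk x) = x;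
  src_comp : forall j k (jk : j < k) x y (e : src jk x = tgt jk y),
    src jk (comp e) = src jk y;
  tgt_comp : forall j k (jk : j < k) x y (e : src jk x = tgt jk y),
    tgt jk (comp e) = tgt jk x;
  src_comp_gt : forall i j k (ij : i < j) (jk : j < k) (ik : i < k) x y
    (e : src ik x = tgt ik y) (e' : src ij (src jk x) = tgt ij (src jk y)),
    src jk (comp e) = comp e';
  tgt_comp_gt : forall i j k (ij : i < j) (jk : j < k) (ik : i < k) x y
    (e : src ik x = tgt ik y) (e' : src ij (tgt jk x) = tgt ij (tgt jk y)),
    tgt jk (comp e) = comp e';
  comp_assoc : forall j k (jk : j < k) x y z
    (e1 : src jk x = tgt jk y) (e2 : src jk (comp e1) = tgt jk z)
    (e3 : src jk y = tgt jk z) (e4 : src jk x = tgt jk (comp e3)),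
    comp e2 = comp e4;
  comp_idl : forall j k (jk : j < k) x
    (e : src jk (idt jk (tgt jk x)) = tgt jk x), comp e = x;
  comp_idr : forall j k (jk : j < k) x
    (e : src jk x = tgt jk (idt jk (src jk x))), comp e = x;
  idt_comp : forall i j k (ij : i < j) (jk : j < k) (ik : i < k) x y
    (e : src ij x = tgt ij y) (e' : src ik (idt jk x) = tgt ik (idt jk y)),
    idt jk (comp e) = comp e';
  exchange : forall i j k (ij : i < j) (jk : j < k) (ik : i < k) x y z w
    (e1 : src jk x = tgt jk y) (e2 : src jk z = tgt jk w)
    (e3 : src ik (comp e1) = tgt ik (comp e2))
    (e4 : src ik x = tgt ik z) (e5 : src ik y = tgt ik w)
    (e6 : src jk (comp e4) = tgt jk (comp e5)),
    comp e3 = comp e6 }.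

Arguments comp {o j k jk x y}.

Record ofunctor (C D : omegacat) := OFunctor {
  fmap :> forall k, ar C k -> ar D k;
  fmap_src : forall j k (jk : j < k) x, fmap (src jk x) = src jk (fmap x);
  fmap_tgt : forall j k (jk : j < k) x, fmap (tgt jk x) = tgt jk (fmap x);
  fmap_idt : forall j k (jk : j < k) x, fmap (idt jk x) = idt jk (fmap x);
  fmap_comp : forall j k (jk : j < k) (x y : ar C k) (e : src jk x = tgt jk y)
    (e' : src jk (fmap x) = tgt jk (fmap y)), fmap (comp e) = comp e' }.

Arguments fmap {C D} o {k}.

Lemma ofunctor_eq C D (F G : ofunctor C D) :
  (forall k (x : ar C k), F k x = G k x) -> F = G.
Proof.
case: F G => [F p q r s] [G p' q' r' s'] /= h.
have e : F = G.
  by apply: functional_extensionality_dep => k; apply: funext => x; exact: h.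
by case: _ / e p' q' r' s' {h} => *; congr OFunctor; exact: Prop_irrelevance.
Qed.

Lemma comp_congr (C : omegacat) j k (jk jk' : j < k) (x y x' y' : ar C k)
    (e : src jk x = tgt jk y) (e' : src jk' x' = tgt jk' y') :
  x = x' -> y = y' -> comp e = comp e'.
Proof.
move=> ex ey; case: _ / ex e'; case: _ / ey => e'.
rewrite (bool_irrelevance jk' jk) in e' *.
by congr comp; exact: Prop_irrelevance.
Qed.

Definition oid C : ofunctor C C.
Proof. by exists (fun _ x => x) => // *; exact: comp_congr. Defined.

Definition ocomp C D E (F : ofunctor D E) (G : ofunctor C D) : ofunctor C E.
Proof.
exists (fun k x => F k (G k x)).
- by move=> *; rewrite !fmap_src.
- by move=> *; rewrite !fmap_tgt.
- by move=> *; rewrite !fmap_idt.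
- move=> j k jk x y e e'.
  have e1 : src jk (G k x) = tgt jk (G k y) by rewrite -fmap_src -fmap_tgt e.
  by rewrite (fmap_comp _ e1) (fmap_comp _ e').
Defined.

Definition oCat : category.
Proof.
by exists omegacat ofunctor oid ocomp => *; apply: ofunctor_eq.
Defined.

(* Here and below n : option nat ranges over {0, 1, ..., oo}, None standing for
   oo.  A strict n-category is viewed as a strict infinity-category whose arrows
   of dimension > n are identities. *)
Definition is_ncat (n : option nat) (C : omegacat) :=
  if n is Some m then
    forall k (mk : m < k) (x : ar C k), exists y : ar C m, x = idt mk y
  else True.

Definition ncat n := {C : omegacat | is_ncat n C}.

Definition nCat n : category := @full oCat (ncat n) sval.

Section Reverse.
(* r j tells whether the orientation of the (j+1)-arrows is reversed, that is
   whether the j-sources and j-targets of arrows of all dimensions > j are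
   exchanged. *)
Variables (r : nat -> bool) (C : omegacat).

Definition rsrc j k (jk : j < k) : ar C k -> ar C j :=
  if r j then tgt jk else src jk.
Definition rtgt j k (jk : j < k) : ar C k -> ar C j :=
  if r j then src jk else tgt jk.
Definition rcomp j k (jk : j < k) (x y : ar C k) :
    rsrc jk x = rtgt jk y -> ar C k :=
  (if r j as b return
     (if b then tgt jk else src jk) x = (if b then src jk else tgt jk) y -> _
   then fun e => comp (esym e) else fun e => comp e).

Definition rev_ocat : omegacat.
Proof.
exists (ar C) rsrc rtgt (@idt C) rcomp.
all: rewrite /rcomp /rsrc /rtgt.
- by move=> i j k ij jk ik x; case: (r i); case: (r j);
    rewrite ?(src_src _ _ ik) ?(src_tgt _ _ ik) ?(tgt_src _ _ ik) ?(tgt_tgt _ _ ik).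
- by move=> i j k ij jk ik x; case: (r i); case: (r j);
    rewrite ?(src_src _ _ ik) ?(src_tgt _ _ ik) ?(tgt_src _ _ ik) ?(tgt_tgt _ _ ik).
- by move=> i j k ij jk ik x; case: (r i); case: (r j);
    rewrite ?(src_src _ _ ik) ?(src_tgt _ _ ik) ?(tgt_src _ _ ik) ?(tgt_tgt _ _ ik).
- by move=> i j k ij jk ik x; case: (r i); case: (r j);
    rewrite ?(src_src _ _ ik) ?(src_tgt _ _ ik) ?(tgt_src _ _ ik) ?(tgt_tgt _ _ ik).
- exact: idt_idt.
- by move=> j k jk x; case: (r j); rewrite ?src_idt ?tgt_idt.
- by move=> j k jk x; case: (r j); rewrite ?src_idt ?tgt_idt.
- by move=> j k jk x y; case: (r j) => e; rewrite ?src_comp ?tgt_comp.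
- by move=> j k jk x y; case: (r j) => e; rewrite ?src_comp ?tgt_comp.
- by move=> i j k ij jk ik x y; case: (r i); case: (r j) => e e';
    first [exact: src_comp_gt | exact: tgt_comp_gt].
- by move=> i j k ij jk ik x y; case: (r i); case: (r j) => e e';
    first [exact: src_comp_gt | exact: tgt_comp_gt].
- by move=> j k jk x y z; case: (r j) => e1 e2 e3 e4;
    [apply: esym |]; exact: comp_assoc.
- by move=> j k jk x; case: (r j) => e; [exact: comp_idr | exact: comp_idl].
- by move=> j k jk x; case: (r j) => e; [exact: comp_idl | exact: comp_idr].
- by move=> i j k ij jk ik x y; case: (r i) => e e'; exact: idt_comp.
- by move=> i j k ij jk ik x y z w; case: (r i); case: (r j) => e1 e2 e3 e4 e5 e6;
    exact: exchange.
Defined.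

End Reverse.

Definition rev_ofunctor r C D (F : ofunctor C D) :
  ofunctor (rev_ocat r C) (rev_ocat r D).
Proof.
refine (@OFunctor (rev_ocat r C) (rev_ocat r D) (@fmap C D F) _ _ _ _) => /=;
  rewrite /rcomp /rsrc /rtgt.
- by move=> j k jk x; case: (r j); rewrite ?fmap_src ?fmap_tgt.
- by move=> j k jk x; case: (r j); rewrite ?fmap_src ?fmap_tgt.
- exact: fmap_idt.
- by move=> j k jk x y; case: (r j) => e e'; exact: fmap_comp.
Defined.

Lemma rev_is_ncat r n C : is_ncat n C -> is_ncat n (rev_ocat r C).
Proof. by []. Qed.

Definition dim (n : option nat) :=
  {i : nat | (0 < i) && (if n is Some m then i <= m else true)}.

Definition Z2n (n : option nat) : zmodType := (dim n -> 'Z_2)%type.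

(* d i is the orientation of the i-arrows, which are those having (i-1)-sources
   and targets, whence the shift. *)
Definition reversed n (d : Z2n n) (j : nat) : bool :=
  if insub j.+1 is Some i then d i == 1%R else false.

Definition opn n (d : Z2n n) : functor (nCat n) (nCat n).
Proof.
exists (fun C : nCat n => exist _ (rev_ocat (reversed d) (sval C))
                             (rev_is_ncat (reversed d) (svalP C)) : nCat n)
  (fun _ _ F => rev_ofunctor (reversed d) F).
- by move=> C; exact: ofunctor_eq.
- by move=> A B C F G; exact: ofunctor_eq.
Defined.

(* Given a (large) class of infinity-categories U M, each equipped with a
   family gv M of arrows indexed by G, the infinity-category generated by G
   subject to all equations holding in every U M: an arrow is an equivalence
   class of formal composites t such that t is defined in every U M, two of
   them being equivalent if they have the same value in every U M.  It is used
   to construct the infinity-categories defined by universal properties. *)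
Section Generated.
Variables (model : Type) (U : model -> omegacat) (G : nat -> Type).
Variable gv : forall M k, G k -> ar (U M) k.

Inductive term : nat -> Type :=
| tgen k of G k : term k
| tsrc j k (jk : j < k) of term k : term j
| ttgt j k (jk : j < k) of term k : term j
| tidt j k (jk : j < k) of term j : term k
| tcomp j k (jk : j < k) of term k & term k : term k.

Fixpoint ev M k (t : term k) : ar (U M) k -> Prop :=
  match t in term k return ar (U M) k -> Prop with
  | tgen k g => fun x => x = gv M g
  | tsrc j k jk t => fun x => exists2 y, ev t y & x = src jk y
  | ttgt j k jk t => fun x => exists2 y, ev t y & x = tgt jk y
  | tidt j k jk t => fun x => exists2 y, ev t y & x = idt jk y
  | tcomp j k jk t u => fun x => exists y z (e : src jk y = tgt jk z),
      [/\ ev t y, ev u z & x = comp e]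
  end.

Lemma ev_fun M k (t : term k) x y : ev t x -> ev t y -> x = y :> ar (U M) k.
Proof.
elim: t x y => {k} [k g|j k jk t IH|j k jk t IH|j k jk t IH|j k jk t IHt u IHu] x y /=.
- by move=> -> ->.
- by move=> [x' tx ->] [y' ty ->]; rewrite (IH _ _ tx ty).
- by move=> [x' tx ->] [y' ty ->]; rewrite (IH _ _ tx ty).
- by move=> [x' tx ->] [y' ty ->]; rewrite (IH _ _ tx ty).
- move=> [x1 [x2 [e [tx ux ->]]]] [y1 [y2 [e' [ty uy ->]]]].
  by apply: comp_congr; [exact: IHt | exact: IHu].
Qed.

Definition total k (t : term k) := forall M, exists x : ar (U M) k, ev t x.

Definition sim k (t u : term k) := forall M (x : ar (U M) k), ev t x <-> ev u x.

Definition gar k := {c : term k -> Prop | exists2 t, total t & c = sim t}.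

Lemma gar_eq k (c d : gar k) : sval c = sval d -> c = d.
Proof.
case: c d => [c p] [d q] /= e; case: _ / e q => q.
by congr exist; exact: Prop_irrelevance.
Qed.

Definition gcls k (t : term k) (h : total t) : gar k :=
  exist _ (sim t) (ex_intro2 _ _ t h erefl).

Definition grep k (c : gar k) : term k := projT1 (cid2 (svalP c)).

Lemma grep_total k (c : gar k) : total (grep c).
Proof. by rewrite /grep; case: cid2. Qed.

Definition gval M k (c : gar k) : ar (U M) k := projT1 (cid (grep_total c M)).

Lemma gvalP M k (c : gar k) : ev (grep c) (gval M c).
Proof. by rewrite /gval; case: cid. Qed.

Lemma gval_cls M k (t : term k) (h : total t) x : ev t x -> gval M (gcls h) = x.
Proof.
move=> tx; apply: (@ev_fun M k t) => //.
have := gvalP M (gcls h); rewrite /grep; case: cid2 => /= u _ e.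
have tu : sim t u by rewrite e.
by move=> ?; apply/tu.
Qed.

Lemma gcls_rep k (c : gar k) : c = gcls (grep_total c).
Proof.
apply: gar_eq; rewrite /= /grep; case: cid2 => t /= _ ->.
by [].
Qed.

Lemma gval_inj k (c d : gar k) : (forall M, gval M c = gval M d) -> c = d.
Proof.
move=> h; apply: gar_eq.
have E (a : gar k) : sval a = fun u => forall M x, x = gval M a <-> ev u x.
  rewrite {1}(gcls_rep a) /=; apply: funext => u; apply/propext.
  have A M x : x = gval M a <-> ev (grep a) x.
    by split => [->|?]; [exact: gvalP | exact: ev_fun (gvalP _ _)].
  by split=> H M x; [rewrite A|rewrite -A]; exact: H.
rewrite !E; apply: funext => u; apply/propext.
by split=> H M x; [rewrite -h|rewrite h]; exact: H.
Qed.

Lemma gsrc_total j k (jk : j < k) (c : gar k) : total (tsrc jk (grep c)).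
Proof. by move=> M; do 2 eexists; first exact: gvalP. Qed.

Lemma gtgt_total j k (jk : j < k) (c : gar k) : total (ttgt jk (grep c)).
Proof. by move=> M; do 2 eexists; first exact: gvalP. Qed.

Lemma gidt_total j k (jk : j < k) (c : gar j) : total (tidt jk (grep c)).
Proof. by move=> M; do 2 eexists; first exact: gvalP. Qed.

Definition gsrc j k (jk : j < k) (c : gar k) : gar j := gcls (gsrc_total jk c).
Definition gtgt j k (jk : j < k) (c : gar k) : gar j := gcls (gtgt_total jk c).
Definition gidt j k (jk : j < k) (c : gar j) : gar k := gcls (gidt_total jk c).

Lemma gval_src M j k (jk : j < k) c : gval M (gsrc jk c) = src jk (gval M c).
Proof. by apply: gval_cls; exists (gval M c) => //; exact: gvalP. Qed.

Lemma gval_tgt M j k (jk : j < k) c : gval M (gtgt jk c) = tgt jk (gval M c).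
Proof. by apply: gval_cls; exists (gval M c) => //; exact: gvalP. Qed.

Lemma gval_idt M j k (jk : j < k) c : gval M (gidt jk c) = idt jk (gval M c).
Proof. by apply: gval_cls; exists (gval M c) => //; exact: gvalP. Qed.

Lemma gval_match M j k (jk : j < k) (c d : gar k) :
  gsrc jk c = gtgt jk d -> src jk (gval M c) = tgt jk (gval M d).
Proof. by rewrite -gval_src -gval_tgt => ->. Qed.

Lemma gcomp_total j k (jk : j < k) (c d : gar k) :
  gsrc jk c = gtgt jk d -> total (tcomp jk (grep c) (grep d)).
Proof.
move=> e M; exists (comp (gval_match M e)).
by exists (gval M c), (gval M d), (gval_match M e); split => //; exact: gvalP.
Qed.

Definition gcomp j k (jk : j < k) (c d : gar k) (e : gsrc jk c = gtgt jk d) :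
  gar k := gcls (gcomp_total e).

Lemma gval_comp M j k (jk : j < k) c d (e : gsrc jk c = gtgt jk d)
    (e' : src jk (gval M c) = tgt jk (gval M d)) :
  gval M (gcomp e) = comp e'.
Proof.
apply: gval_cls; exists (gval M c), (gval M d), e'.
by split => //; exact: gvalP.
Qed.

Lemma gval_comp_match M j k (jk : j < k) c d (e : gsrc jk c = gtgt jk d) :
  gval M (gcomp e) = comp (gval_match M e).
Proof. exact: gval_comp. Qed.

Definition generated : omegacat.
Proof.
exists gar gsrc gtgt gidt gcomp.
- by move=> *; apply: gval_inj => M; rewrite !gval_src; exact: src_src.
- by move=> *; apply: gval_inj => M; rewrite !gval_src gval_tgt; exact: src_tgt.
- by move=> *; apply: gval_inj => M; rewrite !gval_tgt gval_src; exact: tgt_src.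
- by move=> *; apply: gval_inj => M; rewrite !gval_tgt; exact: tgt_tgt.
- by move=> *; apply: gval_inj => M; rewrite !gval_idt; exact: idt_idt.
- by move=> *; apply: gval_inj => M; rewrite gval_src gval_idt src_idt.
- by move=> *; apply: gval_inj => M; rewrite gval_tgt gval_idt tgt_idt.
- by move=> *; apply: gval_inj => M; rewrite !gval_src gval_comp_match src_comp.
- by move=> *; apply: gval_inj => M; rewrite !gval_tgt gval_comp_match tgt_comp.
- move=> i j k ij jk ik x y e e'; apply: gval_inj => M.
  rewrite gval_src !gval_comp_match.
  have h : src ij (src jk (gval M x)) = tgt ij (src jk (gval M y)).
    by rewrite -!gval_src -gval_tgt e'.
  by rewrite (src_comp_gt _ h); apply: comp_congr; rewrite gval_src.
- move=> i j k ij jk ik x y e e'; apply: gval_inj => M.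
  rewrite gval_tgt !gval_comp_match.
  have h : src ij (tgt jk (gval M x)) = tgt ij (tgt jk (gval M y)).
    by rewrite -!gval_tgt -gval_src e'.
  by rewrite (tgt_comp_gt _ h); apply: comp_congr; rewrite gval_tgt.
- move=> j k jk x y z e1 e2 e3 e4; apply: gval_inj => M.
  have h1 := gval_match M e1; have h3 := gval_match M e3.
  have h2 : src jk (comp h1) = tgt jk (gval M z) by rewrite src_comp.
  have h4 : src jk (gval M x) = tgt jk (comp h3) by rewrite tgt_comp.
  rewrite (gval_comp_match M e2) (gval_comp_match M e4); transitivity (comp h2).
    by apply: comp_congr => //; exact: gval_comp.
  rewrite (comp_assoc h2 h4).
  by apply: comp_congr => //; rewrite -gval_comp.
- move=> j k jk x e; apply: gval_inj => M.
  have h : src jk (idt jk (tgt jk (gval M x))) = tgt jk (gval M x).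
    by rewrite src_idt.
  rewrite gval_comp_match -[RHS](comp_idl h).
  by apply: comp_congr; rewrite ?gval_idt ?gval_tgt.
- move=> j k jk x e; apply: gval_inj => M.
  have h : src jk (gval M x) = tgt jk (idt jk (src jk (gval M x))).
    by rewrite tgt_idt.
  rewrite gval_comp_match -[RHS](comp_idr h).
  by apply: comp_congr; rewrite ?gval_idt ?gval_src.
- move=> i j k ij jk ik x y e e'; apply: gval_inj => M.
  have h : src ik (idt jk (gval M x)) = tgt ik (idt jk (gval M y)).
    by rewrite -!gval_idt; exact: gval_match.
  rewrite gval_idt !gval_comp_match (idt_comp (gval_match M e) h).
  by apply: comp_congr; rewrite gval_idt.
- move=> i j k ij jk ik x y z w e1 e2 e3 e4 e5 e6; apply: gval_inj => M.
  have h1 := gval_match M e1; have h2 := gval_match M e2.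
  have h4 := gval_match M e4; have h5 := gval_match M e5.
  have h3 : src ik (comp h1) = tgt ik (comp h2).
    by rewrite -!gval_comp; exact: gval_match.
  have h6 : src jk (comp h4) = tgt jk (comp h5).
    by rewrite -!gval_comp; exact: gval_match.
  rewrite (gval_comp_match M e3) (gval_comp_match M e6); transitivity (comp h3).
    by apply: comp_congr; exact: gval_comp.
  rewrite (exchange ij h3 h6).
  by apply: comp_congr; rewrite -gval_comp.
Defined.

Definition gvalF M : ofunctor generated (U M).
Proof.
by exists (gval M) => *;
  [exact: gval_src | exact: gval_tgt | exact: gval_idt | exact: gval_comp].
Defined.

Lemma ggen_total k (g : G k) : total (tgen g).
Proof. by move=> M; exists (gv M g). Qed.

Definition ggen k (g : G k) : ar generated k := gcls (ggen_total g).

Lemma gval_gen M k (g : G k) : gvalF M k (ggen g) = gv M g.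
Proof. exact: gval_cls. Qed.

Lemma generated_ind (P : forall k, ar generated k -> Prop) :
  (forall k (g : G k), P k (ggen g)) ->
  (forall j k (jk : j < k) x, P k x -> P j (src jk x)) ->
  (forall j k (jk : j < k) x, P k x -> P j (tgt jk x)) ->
  (forall j k (jk : j < k) x, P j x -> P k (idt jk x)) ->
  (forall j k (jk : j < k) x y (e : src jk x = tgt jk y),
     P k x -> P k y -> P k (comp e)) ->
  forall k x, P k x.
Proof.
move=> Pg Ps Pt Pi Pc k x; rewrite (gcls_rep x).
elim: {x}(grep x) (grep_total x) => {k} [k g|j k jk t IH|j k jk t IH|j k jk t IH|j k jk t IHt u IHu] h.
- have -> : h = ggen_total g by exact: Prop_irrelevance.
  exact: Pg.
- have ht : total t by move=> M; have [_ [y ty _]] := h M; exists y.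
  suff -> : gcls h = src jk (gcls ht : ar generated k) by apply: Ps; exact: IH.
  apply: gval_inj => M; rewrite gval_src; have [_ [y ty _]] := h M.
  by apply: gval_cls; rewrite (gval_cls ht ty); exists y.
- have ht : total t by move=> M; have [_ [y ty _]] := h M; exists y.
  suff -> : gcls h = tgt jk (gcls ht : ar generated k) by apply: Pt; exact: IH.
  apply: gval_inj => M; rewrite gval_tgt; have [_ [y ty _]] := h M.
  by apply: gval_cls; rewrite (gval_cls ht ty); exists y.
- have ht : total t by move=> M; have [_ [y ty _]] := h M; exists y.
  suff -> : gcls h = idt jk (gcls ht : ar generated j) by apply: Pi; exact: IH.
  apply: gval_inj => M; rewrite gval_idt; have [_ [y ty _]] := h M.
  by apply: gval_cls; rewrite (gval_cls ht ty); exists y.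
- have ht : total t.
    by move=> M; have [_ [y [z [e [ty uz _]]]]] := h M; exists y.
  have hu : total u.
    by move=> M; have [_ [y [z [e [ty uz _]]]]] := h M; exists z.
  have e : src jk (gcls ht : ar generated k) = tgt jk (gcls hu : ar generated k).
    apply: gval_inj => M; rewrite gval_src gval_tgt.
    have [_ [y [z [e [ty uz _]]]]] := h M.
    by rewrite (gval_cls _ ty) (gval_cls _ uz).
  suff -> : gcls h = comp e by apply: Pc; [exact: IHt | exact: IHu].
  apply: gval_inj => M; rewrite gval_comp_match.
  have [_ [y [z [e' [ty uz _]]]]] := h M.
  apply: gval_cls; exists y, z, e'; split=> //.
  by apply: comp_congr; exact: gval_cls.
Qed.

Lemma generated_ext (C : omegacat) (F F' : ofunctor generated C) :
  (forall k (g : G k), F k (ggen g) = F' k (ggen g)) -> F = F'.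
Proof.
move=> h; apply: ofunctor_eq; apply: generated_ind => //.
- by move=> j k jk x e; rewrite !fmap_src e.
- by move=> j k jk x e; rewrite !fmap_tgt e.
- by move=> j k jk x e; rewrite !fmap_idt e.
- move=> j k jk x y e ex ey.
  have e1 : src jk (F k x) = tgt jk (F k y) by rewrite -fmap_src -fmap_tgt e.
  have e2 : src jk (F' k x) = tgt jk (F' k y) by rewrite -fmap_src -fmap_tgt e.
  by rewrite (fmap_comp _ e1) (fmap_comp _ e2); exact: comp_congr.
Qed.

Lemma generated_ncat n :
  (if n is Some m then
     forall k (mk : m < k) (g : G k), exists y : ar generated m, ggen g = idt mk y
   else True) -> is_ncat n generated.
Proof.
case: n => //= m hg.
suff H k (x : ar generated k) : forall mk : m < k, exists y : ar generated m, x = idt mk y.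
  by move=> k mk x; exact: H.
move: k x; apply: generated_ind => [k g mk|j k jk x IH mj|j k jk x IH mj|j k jk x IH mk|j k jk x y e IHx IHy mk].
- exact: hg.
- have [y ->] := IH (ltn_trans mj jk); exists y.
  by rewrite -(idt_idt mj jk (ltn_trans mj jk)) src_idt.
- have [y ->] := IH (ltn_trans mj jk); exists y.
  by rewrite -(idt_idt mj jk (ltn_trans mj jk)) tgt_idt.
- have [mj|jm|mj] := ltngtP m j.
  + have [y ->] := IH mj; exists y; exact: idt_idt.
  + by exists (idt jm x); rewrite idt_idt.
  + case: _ / mj jk x IH mk => jk x _ mk.
    by exists x; rewrite (bool_irrelevance jk mk).
- have [x' ex] := IHx mk; have [y' ey] := IHy mk.
  have [mj|jm|mj] := ltngtP m j.
  +  exists y'; rewrite -ey.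
    have ix : x = idt jk (src jk x).
      by rewrite ex -(idt_idt mj jk mk) src_idt.
    have iy : x = idt jk (tgt jk y) by rewrite -e.
    rewrite -[RHS](comp_idl (jk := jk)); first by rewrite src_idt.
    by move=> e'; exact: comp_congr.
  + have e' : src jm x' = tgt jm y'.
      rewrite -[x'](src_idt mk) -[y'](tgt_idt mk) -ex -ey.
      by rewrite (src_src _ _ jk) (tgt_tgt _ _ jk).
    have e1 : src jk (idt mk x') = tgt jk (idt mk y') by rewrite -ex -ey.
    by exists (comp e'); rewrite (idt_comp e' e1); exact: comp_congr.
  + case: _ / mj jk e => jk e.
    rewrite (bool_irrelevance mk jk) in ex ey *.
    exists y'; rewrite -ey.
    have iy : x = idt jk (tgt jk y) by rewrite -e ex src_idt.
    rewrite -[RHS](comp_idl (jk := jk)); first by rewrite src_idt.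
    by move=> e'; exact: comp_congr.
Qed.

End Generated.

Section Disk.
Variable k : nat.

Definition pointed := {C : omegacat & ar C k}.

Definition point (M : pointed) m (e : k = m) : ar (projT1 M) m :=
  ecast m (ar (projT1 M) m) e (projT2 M).

Definition disk : omegacat := generated point.

Definition dcell : ar disk k := ggen point erefl.

Definition disk_map (C : omegacat) (x : ar C k) : ofunctor disk C :=
  gvalF point (existT _ C x).

Lemma disk_corep (C : omegacat) (x : ar C k) :
  unique (fun F : ofunctor disk C => F k dcell = x) (disk_map x).
Proof.
split=> [|F Fx]; first exact: (gval_gen point (existT _ C x)).
apply: generated_ext => m g; case: _ / g.
by rewrite [RHS]Fx; exact: (gval_gen point (existT _ C x)).
Qed.

Lemma disk_ncat n : (if n is Some m then k <= m else true) -> is_ncat n disk.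
Proof.
case: n => // m km; apply: generated_ncat => /= l ml g.
by have := leq_trans ml (eq_leq (esym g)); rewrite ltnNge km.
Qed.

End Disk.

Definition sigma j k (jk : j < k) : ofunctor (disk j) (disk k) :=
  disk_map (src jk (dcell k)).

Definition tau j k (jk : j < k) : ofunctor (disk j) (disk k) :=
  disk_map (tgt jk (dcell k)).

(* A diagram indexed by a graph; its colimit is the colimit over the category
   freely generated by the graph. *)
Record diagram (C : category) := Diagram {
  vert : Type;
  edge : Type;
  edom : edge -> vert;
  ecod : edge -> vert;
  dob : vert -> C;
  dmor : forall e, hom (dob (edom e)) (dob (ecod e)) }.

Record cocone (C : category) (D : diagram C) := Cocone {
  apex : C;
  leg : forall v : vert D, hom (dob v) apex;
  legP : forall e : edge D, cmp (leg (ecod e)) (dmor e) = leg (edom e) }.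

Arguments Cocone {C D apex}.

Definition is_colimit (C : category) (D : diagram C) (K : cocone D) :=
  forall L : cocone D,
    exists! h : hom (apex K) (apex L), forall v, cmp h (leg K v) = leg L v.

Section Colimit.
Variable D : diagram oCat.

Let U (L : cocone D) : omegacat := apex L.
Let gens k := {v : vert D & ar (dob v : omegacat) k}.
Let gv (L : cocone D) k (g : gens k) : ar (U L) k :=
  (leg L (projT1 g) : ofunctor _ _) k (projT2 g).

Definition ocolim_apex : omegacat := generated gv.

Definition ocolim_in (v : vert D) k (x : ar (dob v : omegacat) k) : ar ocolim_apex k :=
  ggen gv (existT _ v x : gens k).

Lemma ocolim_inE (L : cocone D) (v : vert D) k (x : ar (dob v : omegacat) k) :
  gval L (ocolim_in x) = (leg L v : ofunctor _ _) k x.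
Proof. exact: gval_gen. Qed.

Definition ocolim_leg (v : vert D) : ofunctor (dob v) ocolim_apex.
Proof.
exists (@ocolim_in v).
- by move=> j k jk x; apply: gval_inj => L; rewrite gval_src !ocolim_inE fmap_src.
- by move=> j k jk x; apply: gval_inj => L; rewrite gval_tgt !ocolim_inE fmap_tgt.
- by move=> j k jk x; apply: gval_inj => L; rewrite gval_idt !ocolim_inE fmap_idt.
- move=> j k jk x y e e'; apply: gval_inj => L.
  have e1 : src jk ((leg L v : ofunctor _ _) k x) =
            tgt jk ((leg L v : ofunctor _ _) k y).
    by rewrite -fmap_src -fmap_tgt e.
  by rewrite gval_comp_match ocolim_inE (fmap_comp _ e1); apply: comp_congr; rewrite ocolim_inE.
Defined.

Lemma ocolim_legP (e : edge D) : ocomp (ocolim_leg (ecod e)) (dmor e) = ocolim_leg (edom e).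
Proof.
apply: ofunctor_eq => k x; apply: gval_inj => L.
by rewrite !ocolim_inE -(legP L e).
Qed.

Definition ocolim : cocone D := @Cocone oCat D ocolim_apex ocolim_leg ocolim_legP.

Lemma ocolimP : is_colimit ocolim.
Proof.
move=> L; exists (gvalF gv L : ofunctor ocolim_apex (U L)); split.
  by move=> v; apply: ofunctor_eq => k x; exact: gval_gen.
move=> h hL; apply: generated_ext => k [v x].
transitivity ((leg L v : ofunctor _ _) k x); first exact: gval_gen.
by rewrite -(hL v).
Qed.

Lemma ocolim_ncat n : (forall v : vert D, is_ncat n (dob v)) -> is_ncat n ocolim_apex.
Proof.
move=> h; apply: generated_ncat; case: n h => // m h k mk [v x].
have [y ->] := h v k mk x; exists (ocolim_leg v m y).
exact: (fmap_idt (ocolim_leg v) mk y).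
Qed.

End Colimit.

(* The table (k_1, k'_1, k_2, ..., k'_{m-1}, k_m) is encoded as the pair of k_1
   and of the sequence of the pairs (k'_i, k_{i+1}), for 0 < i < m. *)
Definition is_table (T : nat * seq (nat * nat)) : bool :=
  path (fun p q => (q.1 < p.2) && (q.1 < q.2)) (0, T.1) T.2.

Definition table := {T : nat * seq (nat * nat) | is_table T}.

Definition height (T : table) : nat :=
  maxn (sval T).1 (\max_(p <- (sval T).2) maxn p.1 p.2).

Section Zigzag.
Variable T : table.

(* The number m - 1 of the k'_i; indices are shifted by 1 in what follows:
   tk i is k_{i+1} for i <= tsize, and tk' i is k'_{i+1} for i < tsize. *)
Definition tsize : nat := size (sval T).2.
Definition tk (i : nat) : nat := nth 0 ((sval T).1 :: unzip2 (sval T).2) i.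
Definition tk' (i : nat) : nat := nth 0 (unzip1 (sval T).2) i.

Lemma tk'_lt i : i < tsize -> (tk' i < tk i) && (tk' i < tk i.+1).
Proof.
move=> iT; have /(pathP (0, 0))/(_ i iT) := svalP T.
rewrite /tk' /tk (nth_map (0, 0)) //= (nth_map (0, 0) 0 snd) //.
congr (_ && _); congr (_ < _); move: iT; rewrite /tsize.
by case: i => //= i iT; rewrite (nth_map (0, 0)) // ltnW.
Qed.

Lemma tk'_ltl (i : 'I_tsize) : tk' i < tk i.
Proof. by have /andP[] := tk'_lt (ltn_ord i). Qed.

Lemma tk'_ltr (i : 'I_tsize) : tk' i < tk i.+1.
Proof. by have /andP[] := tk'_lt (ltn_ord i). Qed.

Definition zigzag_ob (v : 'I_tsize.+1 + 'I_tsize) : omegacat :=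
  match v with inl i => disk (tk i) | inr i => disk (tk' i) end.

Definition zigzag : diagram oCat :=
  @Diagram oCat ('I_tsize.+1 + 'I_tsize)%type ('I_tsize + 'I_tsize)%type
    (fun e => match e with inl i => inr i | inr i => inr i end)
    (fun e => match e with
       | inl i => inl (widen_ord (leqnSn tsize) i)
       | inr i => inl (lift ord0 i)
       end)
    zigzag_ob
    (fun e => match e with
       | inl i => sigma (tk'_ltl i)
       | inr i => tau (tk'_ltr i)
       end).

Definition Theta_of : omegacat := apex (ocolim zigzag).

End Zigzag.

Definition Theta_table (n : option nat) :=
  {T : table | if n is Some m then height T <= m else true}.

Lemma tk_height (T : table) i : tk T i <= height T.
Proof.
rewrite /tk /height; case: i => [|i] /=; first exact: leq_maxl.
have [iT|iT] := ltnP i (size (unzip2 (sval T).2)); last by rewrite nth_default.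
have /mapP[p pT ->] := mem_nth 0 iT.
rewrite (leq_trans _ (leq_maxr _ _)) // (leq_trans (leq_maxr p.1 p.2)) //.
by apply: (leq_bigmax_seq (P := xpredT) (F := fun p => maxn p.1 p.2)).
Qed.

Lemma Theta_of_ncat n (T : Theta_table n) : is_ncat n (Theta_of (sval T)).
Proof.
case: T => T /= hT; apply: ocolim_ncat => -[] i; apply: disk_ncat.
  by case: n hT => // m; apply: leq_trans; exact: tk_height.
case: n hT => // m; apply: leq_trans.
exact: leq_trans (ltnW (tk'_ltl i)) (tk_height T i).
Qed.

Definition Theta_ob n (T : Theta_table n) : nCat n :=
  exist _ (Theta_of (sval T)) (Theta_of_ncat T).

Definition Theta n : category := full (@Theta_ob n).

Definition Theta_incl n : functor (Theta n) (nCat n) := full_incl (@Theta_ob n).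

(* Since Theta_n is a full subcategory of n-Cat, without isomorphisms other than
   the identities, there is exactly one such F. *)
Definition induced_op n (d : Z2n n) (F : functor (Theta n) (Theta n)) : Prop :=
  nat_iso (fcomp (Theta_incl n) F) (fcomp (opn d) (Theta_incl n)).

(* Main.v *)
Require Import Defs.
From mathcomp Require Import all_boot all_order all_algebra.
From mathcomp Require Import boolp functions.
From mathcomp Require Import zify.
Import Defs.

(** Why the theorem holds.

    Isomorphisms in Theta_n are identities (Theta_gaunt), so equivalences of
    Theta_n with itself are automorphisms, op_d is well defined as a functor, and it
    suffices to show that every automorphism is op_d for a unique d, and that
    the only natural transformations between the op_d are identities.

    Cells. Theta(T) is the free strict category on a T-shaped composable family of
    cells (diag_functor, gen_ind). A table that is not a single disk is cut
    at a smallest gluing dimension j; every cell of the glued category is a cell of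
    one of the halves or a composite, along dimension j, of a cell of the first half
    with one of the second (all_normal). Since both halves are retracts, it follows by
    induction that the cells of Theta(T) are separated by functors to disks, hence
    by functors to the boundary of a large globe (disks_separateP).

    Rigidity. The functors from Theta(T) to this globe form a finite set, which has a total
    order that can be described without the generators of Theta(T): compare in the lowest
    dimension where the functors differ. An isomorphism of Theta(S) with Theta(T)
    induces an isomorphism of the two finite chains, preserving the dimensions of
    the images. The sequence of these dimensions along the chain determines the table
    (lams_inj), so S = T; then functors to the globe are fixed and, as they separate
    cells, the isomorphism is the identity (auto_id).

    Automorphisms. Let F be an automorphism of Theta_n. By induction on k it fixes the disk
    D_k (fixes_disks): the retracts of a disk are smaller disks, whereas other tables have
    the shape of a composition of two cells among their retracts, and this shape
    has three top cells where a disk has two. Then F acts on the arrows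
    D_k -> D_{k+1} given by source and target, fixing or exchanging them; this is
    the signature of F. If it is trivial, F fixes all arrows between disks, and the
    universal property yields a natural transformation from the identity to F, which
    is invertible because its composite with the one for the inverse of F is an
    identity; by rigidity F is the identity. So automorphisms are determined by their
    signatures (same_sgn_eq). The same argument on disks shows that naturally related
    automorphisms have the same signature, and that a transformation is
    unique when it exists (nattrans_disk, nattrans_unique).

    Finally, every signature occurs: reversing the j-arrows of Theta(T) amounts to
    exchanging the two halves of T, for all cuts at dimension j (rev_Theta), and op_d
    has signature d (sgn_op). *)

Set Implicit Arguments.
Unset Strict Implicit.
Unset Printing Implicit Defensive.

(** * Cells of a fixed dimension *)

Lemma eq_of_nlt i k : ~ i < k -> ~ k < i -> k = i.
Proof. by case: (ltngtP i k). Qed.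

Section Resize.
Variable C : omegacat.

(** Iterated source (b = false) or target (b = true) when i < k, iterated
    identity when k < i: one operation makes the globular identities uniform. *)
Definition resize (b : bool) i k (x : ar C k) : ar C i :=
  match decP (@idP (i < k)), decP (@idP (k < i)) with
  | left h, _ => if b then tgt h x else src h x
  | _, left h => idt h x
  | right h, right h' => ecast m (ar C m) (eq_of_nlt h h') x
  end.

Lemma resize_lt b i k (ik : i < k) (x : ar C k) :
  resize b i x = if b then tgt ik x else src ik x.
Proof.
by rewrite /resize; case: (decP (@idP (i < k))) => // h; rewrite (bool_irrelevance h ik).
Qed.

Lemma resize_gt b i k (ki : k < i) (x : ar C k) : resize b i x = idt ki x.
Proof.
rewrite /resize; case: (decP (@idP (i < k))) => h.
  by move: (ltn_trans h ki); rewrite ltnn.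
by case: (decP (@idP (k < i))) => // h'; rewrite (bool_irrelevance h' ki).
Qed.

Lemma resize_id b k (x : ar C k) : resize b k x = x.
Proof.
rewrite /resize; case: (decP (@idP (k < k))) => h; first by exfalso; rewrite ltnn in h.
by rewrite (Prop_irrelevance (eq_of_nlt h h) erefl).
Qed.

Lemma resize_up b b' i k (x : ar C k) : k <= i -> resize b i x = resize b' i x.
Proof.
rewrite leq_eqVlt => /orP[/eqP e|ki]; last by rewrite !(resize_gt _ ki).
by case: _ / e; rewrite !resize_id.
Qed.

Lemma resize_down b b' i j k (x : ar C k) :
  i < j -> resize b i (resize b' j x) = resize b i x.
Proof.
move=> ij; have [jk|kj|e] := ltngtP j k; last first.
- by case: _ / e x => x; rewrite resize_id.
- rewrite (resize_gt _ kj) (resize_lt _ ij); have [ik|ki|e] := ltngtP i k.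
  + rewrite (resize_lt _ ik); case: b.
      by rewrite -(tgt_tgt ik kj ij) tgt_idt.
    by rewrite -(src_src ik kj ij) src_idt.
  + by rewrite (resize_gt _ ki) -(idt_idt ki ij kj) tgt_idt src_idt if_same.
  + case: _ / e x kj => x kj; rewrite (bool_irrelevance kj ij) resize_id.
    by rewrite tgt_idt src_idt if_same.
- have ik := ltn_trans ij jk; rewrite (resize_lt _ ij) (resize_lt _ jk) (resize_lt _ ik).
  case: b; case: b'; first exact: tgt_tgt.
  - exact: tgt_src.
  - exact: src_tgt.
  - exact: src_src.
Qed.

Lemma resize_resize b b' i j k (x : ar C k) :
  k <= j -> resize b i (resize b' j x) = resize b i x.
Proof.
rewrite leq_eqVlt => /orP[/eqP e|kj]; first by case: _ / e; rewrite resize_id.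
have [ij|ji|e] := ltngtP i j; first exact: resize_down.
  by rewrite (resize_gt _ ji) (resize_gt _ kj) (resize_gt _ (ltn_trans kj ji)) (idt_idt kj ji (ltn_trans kj ji)).
by case: _ / e kj => ki; rewrite resize_id; apply: resize_up; exact: ltnW.
Qed.

End Resize.

Lemma fmap_resize C D (F : ofunctor C D) b i k (x : ar C k) :
  F i (resize b i x) = resize b i (F k x).
Proof.
have [ik|ki|e] := ltngtP i k.
- by rewrite !(resize_lt _ ik); case: b; rewrite ?fmap_src ?fmap_tgt.
- by rewrite !(resize_gt _ ki) fmap_idt.
- by case: _ / e x => x; rewrite !resize_id.
Qed.

Section Level.
Variables (C : omegacat) (K : nat).
Implicit Types x y z w : ar C K.

(** Lower-dimensional cells are handled through their identities of dimension K,
    so that all boundaries and composites of K-cells are again K-cells. *)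
Definition bd b j x : ar C K := resize b K (resize b j x).

Definition dimle k x := bd false k x = x.

Definition composable j x y := j < K /\ bd false j x = bd true j y.

(** Composition as a total operation, so that composites can be rewritten without
    carrying proofs of composability along. *)
Definition cp j x y : ar C K :=
  match pselect (exists jk : j < K, src jk x = tgt jk y) with
  | left h => comp (projT2 (cid h))
  | right _ => x
  end.

Lemma bd_resize b b' j k (u : ar C k) : k <= K ->
  bd b j (resize b' K u) = resize b K (resize b j u).
Proof. by move=> kK; rewrite /bd (resize_resize b b' j u kK). Qed.

Lemma bd_ge b j x : K <= j -> bd b j x = x.
Proof. by move=> Kj; rewrite /bd resize_resize // resize_id. Qed.

Lemma bd_bd b b' i j x :
  bd b i (bd b' j x) = if i < j then bd b i x else bd b' j x.
Proof.
have [Kj|jK] := leqP K j.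
  rewrite (bd_ge b' x Kj); case: ltnP => // ji.
  by apply: bd_ge; exact: leq_trans Kj ji.
rewrite {1 2}/bd (resize_resize b b' i (resize b' j x) (ltnW jK)).
have [ij|ji] := ltnP i j; first by rewrite (resize_down b b' x ij).
rewrite (resize_up b b' (resize b' j x) ji) (resize_resize _ _ _ _ ji) /bd.
by apply: resize_up; exact: ltnW.
Qed.

Lemma dimleP b i k x : dimle k x -> k <= i -> bd b i x = x.
Proof. by move=> <- ki; rewrite bd_bd ltnNge ki. Qed.

Lemma dimle_bd b i k x : i <= k -> dimle k (bd b i x).
Proof. by move=> ik; rewrite /dimle bd_bd ltnNge ik. Qed.

Lemma dimle_leq i k x : i <= k -> dimle i x -> dimle k x.
Proof. by move=> ik xi; apply: dimleP ik. Qed.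

Lemma dimleK x : dimle K x.
Proof. by rewrite /dimle bd_ge. Qed.

Lemma bd_src j (jK : j < K) x : bd false j x = idt jK (src jK x).
Proof. by rewrite /bd (resize_lt _ jK) (resize_gt _ jK). Qed.

Lemma bd_tgt j (jK : j < K) x : bd true j x = idt jK (tgt jK x).
Proof. by rewrite /bd (resize_lt _ jK) (resize_gt _ jK). Qed.

Lemma composableE j (jK : j < K) x y : composable j x y <-> src jK x = tgt jK y.
Proof.
rewrite /composable (bd_src jK) (bd_tgt jK); split=> [[_ e]|->//].
by rewrite -(src_idt jK (src jK x)) e src_idt.
Qed.

Lemma cpE j (jK : j < K) x y (e : src jK x = tgt jK y) : cp j x y = comp e.
Proof.
rewrite /cp; case: pselect => [h|]; last by case; exists jK.
by apply: comp_congr.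
Qed.

Lemma bd_cp0 i j x y : composable j x y -> i <= j -> bd false i (cp j x y) = bd false i y.
Proof.
move=> xy; have [jK _] := xy; have e := (composableE jK x y).1 xy; rewrite leq_eqVlt.
have E : bd false j (cp j x y) = bd false j y.
  by rewrite (cpE e) !(bd_src jK) src_comp.
move=> /orP[/eqP->//|ij].
by have := bd_bd false false i j (cp j x y); rewrite ij => <-; rewrite E bd_bd ij.
Qed.

Lemma bd_cp1 i j x y : composable j x y -> i <= j -> bd true i (cp j x y) = bd true i x.
Proof.
move=> xy; have [jK _] := xy; have e := (composableE jK x y).1 xy; rewrite leq_eqVlt.
have E : bd true j (cp j x y) = bd true j x.
  by rewrite (cpE e) !(bd_tgt jK) tgt_comp.
move=> /orP[/eqP->//|ij].
by have := bd_bd true true i j (cp j x y); rewrite ij => <-; rewrite E bd_bd ij.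
Qed.

Lemma composable_lt b i j x y : composable j x y -> i < j -> bd b i x = bd b i y.
Proof.
move=> [_ e] ij; have := bd_bd b false i j x; rewrite ij => <-.
by rewrite e bd_bd ij.
Qed.

Lemma bd_cp_lt b i j x y : composable j x y -> i < j -> bd b i (cp j x y) = bd b i x.
Proof.
move=> xy ij; case: b; first by rewrite bd_cp1 // ltnW.
by rewrite bd_cp0 ?(ltnW ij) // -(composable_lt _ xy).
Qed.

Lemma composable_bd b i j x y : composable j x y -> j < i -> composable j (bd b i x) (bd b i y).
Proof. by move=> [jK e] ji; split=> //; rewrite !bd_bd ji. Qed.

Lemma bd_cp_gt b i j x y : composable j x y -> j < i ->
  bd b i (cp j x y) = cp j (bd b i x) (bd b i y).
Proof.
move=> xy ji; have [Ki|iK] := leqP K i; first by rewrite !bd_ge.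
have [jK _] := xy; have e := (composableE jK x y).1 xy.
rewrite (cpE e); have xy' := composable_bd b xy ji.
have e' := (composableE jK _ _).1 xy'; rewrite (cpE e').
case: b xy' e' => xy' e'.
  have h : src ji (tgt iK x) = tgt ji (tgt iK y).
    by rewrite (src_tgt _ _ jK) (tgt_tgt _ _ jK).
  rewrite (bd_tgt iK) (tgt_comp_gt e h).
  have h' : src jK (idt iK (tgt iK x)) = tgt jK (idt iK (tgt iK y)).
    by rewrite -!(bd_tgt iK).
  by rewrite (idt_comp h h'); apply: comp_congr; rewrite (bd_tgt iK).
have h : src ji (src iK x) = tgt ji (src iK y).
  by rewrite (src_src _ _ jK) (tgt_src _ _ jK).
rewrite (bd_src iK) (src_comp_gt e h).
have h' : src jK (idt iK (src iK x)) = tgt jK (idt iK (src iK y)).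
  by rewrite -!(bd_src iK).
by rewrite (idt_comp h h'); apply: comp_congr; rewrite (bd_src iK).
Qed.

Lemma cp_dimlel j x y : composable j x y -> dimle j x -> cp j x y = y.
Proof.
move=> xy xj; have [jK E] := xy; have e := (composableE jK x y).1 xy.
rewrite (cpE e) -[RHS](comp_idl (jk := jK)); first by rewrite src_idt.
by move=> e'; apply: comp_congr => //; rewrite -(bd_tgt jK) -E.
Qed.

Lemma cp_dimler j x y : composable j x y -> dimle j y -> cp j x y = x.
Proof.
move=> xy yj; have [jK E] := xy; have e := (composableE jK x y).1 xy.
rewrite (cpE e) -[RHS](comp_idr (jk := jK)); first by rewrite tgt_idt.
by move=> e'; apply: comp_congr => //; rewrite -(bd_src jK) E (dimleP _ yj).
Qed.

Lemma cpA j x y z : composable j x y -> composable j y z ->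
  cp j (cp j x y) z = cp j x (cp j y z).
Proof.
move=> xy yz; have [jK _] := xy.
have xyz : composable j (cp j x y) z.
  by split=> //; rewrite bd_cp0 // (yz.2).
have xyz' : composable j x (cp j y z).
  by split=> //; rewrite bd_cp1 // (xy.2).
have e1 := (composableE jK _ _).1 xy; have e3 := (composableE jK _ _).1 yz.
have e2 := (composableE jK _ _).1 xyz; have e4 := (composableE jK _ _).1 xyz'.
rewrite (cpE e2) (cpE e4).
have e2' : src jK (comp e1) = tgt jK z by rewrite src_comp.
have e4' : src jK x = tgt jK (comp e3) by rewrite tgt_comp.
rewrite (@comp_congr _ _ _ _ jK _ _ _ _ e2 e2') ?cpE //.
by rewrite (comp_assoc e2' e4'); apply: comp_congr; rewrite // cpE.
Qed.

Lemma cp_exchange i j x y z w : i < j ->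
  composable j x y -> composable j z w ->
  composable i x z -> composable i y w ->
  cp i (cp j x y) (cp j z w) = cp j (cp i x z) (cp i y w).
Proof.
move=> ij xy zw xz yw; have [jK _] := xy; have [iK _] := xz.
have e1 := (composableE jK _ _).1 xy; have e2 := (composableE jK _ _).1 zw.
have e4 := (composableE iK _ _).1 xz; have e5 := (composableE iK _ _).1 yw.
have e3 : src iK (comp e1) = tgt iK (comp e2).
  apply/(composableE iK); split=> //; rewrite -!cpE.
  by rewrite !bd_cp_lt // xz.2.
have e6 : src jK (comp e4) = tgt jK (comp e5).
  apply/(composableE jK); split=> //; rewrite -!cpE !bd_cp_gt //.
  by rewrite xy.2 zw.2.
have -> : cp i (cp j x y) (cp j z w) = comp e3 by rewrite (cpE e1) (cpE e2); exact: cpE.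
have -> : cp j (cp i x z) (cp i y w) = comp e6 by rewrite (cpE e4) (cpE e5); exact: cpE.
exact: exchange.
Qed.

End Level.

Lemma fmap_bd C D (F : ofunctor C D) K b j (x : ar C K) : F K (bd b j x) = bd b j (F K x).
Proof. by rewrite /bd !fmap_resize. Qed.

Lemma fmap_dimle C D (F : ofunctor C D) K k (x : ar C K) : dimle k x -> dimle k (F K x).
Proof. by rewrite /dimle -fmap_bd => ->. Qed.

Lemma fmap_composable C D (F : ofunctor C D) K j (x y : ar C K) :
  composable j x y -> composable j (F K x) (F K y).
Proof. by case=> jK e; split=> //; rewrite -!fmap_bd e. Qed.

Lemma fmap_cp C D (F : ofunctor C D) K j (x y : ar C K) :
  composable j x y -> F K (cp j x y) = cp j (F K x) (F K y).
Proof.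
move=> xy; have [jK _] := xy; have e := (composableE jK _ _).1 xy.
have e' := (composableE jK _ _).1 (fmap_composable F xy).
by rewrite (cpE e) (cpE e') (fmap_comp _ e').
Qed.

(** * The universal property of Theta(T) *)

(** The T-shaped composable families: the i-th cell has dimension tk T i, and its
    source of dimension tk' T i is the target of the next one. *)
Definition diag (C : omegacat) K (T : table) (y : nat -> ar C K) :=
  (forall i, i <= tsize T -> dimle (tk T i) (y i)) /\
  (forall i, i < tsize T -> bd false (tk' T i) (y i) = bd true (tk' T i) (y i.+1)).

Lemma fmap_diag C D (F : ofunctor C D) K T (y : nat -> ar C K) :
  diag T y -> diag T (fun i => F K (y i)).
Proof.
case=> yd ym; split=> i iT; first exact/fmap_dimle/yd.
by rewrite -!fmap_bd ym.
Qed.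

#[local] Arguments disk_map : simpl never.
#[local] Arguments dcell : simpl never.
#[local] Arguments ocolim : simpl never.

Lemma ocompE C D E (F : ofunctor D E) (G : ofunctor C D) k (x : ar C k) :
  ocomp F G k x = F k (G k x).
Proof. by []. Qed.

Lemma disk_map_cell k (C : omegacat) (x : ar C k) : disk_map x k (dcell k) = x.
Proof. by have [] := disk_corep x. Qed.

Lemma disk_mapE k (C : omegacat) (F : ofunctor (disk k) C) : F = disk_map (F k (dcell k)).
Proof. by have [_ h] := disk_corep (F k (dcell k)); exact/esym/h. Qed.

Section Universal.
Variables (T : table) (K : nat).
Hypothesis TK : height T <= K.

Let tkK i : tk T i <= K := leq_trans (tk_height T i) TK.

Definition mcell (i : 'I_(tsize T).+1) : ar (Theta_of T) (tk T i) :=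
  (leg (ocolim (zigzag T)) (inl i) : ofunctor (disk (tk T i)) (Theta_of T)) _ (dcell _).

(** The maximal cells, raised to dimension K. Indexing them by nat avoids transports
    between ordinals; statements about gen i assume i <= tsize T. *)
Definition gen i : ar (Theta_of T) K := resize false K (mcell (inord i)).

Lemma genE (i : 'I_(tsize T).+1) : gen i = resize false K (mcell i).
Proof. by rewrite /gen inord_val. Qed.

Lemma mcellE i : mcell i = resize false (tk T i) (gen i).
Proof. by rewrite genE resize_resize // resize_id. Qed.

Lemma mcell_edge (i : 'I_(tsize T)) :
  let F := leg (ocolim (zigzag T)) (inr i) : ofunctor (disk (tk' T i)) (Theta_of T) in
  F _ (dcell _) = src (tk'_ltl i) (mcell (widen_ord (leqnSn _) i)) /\
  F _ (dcell _) = tgt (tk'_ltr i) (mcell (lift ord0 i)).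
Proof.
have A := legP (ocolim (zigzag T)) (inl i : edge (zigzag T)).
have B := legP (ocolim (zigzag T)) (inr i : edge (zigzag T)).
move=> F; split.
  transitivity ((leg (ocolim (zigzag T)) (inl (widen_ord (leqnSn _) i)) :
    ofunctor (disk (tk T i)) (Theta_of T)) _ (sigma (tk'_ltl i) _ (dcell _))).
    by rewrite /F -A.
  by rewrite /sigma disk_map_cell fmap_src.
transitivity ((leg (ocolim (zigzag T)) (inl (lift ord0 i)) :
  ofunctor (disk (tk T i.+1)) (Theta_of T)) _ (tau (tk'_ltr i) _ (dcell _))).
  by rewrite /F -B.
by rewrite /tau disk_map_cell fmap_tgt.
Qed.

Lemma gen_diag : diag T gen.
Proof.
split=> i iT.
  have -> : i = (inord i : 'I_(tsize T).+1) by rewrite inordK.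
  by rewrite genE /dimle bd_resize // resize_id.
have [A B] := mcell_edge (Ordinal iT).
have ltl := tk'_ltl (Ordinal iT); have ltr := tk'_ltr (Ordinal iT).
have -> : gen i = resize false K (mcell (widen_ord (leqnSn _) (Ordinal iT))).
  by rewrite -genE.
have -> : gen i.+1 = resize false K (mcell (lift ord0 (Ordinal iT))).
  by rewrite -genE.
rewrite (bd_resize _ _ _ _ (tkK i)) (bd_resize _ _ _ _ (tkK i.+1)).
rewrite (resize_lt false ltl) (bool_irrelevance ltl (tk'_ltl (Ordinal iT))) -A.
rewrite (resize_lt true ltr) (bool_irrelevance ltr (tk'_ltr (Ordinal iT))) -B.
by apply: resize_up; rewrite (leq_trans (ltnW ltl)) //; exact: tkK.
Qed.

(** This is the universal property of the colimit, disks corepresenting cells. *)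
Lemma diag_functor (C : omegacat) (y : nat -> ar C K) : diag T y ->
  exists F : ofunctor (Theta_of T) C, forall i, i <= tsize T -> F K (gen i) = y i.
Proof.
move=> [yd ym].
pose lg (v : vert (zigzag T)) : ofunctor (zigzag_ob v) C :=
  match v return ofunctor (zigzag_ob v) C with
  | inl i => disk_map (resize false (tk T i) (y i))
  | inr i => disk_map (resize false (tk' T i) (y i))
  end.
have lgP (e : edge (zigzag T)) : ocomp (lg (ecod e)) (dmor e) = lg (edom e).
  case: e => i; rewrite /= /sigma /tau [LHS]disk_mapE ocompE disk_map_cell.
    rewrite fmap_src disk_map_cell; congr disk_map.
    by rewrite -(resize_down false false _ (tk'_ltl i)) (resize_lt _ (tk'_ltl i)).
  rewrite fmap_tgt disk_map_cell; congr disk_map.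
  have ltl := tk'_ltl i; have ltr := tk'_ltr i.
  have tK : tk' T i <= K by rewrite (leq_trans (ltnW ltl)).
  transitivity (resize true (tk' T i) (y i.+1)).
    by rewrite -(resize_down true false _ (tk'_ltr i)) (resize_lt _ (tk'_ltr i)).
  have := congr1 (fun z : ar C K => resize false (tk' T i) z) (ym i (ltn_ord i)).
  by rewrite /bd !(resize_resize _ _ _ _ tK) !resize_id.
pose L := @Cocone oCat (zigzag T) C lg lgP.
have [F [FL _]] := @ocolimP (zigzag T) L.
exists F => i iT.
have -> : gen i = gen (inord i : 'I_(tsize T).+1) by rewrite inordK.
rewrite genE fmap_resize.
pose v : 'I_(tsize T).+1 := inord i.
have E : F _ (mcell v) = resize false (tk T v) (y v).
  transitivity ((leg L (inl v) : ofunctor (disk (tk T v)) C) _ (dcell _)).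
    by rewrite -(FL (inl v)).
  exact: disk_map_cell.
by rewrite E /v inordK // -[RHS](yd i iT).
Qed.

(** Induction on the way a cell of the colimit is generated, proving P for all
    its boundaries or identities in dimension K. This works since K bounds the
    dimension of all generators. *)
Lemma gen_ind (P : ar (Theta_of T) K -> Prop) :
  (forall i, i <= tsize T -> P (gen i)) ->
  (forall b j x, j < K -> P x -> P (bd b j x)) ->
  (forall j x y, composable j x y -> P x -> P y -> P (cp j x y)) ->
  forall x, P x.
Proof.
move=> Pg Pb Pc.
pose Q k (x : ar (Theta_of T) k) := forall b, P (resize b K x).
suff H : forall k (x : ar (Theta_of T) k), Q k x by move=> x; have := H K x false; rewrite resize_id.
have Qr b j k (x : ar (Theta_of T) k) : j < k -> Q k x -> Q j (resize b j x).
  move=> jk Qx b'; have [jK|Kj|e] := ltngtP j K.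
  - have := Pb b j _ jK (Qx b).
    by rewrite /bd (resize_down b b x jK) (resize_up b b' (resize b j x) (ltnW jK)).
  - by rewrite (resize_down _ _ _ Kj); exact: Qx.
  - by subst j; rewrite resize_id; exact: Qx.
have Qs j k (jk : j < k) x : Q k x -> Q j (src jk x).
  by move=> Qx; rewrite -(resize_lt false jk); exact: Qr.
have Qt j k (jk : j < k) x : Q k x -> Q j (tgt jk x).
  by move=> Qx; rewrite -(resize_lt true jk); exact: Qr.
have Qi j k (jk : j < k) x : Q j x -> Q k (idt jk x).
  by move=> Qx b; rewrite -(resize_gt false jk) resize_resize //; exact: ltnW.
have Qc j k (jk : j < k) (x y : ar (Theta_of T) k) (e : src jk x = tgt jk y) :
    Q k x -> Q k y -> Q k (comp e).
  move=> Qx Qy b; have [jK|Kj|jK] := ltngtP j K; first last.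
  - subst j; rewrite (resize_lt _ jk).
    case: b; first by rewrite tgt_comp -(resize_lt true jk).
    by rewrite src_comp -(resize_lt false jk).
  - have Kk := ltn_trans Kj jk; rewrite (resize_lt _ Kk); case: b.
      rewrite -(tgt_tgt Kj jk Kk) tgt_comp (tgt_tgt Kj jk Kk).
      by rewrite -(resize_lt true Kk).
    rewrite -(src_src Kj jk Kk) src_comp (src_src Kj jk Kk).
    by rewrite -(resize_lt false Kk).
  have E b' : composable j (resize b' K x) (resize b' K y).
    split=> //; have [kK|Kk] := leqP k K.
      by rewrite !(bd_resize _ _ _ _ kK) !(resize_lt _ jk) e !(resize_gt _ jK).
    by rewrite /bd !(resize_down _ _ _ jK) !(resize_lt _ jk) e !(resize_gt _ jK).
  suff -> : resize b K (comp e) = cp j (resize b K x) (resize b K y) by exact: Pc.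
  have h := (composableE jK _ _).1 (E b); rewrite (cpE h).
  have [kK|Kk|kK] := ltngtP k K.
  - have h' : src jK (idt kK x) = tgt jK (idt kK y) by move: h; rewrite !(resize_gt _ kK).
    rewrite (resize_gt _ kK) (idt_comp e h'); apply: comp_congr;
    by rewrite (resize_gt _ kK).
  - move: h; rewrite !(resize_lt _ Kk); case: b => h.
      by rewrite (tgt_comp_gt e h).
    by rewrite (src_comp_gt e h).
  - subst k; rewrite (resize_id b (comp e)).
    by apply: comp_congr; rewrite resize_id.
apply: generated_ind => [k [v x]| | | |]; [|exact: Qs|exact: Qt|exact: Qi|exact: Qc].
pose lg := leg (ocolim (zigzag T)) v : ofunctor (zigzag_ob v) (Theta_of T).
suff H : forall k (x : ar (zigzag_ob v) k), Q k (lg k x) by exact: (H k x).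
case: v @lg {x} => i lg; apply: generated_ind.
- move=> m e; case: _ / e => b.
  have := Pg i (ltn_ord i); rewrite genE; rewrite (resize_up false b) //; exact.
- by move=> j m jm x; rewrite fmap_src; exact: Qs.
- by move=> j m jm x; rewrite fmap_tgt; exact: Qt.
- by move=> j m jm x; rewrite fmap_idt; exact: Qi.
- move=> j m jm x y e Qx Qy.
  have e' : src jm (lg m x) = tgt jm (lg m y) by rewrite -fmap_src -fmap_tgt e.
  by rewrite (fmap_comp _ e'); exact: Qc.
- move=> m e; case: _ / e.
  have [-> _] := mcell_edge i; apply: Qs => b.
  have := Pg i (ltnW (ltn_ord i)).
  have -> : gen i = gen (widen_ord (leqnSn _) i) by [].
  by rewrite genE; rewrite (resize_up false b) //; exact: tkK.
- by move=> j m jm x; rewrite fmap_src; exact: Qs.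
- by move=> j m jm x; rewrite fmap_tgt; exact: Qt.
- by move=> j m jm x; rewrite fmap_idt; exact: Qi.
- move=> j m jm x y e Qx Qy.
  have e' : src jm (lg m x) = tgt jm (lg m y) by rewrite -fmap_src -fmap_tgt e.
  by rewrite (fmap_comp _ e'); exact: Qc.
Qed.

Lemma functor_eqK (C : omegacat) (F G : ofunctor (Theta_of T) C) :
  (forall i, i <= tsize T -> F K (gen i) = G K (gen i)) -> F = G.
Proof.
move=> FG; have E i : F _ (mcell i) = G _ (mcell i).
  by rewrite mcellE (fmap_resize F) (fmap_resize G) FG // -ltnS.
pose D := zigzag T.
pose lg (v : vert D) : ofunctor (zigzag_ob v) C :=
  ocomp F (leg (ocolim (zigzag T)) v : ofunctor (zigzag_ob v) (Theta_of T)).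
have lgP (e : edge (zigzag T)) : ocomp (lg (ecod e)) (dmor e) = lg (edom e).
  by rewrite /lg -(legP (ocolim (zigzag T)) e); exact: ofunctor_eq.
pose L := @Cocone oCat (zigzag T) C lg lgP.
have [H [_ HU]] := @ocolimP (zigzag T) L.
rewrite -(HU F) //; apply: HU => v.
suff : ocomp G (leg (ocolim (zigzag T)) v : ofunctor (zigzag_ob v) (Theta_of T)) = lg v by [].
case: v => i; rewrite [LHS]disk_mapE [RHS]disk_mapE /=; congr disk_map.
  by rewrite -(E i).
have [e _] := mcell_edge i.
transitivity (src (tk'_ltl i) (G _ (mcell (widen_ord (leqnSn _) i)))).
  by rewrite -fmap_src -e.
by rewrite -E -fmap_src -e.
Qed.

Lemma functor_eq_cells (C : omegacat) (F G : ofunctor (Theta_of T) C) :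
  (forall x : ar (Theta_of T) K, F K x = G K x) -> F = G.
Proof. by move=> FG; apply: functor_eqK. Qed.

End Universal.
Arguments gen T K i : clear implicits.

(* From here on, Theta(T) is used through its universal property. *)
Opaque gen Theta_of.

(** * A test category: the boundary of a globe *)

Section Globe.
Variable N : nat.

(** The cells of the boundary of the (N+1)-globe are the positions 0, ..., 2N+1.
    For j <= N, the positions j and 2N+1-j are the two cells of dimension j, the source and target of
    all positions strictly between them. When composing x and y along dimension
    j, at most one of them has dimension greater than j, and the composite is this one:
    otherwise j, the source of x, would be 2N+1-j, the target of y. Equations in
    such a category are statements of linear arithmetic. *)

Definition mid j z := (j < z) && (z + j < 2 * N + 1).

Definition bpos (b : bool) j z :=
  if mid j z then (if b then 2 * N + 1 - j else j) else z.

Definition gcell k := {z : nat | (z <= 2 * N + 1) && ((z <= k) || (2 * N + 1 <= z + k))}.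

Lemma bpos_cell b j k (z : gcell k) :
  (bpos b j (sval z) <= 2 * N + 1) && ((bpos b j (sval z) <= j) || (2 * N + 1 <= bpos b j (sval z) + j)).
Proof. by case: z => z /= zk; rewrite /bpos /mid; case: b; case: ifP; lia. Qed.

Definition gbd b j k (z : gcell k) : gcell j := exist _ (bpos b j (sval z)) (bpos_cell b j z).

Lemma gup_cell j k (jk : j < k) (z : gcell j) :
  (sval z <= 2 * N + 1) && ((sval z <= k) || (2 * N + 1 <= sval z + k)).
Proof. by case: z => z /= zj; lia. Qed.

Definition gup j k (jk : j < k) (z : gcell j) : gcell k := exist _ (sval z) (gup_cell jk z).

Definition gcpv j x y := if mid j x then x else y.

Lemma gcp_cell j k (x y : gcell k) : let z := gcpv j (sval x) (sval y) in
  (z <= 2 * N + 1) && ((z <= k) || (2 * N + 1 <= z + k)).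
Proof. by case: x y => x xk [y yk] /=; rewrite /gcpv; case: ifP. Qed.

Definition gcp j k (x y : gcell k) : gcell k :=
  exist _ (gcpv j (sval x) (sval y)) (gcp_cell j x y).

Lemma mid_match i j x y : i < j -> bpos false j x = bpos true j y -> mid i x = mid i y.
Proof. by move=> ij; rewrite /bpos; case: ifP; case: ifP; rewrite /mid; lia. Qed.

Lemma gcpv_exchange i j x y z w : mid i x = mid i y ->
  gcpv i (gcpv j x y) (gcpv j z w) = gcpv j (gcpv i x z) (gcpv i y w).
Proof.
rewrite /gcpv => m; rewrite -m; case mi: (mid i x); rewrite mi in m.
  by case: (mid j x); rewrite ?mi -?m.
by case: (mid j x); rewrite ?mi -?m.
Qed.

Ltac globe_lia :=
  intros; simpl in *; apply: val_inj; simpl;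
  repeat match goal with H : @eq (gcell _) ?a ?b |- _ =>
    have {}H : val a = val b := congr1 val H; simpl in H end;
  unfold gcpv, bpos in *;
  repeat match goal with
    | |- context [if ?b then _ else _] => destruct b eqn:?
    | H : context [if ?b then _ else _] |- _ => destruct b eqn:? end;
  unfold mid in *; try (by lia);
  match goal with x : gcell _ |- _ => destruct x as [x ?]; simpl in *; by lia end.

Definition globe : omegacat.
Proof.
refine (@OmegaCat gcell (fun j k _ => @gbd false j k) (fun j k _ => @gbd true j k)
  gup (fun j k _ x y _ => gcp j x y) _ _ _ _ _ _ _ _ _ _ _ _ _ _ _ _).
16: by move=> i j k ij jk ik x y z w e1 e2 e3 e4 e5 e6; apply/val_inj/gcpv_exchange;
  apply: mid_match ij _; exact: (congr1 sval e1).
all: abstract globe_lia.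
Defined.
End Globe.

Lemma sval_bd N K b j (x : ar (globe N) K) : sval (bd b j x) = bpos N b j (sval x).
Proof.
have [jK|Kj] := ltnP j K.
  by case: b; rewrite ?(bd_tgt jK) ?(bd_src jK).
rewrite bd_ge //; case: x => x /= xK; rewrite /bpos; case: ifP => //; rewrite /mid; lia.
Qed.

Lemma sval_cp N K j (x y : ar (globe N) K) :
  composable j x y -> sval (cp j x y) = gcpv N j (sval x) (sval y).
Proof. by move=> xy; have [jK _] := xy; rewrite (cpE ((composableE jK x y).1 xy)). Qed.

Lemma globe_cell_subproof N z : z <= 2 * N + 1 ->
  (z <= 2 * N + 1) && ((z <= N) || (2 * N + 1 <= z + N)).
Proof. lia. Qed.

Definition globe_cell N z (h : z <= 2 * N + 1) : ar (globe N) N :=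
  exist _ z (globe_cell_subproof h).

(** The families diag T of cells of the globe, in terms of positions. *)
Definition ediag K (T : table) (zs : nat -> nat) :=
  (forall i, i <= tsize T -> zs i <= 2 * K + 1 /\ ~~ mid K (tk T i) (zs i)) /\
  (forall i, i < tsize T -> bpos K false (tk' T i) (zs i) = bpos K true (tk' T i) (zs i.+1)).

Lemma globe_functor T K zs : height T <= K -> ediag K T zs ->
  exists F : ofunctor (Theta_of T) (globe K),
    forall i, i <= tsize T -> sval (F K (gen T K i)) = zs i.
Proof.
move=> TK [zd zm].
have zle i : minn (zs i) (2 * K + 1) <= 2 * K + 1 by exact: geq_minr.
have zE i : i <= tsize T -> minn (zs i) (2 * K + 1) = zs i.
  by move=> iT; apply/minn_idPl; case: (zd i iT).
have D : diag T (fun i => globe_cell (zle i)).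
  split=> i iT; apply: val_inj; rewrite /= !sval_bd /= !zE //; last 2 first.
  - exact: zm.
  - exact: ltnW.
  by rewrite /bpos; have [_ /negbTE->] := zd i iT.
have [F FE] := diag_functor TK D; exists F => i iT.
by rewrite FE //= zE.
Qed.

Lemma functor_ediag T K (F : ofunctor (Theta_of T) (globe K)) : height T <= K ->
  ediag K T (fun i => sval (F K (gen T K i))).
Proof.
move=> TK; have [D M] := fmap_diag F (gen_diag TK).
split=> i iT; last by have := congr1 sval (M i iT); rewrite !sval_bd.
case: (F K (gen T K i)) (D i iT) => z /= zK /(congr1 sval); rewrite sval_bd /bpos /= => zE.
by split; [lia|move: zE; case: ifP => //; rewrite /mid; lia].
Qed.

(** * Low and high cells *)

(** All entries of T are at least j, so that Theta(T) is obtained by gluing along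
    cells of dimension at least j and looks like a disk in lower dimensions. *)
Definition deep j (T : table) :=
  (forall i, i <= tsize T -> j <= tk T i) /\ (forall i, i < tsize T -> j <= tk' T i).

Lemma deep_height j T : deep j T -> j <= height T.
Proof. by case=> /(_ 0 isT) h _; exact: leq_trans h (tk_height T 0). Qed.

Section Dichotomy.
Variables (T : table) (K j : nat).
Hypotheses (TK : height T <= K) (jT : deep j T).
Let X := Theta_of T.
Let g := gen T K.

Lemma bd_gen b l i : l < j -> i <= tsize T -> bd b l (g i) = bd b l (g 0).
Proof.
move=> lj; elim: i => // i IH iT; have [_ /(_ i iT) E] := gen_diag TK.
have lt : l < tk' T i by apply: leq_trans lj _; case: jT => _; apply.
have := bd_bd b true l (tk' T i) (g i.+1); rewrite lt => <-.
by rewrite -E bd_bd lt IH // ltnW.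
Qed.

Lemma bd_gen_neq l : l < j -> bd false l (g 0) <> bd true l (g 0).
Proof.
move=> lj; have jK : j <= K := leq_trans (deep_height jT) TK.
have E : ediag K T (fun=> j).
  split=> i iT; first by split; [lia|rewrite /mid; case: jT => /(_ i iT); lia].
  by case: jT => _ /(_ i iT) h; rewrite /bpos /mid ltnNge h.
have [F /(_ 0 isT) F0] := globe_functor TK E.
move=> /(congr1 (fun c => sval (F K c))); rewrite !fmap_bd !sval_bd F0 /bpos /mid.
by case: ifP; lia.
Qed.

(** Low cells are the boundaries, of dimension less than j, common to all the
    generators. High cells are the others; they have these boundaries, and
    any functor collapsing all generators to one j-cell sends them to it as well. *)
Definition low (c : ar X K) := exists b l, l < j /\ c = bd b l (g 0).

Definition high (c : ar X K) :=
  (forall b l, l < j -> bd b l c = bd b l (g 0)) /\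
  (forall (C : omegacat) (G : ofunctor X C) w, dimle j w ->
     (forall i, i <= tsize T -> G K (g i) = w) -> G K c = w).

(** Below dimension j, all cells of Theta(T) look like those of a j-disk: no
    composition in dimension l < j can be non-trivial, since the l-source and
    the l-target of the generators differ. *)
Lemma low_high_shallow c l : low c \/ high c -> l < j ->
  dimle l c \/ forall b, bd b l c = bd b l (g 0).
Proof.
case=> [[b [m [mj ->]]]|[h _]] lj; last by right=> b; exact: h.
have [ml|lm] := leqP m l; first by left; exact: dimle_bd.
by right=> b'; rewrite bd_bd lm.
Qed.

Lemma composable_shallow c d l : low c \/ high c -> low d \/ high d ->
  l < j -> composable l c d -> dimle l c \/ dimle l d.
Proof.
move=> hc hd lj [_ e]; have [|Ec] := low_high_shallow hc lj; first by left.
have [|Ed] := low_high_shallow hd lj; first by right.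
by move: e; rewrite Ec Ed => /(bd_gen_neq lj).
Qed.

Lemma low_or_high c : low c \/ high c.
Proof.
elim/(gen_ind TK): c => [i iT|b l c _ IH|l c d cd IHc IHd].
- by right; split=> [b l lj|C G w _ h]; [exact: bd_gen | exact: h].
- have [lj|jl] := ltnP l j.
    have [/(dimleP b)/(_ (leqnn l))->//|E] := low_high_shallow IH lj.
    by left; exists b, l.
  case: IH => [[b' [m [mj ->]]]|[h1 h2]].
    by left; exists b', m; split=> //; rewrite bd_bd ltnNge ltnW // (leq_trans mj).
  right; split=> [b' m mj|C G w wj h]; first by rewrite bd_bd (leq_trans mj jl) h1.
  by rewrite fmap_bd (h2 _ _ w) // (dimleP b wj).
- have T1 : dimle l c \/ dimle l d -> low (cp l c d) \/ high (cp l c d).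
    by case=> h; [rewrite cp_dimlel | rewrite cp_dimler].
  have [lj|jl] := ltnP l j; first exact: T1 (composable_shallow IHc IHd lj cd).
  case: IHc T1 => [[b [m [mj ->]]] T1|[c1 c2] T1].
    by apply: T1; left; apply: dimle_bd; rewrite ltnW // (leq_trans mj).
  case: IHd T1 => [[b [m [mj ->]]] T1|[d1 d2] T1].
    by apply: T1; right; apply: dimle_bd; rewrite ltnW // (leq_trans mj).
  right; split=> [b m mj|C G w wj h].
    by rewrite (bd_cp_lt _ cd) ?c1 // (leq_trans mj).
  have cd' := fmap_composable G cd.
  rewrite fmap_cp // (c2 _ _ w) // in cd' *; rewrite (d2 _ _ w) // in cd' *.
  by rewrite cp_dimlel //; exact: dimle_leq wj.
Qed.

End Dichotomy.

(** * Disks *)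

Definition single k : table := exist _ (k, [::]) isT.

Lemma height_single k : height (single k) = k.
Proof. by rewrite /height /= big_nil maxn0. Qed.

Lemma tk_single k : tk (single k) 0 = k.
Proof. by []. Qed.

Lemma deep_single k : deep k (single k).
Proof. by split=> [[|//]|[]]. Qed.

(** A k-disk has no other cells than the boundaries of its generator: by the
    dichotomy at j = k, the identity functor sends any high cell to the generator. *)
Lemma disk_cells k K (c : ar (Theta_of (single k)) K) : k <= K ->
  exists b i, i <= k /\ c = bd b i (gen (single k) K 0).
Proof.
move=> kK; have TK : height (single k) <= K by rewrite height_single.
have [[b [l [lk ->]]]|[_ h]] := low_or_high TK (deep_single k) c.
  by exists b, l; rewrite ltnW.
have [gd _] := gen_diag TK; have g0 := gd 0 isT.
exists false, k; split=> //; rewrite (dimleP _ g0) //.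
by apply: (h _ (oid _)) => // -[].
Qed.

Lemma disk_functor k K (C : omegacat) (c : ar C K) : k <= K -> dimle k c ->
  exists F : ofunctor (Theta_of (single k)) C, F K (gen (single k) K 0) = c.
Proof.
move=> kK ck; have TK : height (single k) <= K by rewrite height_single.
have D : diag (single k) (fun=> c) by split=> [[|//]|[]].
by have [F FE] := diag_functor TK D; exists F; exact: FE.
Qed.

Lemma disk_functor_eq k K (C : omegacat) (F G : ofunctor (Theta_of (single k)) C) : k <= K ->
  F K (gen (single k) K 0) = G K (gen (single k) K 0) -> F = G.
Proof.
move=> kK FG; have TK : height (single k) <= K by rewrite height_single.
by apply: (functor_eqK TK) => -[].
Qed.

Lemma gen_disk_dimle k K : k <= K -> dimle k (gen (single k) K 0).
Proof.
move=> kK; have TK : height (single k) <= K by rewrite height_single.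
by have [/(_ 0 isT)] := gen_diag TK.
Qed.

Lemma disk_globe k K : k <= K -> exists F : ofunctor (Theta_of (single k)) (globe K),
  sval (F K (gen (single k) K 0)) = k.
Proof.
move=> kK; have TK : height (single k) <= K by rewrite height_single.
have [|F FE] := @globe_functor (single k) K (fun=> k) TK.
  by split=> [[|//] _|[]//]; split; [lia|rewrite tk_single /mid; lia].
by exists F; exact: FE.
Qed.

Lemma bpos_inj N k b b' i i' : i <= k -> i' <= k -> k <= N ->
  bpos N b i k = bpos N b' i' k -> i = i' /\ (b = b' \/ i = k).
Proof. by rewrite /bpos /mid; case: b; case: b'; case: ifP; case: ifP; lia. Qed.

Lemma disk_bd_inj k K b b' i i' : i <= k -> i' <= k -> k <= K ->
  bd b i (gen (single k) K 0) = bd b' i' (gen (single k) K 0) -> i = i' /\ (b = b' \/ i = k).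
Proof.
move=> ik ik' kK e; have [F F0] := disk_globe kK.
apply: (@bpos_inj K k) => //; move: (congr1 (fun c => sval (F K c)) e).
by rewrite !fmap_bd !sval_bd F0.
Qed.

Lemma disk_globe_inj k K (F : ofunctor (Theta_of (single k)) (globe K))
    (c c' : ar (Theta_of (single k)) K) : k <= K ->
  sval (F K (gen (single k) K 0)) = k -> sval (F K c) = sval (F K c') -> c = c'.
Proof.
move=> kK F0; have [b [i [ik ->]]] := disk_cells c kK; have [b' [i' [ik' ->]]] := disk_cells c' kK.
rewrite !fmap_bd !sval_bd F0 => /(bpos_inj ik ik' kK)[e]; case: _ / e => -[->//|->].
by rewrite !(dimleP _ (gen_disk_dimle kK)).
Qed.

(** * Cutting a table at a minimal entry *)

Definition above j (T : table) :=
  (forall i, i <= tsize T -> j < tk T i) /\ (forall i, i < tsize T -> j <= tk' T i).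

Lemma above_deep j T : above j T -> deep j T.
Proof. by case=> h h'; split=> // i iT; exact/ltnW/h. Qed.

(** Theta(T) is then the result of gluing Theta(T1) and Theta(T2) along a j-cell. *)
Definition is_join (T T1 T2 : table) j :=
  sval T = ((sval T1).1, (sval T1).2 ++ (j, (sval T2).1) :: (sval T2).2).

Lemma table_eq (S T : table) : sval S = sval T -> S = T.
Proof. exact: val_inj. Qed.

Lemma heightP T m : (forall i, i <= tsize T -> tk T i <= m) <-> height T <= m.
Proof.
split=> [h|h i _]; last exact: leq_trans (tk_height T i) h.
rewrite /height geq_max (h 0 isT) /=; apply/bigmax_leqP_seq => p pT _.
have iT : index p (sval T).2 < tsize T by rewrite /tsize index_mem.
have := h _ iT; have /andP[_] := tk'_lt iT.
rewrite /tk /tk' /= (nth_map (0, 0)) // (nth_map (0, 0)) // nth_index // geq_max.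
lia.
Qed.

Section Join.
Variables (T T1 T2 : table) (j : nat).
Hypothesis TJ : is_join T T1 T2 j.

Lemma tsize_join : tsize T = tsize T1 + (tsize T2).+1.
Proof. by rewrite /tsize TJ /= size_cat. Qed.

Lemma tk_join1 i : i <= tsize T1 -> tk T i = tk T1 i.
Proof.
rewrite /tk TJ /= /unzip2 map_cat; case: i => //= i iT.
by rewrite nth_cat size_map iT.
Qed.

Lemma tk_join2 i : tk T (tsize T1 + i.+1) = tk T2 i.
Proof.
rewrite /tk TJ addnS /= /unzip2 map_cat nth_cat size_map -ltn_subRL subnn /= /tsize.
by rewrite addKn; case: i.
Qed.

Lemma tk'_join1 i : i < tsize T1 -> tk' T i = tk' T1 i.
Proof. by move=> iT; rewrite /tk' TJ /= /unzip1 map_cat nth_cat size_map iT. Qed.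

Lemma tk'_join0 : tk' T (tsize T1) = j.
Proof. by rewrite /tk' TJ /= /unzip1 map_cat nth_cat size_map ltnn subnn. Qed.

Lemma tk'_join2 i : tk' T (tsize T1 + i.+1) = tk' T2 i.
Proof.
rewrite /tk' TJ /= /unzip1 map_cat nth_cat size_map -ltn_subRL subnn /= /tsize.
by rewrite addKn.
Qed.

Lemma join_cases (P : nat -> Prop) :
  (forall i, i <= tsize T1 -> P i) -> (forall i, i <= tsize T2 -> P (tsize T1 + i.+1)) ->
  forall i, i <= tsize T -> P i.
Proof.
move=> P1 P2 i; rewrite tsize_join => iT; have [iT1|iT1] := leqP i (tsize T1); first exact: P1.
have -> : i = tsize T1 + (i - (tsize T1).+1).+1 by lia.
by apply: P2; lia.
Qed.

Lemma join_cases' (P : nat -> Prop) :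
  (forall i, i < tsize T1 -> P i) -> P (tsize T1) ->
  (forall i, i < tsize T2 -> P (tsize T1 + i.+1)) ->
  forall i, i < tsize T -> P i.
Proof.
move=> P1 P0 P2 i; rewrite tsize_join => iT; have [iT1|iT1|->] := ltngtP i (tsize T1).
- exact: P1.
- have -> : i = tsize T1 + (i - (tsize T1).+1).+1 by lia.
  by apply: P2; lia.
- exact: P0.
Qed.

Lemma height_join m : height T <= m <-> height T1 <= m /\ height T2 <= m.
Proof.
rewrite -!heightP; split=> [h|[h1 h2]].
  split=> i iT; first by rewrite -tk_join1 // h // tsize_join; lia.
  by rewrite -tk_join2 h // tsize_join; lia.
by apply: join_cases => i iT; [rewrite tk_join1 // h1 | rewrite tk_join2 h2].
Qed.

Lemma above_join i : i <= j -> above i T1 -> above i T2 -> above i T.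
Proof.
move=> ij [a1 b1] [a2 b2]; split.
  by apply: join_cases => l lT; [rewrite tk_join1 // a1 | rewrite tk_join2 a2].
by apply: join_cases' => [l lT||l lT]; [rewrite tk'_join1 // b1 | rewrite tk'_join0 | rewrite tk'_join2 b2].
Qed.

Lemma join_above i : above i T -> [/\ i <= j, above i T1 & above i T2].
Proof.
move=> [a b]; split; first by rewrite -tk'_join0; apply: b; rewrite tsize_join; lia.
  split=> l lT; first by rewrite -tk_join1 // a // tsize_join; lia.
  by rewrite -tk'_join1 // b // tsize_join; lia.
split=> l lT; first by rewrite -tk_join2 a // tsize_join; lia.
by rewrite -tk'_join2 b // tsize_join; lia.
Qed.

End Join.

Lemma is_tableP (t : nat * seq (nat * nat)) :
  reflect (forall i, i < size t.2 ->
     nth 0 (unzip1 t.2) i < nth 0 (t.1 :: unzip2 t.2) i /\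
     nth 0 (unzip1 t.2) i < nth 0 (unzip2 t.2) i) (is_table t).
Proof.
apply: (iffP idP) => [h i iT|h].
  have := @tk'_lt (exist _ t h) i iT; rewrite /tk /tk' /=.
  by case/andP.
apply/(pathP (0, 0)) => i iT; have [] := h i iT.
rewrite (nth_map (0, 0)) // (nth_map (0, 0)) // => h1 h2; apply/andP; split=> //.
rewrite (leq_trans h1) // {h h1 h2}; move: iT; case: i => //= i iT.
by rewrite (nth_map (0, 0)) // ltnW.
Qed.

Lemma join_exists T1 T2 j : above j T1 -> above j T2 -> exists T, is_join T T1 T2 j.
Proof.
move=> [a1 _] [a2 _].
pose t := ((sval T1).1, (sval T1).2 ++ (j, (sval T2).1) :: (sval T2).2).
suff ht : is_table t by exists (exist _ t ht).
move: (svalP T1) (svalP T2); rewrite /is_table => p1 p2.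
rewrite /t /= cat_path /= p1 /=; apply/andP; split.
  have := a1 (tsize T1) (leqnn _); have := a2 0 isT; rewrite /tk /= => -> .
  have -> : (last (0, (sval T1).1) (sval T1).2).2 =
            nth 0 ((sval T1).1 :: unzip2 (sval T1).2) (tsize T1).
    rewrite -[LHS](last_map snd (sval T1).2 (0, (sval T1).1)) /=.
    by rewrite /tsize -(size_map snd) -[size _]/((size ((sval T1).1 :: unzip2 (sval T1).2)).-1) nth_last.
  by move=> ->.
by case: (sval T2) p2 => a [//|[u v] s].
Qed.

(** A table that is not a single disk is cut at a smallest of its entries
    k'_i. Both parts then lie above this entry, which is what makes the cells of the
    glued category easy to describe. *)
Lemma table_ind (P : table -> Prop) :
  (forall T, tsize T = 0 -> P T) ->
  (forall T T1 T2 j, is_join T T1 T2 j -> above j T1 -> above j T2 -> P T1 -> P T2 -> P T) ->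
  forall T, P T.
Proof.
move=> P0 PJ T; have [n] := ubnP (tsize T); elim: n T => // n IH T; rewrite ltnS => Tn.
have [/eqP/P0//|T0] := boolP (tsize T == 0).
have hT : 0 < tsize T by rewrite lt0n.
have [m mT mmin] : exists2 m, m < tsize T & forall i, i < tsize T -> tk' T m <= tk' T i.
  case: (@arg_minnP _ (Ordinal hT) xpredT (fun i => tk' T i) isT) => m _ h.
  by exists m => // i iT; exact: (h (Ordinal iT)).
case: T m mmin mT Tn {hT T0} => -[a s] ht m mmin mT Tn.
pose t1 := (a, take m s); pose t2 := (nth 0 (unzip2 s) m, drop m.+1 s).
have es : s = take m s ++ (tk' (exist _ (a, s) ht) m, nth 0 (unzip2 s) m) :: drop m.+1 s.
  rewrite /tk' /= (nth_map (0, 0)) // (nth_map (0, 0)) //.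
  rewrite -{1}(cat_take_drop m s) (drop_nth (0, 0)) //; congr (_ ++ _ :: _).
  by case: (nth _ _ _).
move/is_tableP: (ht) => h.
have st : size (take m s) = m by rewrite size_take; move: mT; rewrite /tsize /= => ->.
have h1 : is_table t1.
  apply/is_tableP => i /=; rewrite st => im.
  have iT : i < size s by apply: ltn_trans im mT.
  have := h i iT; rewrite /= /unzip1 /unzip2 !map_take !nth_take //.
  by case: i im iT => //= i im iT; rewrite nth_take; last exact: ltnW.
have h2 : is_table t2.
  apply/is_tableP => i /=; rewrite size_drop => im.
  have iT : m.+1 + i < size s by lia.
  have := h _ iT; rewrite /= /unzip1 /unzip2 !map_drop !nth_drop.
  case: i im iT => [|i] im iT; first by rewrite ?addSn ?addn0.
  by rewrite !addSn /= nth_drop addSnnS.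
have J : is_join (exist _ (a, s) ht) (exist _ t1 h1) (exist _ t2 h2) (tk' (exist _ (a, s) ht) m).
  by rewrite /is_join /= -es.
have [A1 A2] : above (tk' (exist _ (a, s) ht) m) (exist _ t1 h1) /\
               above (tk' (exist _ (a, s) ht) m) (exist _ t2 h2).
  have e := tsize_join J.
  have s1 : tsize (exist _ t1 h1 : table) = m by [].
  split; split=> i iT.
  - rewrite -(tk_join1 J) //; rewrite s1 in iT; have [im|mi] := ltnP i m.
      by apply: leq_ltn_trans (mmin i _) _; [lia|have /andP[] := @tk'_lt (exist _ (a, s) ht) i (ltn_trans im mT)].
    have -> : i = m by lia.
    by have /andP[] := tk'_lt mT.
  - rewrite -(tk'_join1 J) //; apply: mmin; rewrite e; lia.
  - rewrite -(tk_join2 J) addnS; set i' := _ + i.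
    have iT' : i' < tsize (exist _ (a, s) ht : table) by rewrite e /i'; lia.
    apply: leq_ltn_trans (mmin i' iT') _.
    by have /andP[] := tk'_lt iT'.
  - rewrite -(tk'_join2 J); apply: mmin; rewrite e; lia.
have e := tsize_join J.
by apply: PJ J A1 A2 _ _; apply: IH; lia.
Qed.

Opaque bd cp resize.

(** * Disks separate the cells of Theta(T) *)

Definition disks_separate T := forall K (c c' : ar (Theta_of T) K), height T <= K ->
  (forall k (F : ofunctor (Theta_of T) (Theta_of (single k))), k <= height T ->
     F K c = F K c') -> c = c'.

Definition globes_separate T := forall K (c c' : ar (Theta_of T) K), height T <= K ->
  (forall F : ofunctor (Theta_of T) (globe K), F K c = F K c') -> c = c'.

Lemma disks_globes_separate T : disks_separate T -> globes_separate T.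
Proof.
move=> sepT K c c' TK h; apply: sepT => // k F kT.
have kK := leq_trans kT TK; have [G G0] := disk_globe kK.
by apply: (disk_globe_inj kK G0); congr sval; exact: (h (ocomp G F)).
Qed.

(** If a functor to the globe sent c to a position of dimension greater than j,
    the j-source of this position, which is j, would be the j-target of the
    image of the diagram. The whole diagram would then be collapsed to j, and
    c with it if c is high; if c is low, it is an identity anyway. *)
Lemma no_loop T K j (c : ar (Theta_of T) K) : height T <= K -> above j T -> globes_separate T ->
  bd false j c = bd true j (gen T K 0) -> c = bd true j (gen T K 0).
Proof.
move=> TK aT sepT e; set t := bd true j _ in e *.
have tj : dimle j t by exact: dimle_bd.
have jT := above_deep aT; have jK : j < K.
  by case: aT => /(_ 0 isT) h _; apply: leq_trans h (leq_trans (tk_height _ _) TK).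
case: (low_or_high TK jT c) => [[b [l [lj ec]]]|[_ hc]].
  by rewrite -e ec bd_bd ltnNge (ltnW lj).
apply: sepT => // F.
have [m|m] := boolP (mid K j (sval (F K c))); last first.
  apply: val_inj; rewrite /= -e fmap_bd sval_bd /bpos; by rewrite (negbTE m).
have E := congr1 (fun c => sval (F K c)) e.
have [Fd Fm] := functor_ediag F TK.
have F0 : sval (F K (gen T K 0)) = j.
  by move: E; rewrite /t !fmap_bd !sval_bd /bpos m; case: ifP => //; rewrite /mid; lia.
have Fj i : i <= tsize T -> sval (F K (gen T K i)) = j.
  elim: i => // i IH iT; have := Fm i iT; rewrite IH; last exact: ltnW.
  have ji : j <= tk' T i by case: jT => _; apply.
  have [d _] := Fd i.+1 iT.
  have iK : tk' T i < K.
    have /andP[h _] := tk'_lt iT.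
    exact: leq_trans h (leq_trans (tk_height _ _) TK).
  rewrite /bpos /mid ltnNge ji /=; case: ifP => // _; lia.
have w : dimle j (F K (gen T K 0)).
  by apply: val_inj; rewrite /= sval_bd F0 /bpos /mid ltnn.
by move: m; rewrite (hc _ F _ w) ?F0 ?/mid ?ltnn // => i iT; apply: val_inj; rewrite /= Fj.
Qed.

(** The normal form of the cells of a glued category, in terms of the two halves.
    It rests on the absence of loops at the gluing cell, which in turn follows from
    the separation property for the second half; hence the induction. *)
Section NormalForm.
Variables (T T1 T2 : table) (j K : nat).
Hypotheses (TJ : is_join T T1 T2 j) (a1 : above j T1) (a2 : above j T2) (TK : height T <= K).
Let X := Theta_of T.
Let A := Theta_of T1.
Let B := Theta_of T2.
Let m := (tsize T1).

Let T1K : height T1 <= K. Proof. by case: ((height_join TJ K).1 TK). Qed.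
Let T2K : height T2 <= K. Proof. by case: ((height_join TJ K).1 TK). Qed.
Let aT : above j T := above_join TJ (leqnn j) a1 a2.
Let jT : deep j T := above_deep aT.
Let j1 : deep j T1 := above_deep a1.
Let j2 : deep j T2 := above_deep a2.
Let jK : j < K.
Proof. by case: aT => /(_ 0 isT) h _; apply: leq_trans h (leq_trans (tk_height _ _) TK). Qed.

Let eA := bd false j (gen T1 K m).
Let eB := bd true j (gen T2 K 0).
Let eAj : dimle j eA. Proof. exact: dimle_bd. Qed.
Let eBj : dimle j eB. Proof. exact: dimle_bd. Qed.

Let eAid b : bd b j eA = eA := dimleP b eAj (leqnn j).
Let eBid b : bd b j eB = eB := dimleP b eBj (leqnn j).

(** The two halves of Theta(T), each a retract of it: the other half is
    collapsed to the j-cell along which the halves are glued. *)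
Record halves := Halves {
  iA : ofunctor A X;
  iB : ofunctor B X;
  pA : ofunctor X A;
  pB : ofunctor X B;
  iA_gen : forall i, i <= m -> iA K (gen T1 K i) = gen T K i;
  iB_gen : forall i, i <= tsize T2 -> iB K (gen T2 K i) = gen T K (m + i.+1);
  pA_gen1 : forall i, i <= m -> pA K (gen T K i) = gen T1 K i;
  pA_gen2 : forall i, i <= tsize T2 -> pA K (gen T K (m + i.+1)) = eA;
  pB_gen1 : forall i, i <= m -> pB K (gen T K i) = eB;
  pB_gen2 : forall i, i <= tsize T2 -> pB K (gen T K (m + i.+1)) = gen T2 K i }.

Lemma halves_exist : inhabited halves.
Proof.
have [D M] := gen_diag TK; have [D1 M1] := gen_diag T1K; have [D2 M2] := gen_diag T2K.
have nm1 i : (m + i.+1 <= m) = false by lia.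
have sm1 i : m + i.+1 - m.+1 = i by lia.
have sm2 i : (m + i.+1).+1 - m.+1 = i.+1 by lia.
have nm2 i : (m + i.+1 < m) = false by lia.
have [F1 E1] : exists F : ofunctor A X, forall i, i <= m -> F K (gen T1 K i) = gen T K i.
  apply: (diag_functor T1K); split=> i iT.
    by rewrite -(tk_join1 TJ) //; apply: D; rewrite (tsize_join TJ); lia.
  by rewrite -(tk'_join1 TJ) //; apply: M; rewrite (tsize_join TJ); lia.
have [F2 E2] : exists F : ofunctor B X, forall i, i <= tsize T2 ->
    F K (gen T2 K i) = gen T K (m + i.+1).
  apply: (diag_functor T2K); split=> i iT.
    by rewrite -(tk_join2 TJ) //; apply: D; rewrite (tsize_join TJ); lia.
  by rewrite -(tk'_join2 TJ) // [m + i.+2]addnS; apply: M; rewrite (tsize_join TJ); lia.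
have [G1 H1] : exists F : ofunctor X A, forall i, i <= tsize T ->
    F K (gen T K i) = if i <= m then gen T1 K i else eA.
  apply: (diag_functor TK); split.
    apply: (join_cases TJ) => i iT; first by rewrite (tk_join1 TJ) // iT; exact: D1.
    rewrite (tk_join2 TJ) nm1.
    by apply: dimle_leq eAj; case: j2 => h _; exact: h.
  apply: (join_cases' TJ) => [i iT||i iT].
  - by rewrite (tk'_join1 TJ) // iT (ltnW iT); exact: M1.
  - by rewrite (tk'_join0 TJ) leqnn ltnn (dimleP _ eAj).
  - rewrite (tk'_join2 TJ) nm1 nm2.
    by case: j2 => _ /(_ i iT) h; rewrite !(dimleP _ eAj).
have [G2 H2] : exists F : ofunctor X B, forall i, i <= tsize T ->
    F K (gen T K i) = if i <= m then eB else gen T2 K (i - m.+1).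
  apply: (diag_functor TK); split.
    apply: (join_cases TJ) => i iT.
      by rewrite (tk_join1 TJ) // iT; apply: dimle_leq eBj; case: j1 => h _; exact: h.
    by rewrite (tk_join2 TJ) nm1 sm1; exact: D2.
  apply: (join_cases' TJ) => [i iT||i iT].
  - rewrite (tk'_join1 TJ) // iT (ltnW iT).
    by case: j1 => _ /(_ i iT) h; rewrite !(dimleP _ eBj).
  - by rewrite (tk'_join0 TJ) leqnn ltnn subnn (dimleP _ eBj).
  - rewrite (tk'_join2 TJ) nm1 nm2.
    by rewrite sm1 sm2; exact: M2.
have iT2 i : i <= tsize T2 -> m + i.+1 <= tsize T by rewrite (tsize_join TJ) /m; lia.
have iT1 i : i <= m -> i <= tsize T by rewrite (tsize_join TJ) /m; lia.
constructor; apply: (@Halves F1 F2 G1 G2) => // i im; rewrite ?H1 ?H2; auto.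
- by rewrite im.
- by rewrite nm1.
- by rewrite im.
- by rewrite nm1 sm1.
Qed.

Variable H : halves.
Notation ia := (iA H K).
Notation ib := (iB H K).
Notation pa := (pA H K).
Notation pb := (pB H K).

Lemma pa_ia a : pa (ia a) = a.
Proof.
suff E : ocomp (pA H) (iA H) = oid A by exact: (congr1 (fun F : ofunctor A A => F K a) E).
by apply: (functor_eqK T1K) => i im; rewrite ocompE iA_gen // pA_gen1.
Qed.

Lemma pb_ib b : pb (ib b) = b.
Proof.
suff E : ocomp (pB H) (iB H) = oid B by exact: (congr1 (fun F : ofunctor B B => F K b) E).
by apply: (functor_eqK T2K) => i im; rewrite ocompE iB_gen // pB_gen2.
Qed.

Lemma ia_eA : ia eA = ib eB.
Proof.
rewrite /eA /eB !fmap_bd iA_gen // iB_gen //.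
have [_ M] := gen_diag TK; rewrite addn1 -(tk'_join0 TJ); apply: M.
by rewrite (tsize_join TJ); lia.
Qed.

Lemma pa_ib_high b : high j b -> pa (ib b) = eA.
Proof. by case=> _ h; apply: (h _ (ocomp (pA H) (iB H))) => // i iT; rewrite ocompE iB_gen // pA_gen2. Qed.

Lemma pb_ia_high a : high j a -> pb (ia a) = eB.
Proof. by case=> _ h; apply: (h _ (ocomp (pB H) (iA H))) => // i iT; rewrite ocompE iA_gen // pB_gen1. Qed.

Lemma pb_eA : pb (ia eA) = eB.
Proof. by rewrite ia_eA pb_ib. Qed.

Lemma pa_eB : pa (ib eB) = eA.
Proof. by rewrite -ia_eA pa_ia. Qed.

Lemma low_dimle (T0 : table) (c : ar (Theta_of T0) K) l : low j c -> j <= l -> dimle l c.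
Proof. by case=> b [n [nj ->]] jl; apply: dimle_bd; rewrite ltnW // (leq_trans nj). Qed.

Lemma pb_ia_src a : bd false j a = eA -> pb (ia a) = eB.
Proof.
move=> e; have [lo|hi] := low_or_high T1K j1 a; last exact: pb_ia_high.
by have := low_dimle lo (leqnn j); rewrite /dimle e => <-; exact: pb_eA.
Qed.

Lemma pa_ib_tgt b : bd true j b = eB -> pa (ib b) = eA.
Proof.
move=> e; have [lo|hi] := low_or_high T2K j2 b; last exact: pa_ib_high.
by have := dimleP true (low_dimle lo (leqnn j)) (leqnn j); rewrite e => <-; exact: pa_eB.
Qed.

Definition in_A c := c = ia (pa c).
Definition in_B c := c = ib (pb c).
Definition glued c := bd false j (pa c) = eA /\ bd true j (pb c) = eB.
Definition in_AB c := glued c /\ c = cp j (ia (pa c)) (ib (pb c)).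
Definition normal c := in_A c \/ in_B c \/ in_AB c.

Lemma composable_glue a b : bd false j a = eA -> bd true j b = eB -> composable j (ia a) (ib b).
Proof. by move=> ea eb; split=> //; rewrite -!fmap_bd ea eb; exact: ia_eA. Qed.

Lemma in_A_ia a : in_A (ia a).
Proof. by rewrite /in_A pa_ia. Qed.

Lemma in_B_ib b : in_B (ib b).
Proof. by rewrite /in_B pb_ib. Qed.

Lemma in_AB_cp a b : bd false j a = eA -> bd true j b = eB -> in_AB (cp j (ia a) (ib b)).
Proof.
move=> ea eb; have ab := composable_glue ea eb.
have Ea : pa (cp j (ia a) (ib b)) = a.
  have := fmap_composable (pA H) ab; rewrite fmap_cp // pa_ia (pa_ib_tgt eb) => h.
  exact: cp_dimler.
have Eb : pb (cp j (ia a) (ib b)) = b.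
  have := fmap_composable (pB H) ab; rewrite fmap_cp // pb_ib (pb_ia_src ea) => h.
  exact: cp_dimlel.
by rewrite /in_AB /glued Ea Eb.
Qed.

Lemma in_A_AB c : in_A c -> bd false j (pa c) = eA -> in_AB c.
Proof.
move=> cA e; have h := composable_glue e (eBid true).
have -> : c = cp j (ia (pa c)) (ib eB).
  by rewrite cp_dimler //; exact: fmap_dimle.
exact: in_AB_cp.
Qed.

Lemma in_B_AB c : in_B c -> bd true j (pb c) = eB -> in_AB c.
Proof.
move=> cB e; have h := composable_glue (eAid false) e.
have -> : c = cp j (ia eA) (ib (pb c)).
  by rewrite cp_dimlel //; exact: fmap_dimle.
exact: in_AB_cp.
Qed.

Lemma cp_in_A l c d : composable l c d -> in_A c -> in_A d -> in_A (cp l c d).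
Proof. by move=> cd cA dA; rewrite /in_A (fmap_cp (pA H)) // fmap_cp -?cA -?dA //; exact: fmap_composable. Qed.

Lemma cp_in_B l c d : composable l c d -> in_B c -> in_B d -> in_B (cp l c d).
Proof. by move=> cd cB dB; rewrite /in_B (fmap_cp (pB H)) // fmap_cp -?cB -?dB //; exact: fmap_composable. Qed.

Lemma cp_in_AB l c d : j < l -> composable l c d -> in_AB c -> in_AB d -> in_AB (cp l c d).
Proof.
move=> jl cd [[c1 c2] ec] [[d1 d2] ed].
have ha := fmap_composable (pA H) cd; have hb := fmap_composable (pB H) cd.
have Ec := composable_glue c1 c2; have Ed := composable_glue d1 d2.
have Ea := fmap_composable (iA H) ha; have Eb := fmap_composable (iB H) hb.
rewrite ec ed -(cp_exchange jl Ea Eb Ec Ed).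
rewrite -(fmap_cp (iA H) ha) -(fmap_cp (iB H) hb); apply: in_AB_cp.
  by rewrite (bd_cp_lt _ ha).
by rewrite (bd_cp_lt _ hb).
Qed.

Lemma in_A_pb c : in_A c -> dimle j c \/ pb c = eB.
Proof.
move=> cA; have [lo|hi] := low_or_high T1K j1 (pa c).
  by left; rewrite cA; apply: fmap_dimle; exact: low_dimle lo _.
by right; rewrite cA; exact: pb_ia_high.
Qed.

Lemma in_B_pa c : in_B c -> dimle j c \/ pa c = eA.
Proof.
move=> cB; have [lo|hi] := low_or_high T2K j2 (pb c).
  by left; rewrite cB; apply: fmap_dimle; exact: low_dimle lo _.
by right; rewrite cB; exact: pa_ib_high.
Qed.

Lemma cp_dimle_normal l c d : composable l c d -> normal c -> normal d ->
  dimle l c \/ dimle l d -> normal (cp l c d).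
Proof. by move=> cd nc nd [h|h]; [rewrite cp_dimlel|rewrite cp_dimler]. Qed.

Lemma cp_in_A_normal c d : composable j c d -> in_A c -> normal d -> normal (cp j c d).
Proof.
move=> cd cA nd; have nc : normal c by left.
have [cj|pbc] := in_A_pb cA; first by apply: cp_dimle_normal; auto.
have ca := fmap_composable (pA H) cd; have cb := fmap_composable (pB H) cd.
case: (nd) => [dA|[dB|[[d1 d2] ed]]]; first by left; exact: cp_in_A.
  have [dj|pad] := in_B_pa dB; first by apply: cp_dimle_normal; auto.
  right; right; rewrite cA dB; apply: in_AB_cp.
    by rewrite ca.2 pad eAid.
  by rewrite -cb.2 pbc eBid.
right; right; rewrite ed -cpA; last exact: composable_glue.
  rewrite {1}cA -fmap_cp //; apply: in_AB_cp => //.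
  by rewrite bd_cp0.
by rewrite {1}cA; exact: fmap_composable.
Qed.

Hypothesis sepT2 : globes_separate T2.

(** Composition along the gluing dimension. The only problematic order, a cell of the
    second half followed by one of the first, is a loop at the gluing cell. *)
Lemma cp_normal_min c d : composable j c d -> normal c -> normal d -> normal (cp j c d).
Proof.
move=> cd nc nd; case: (nc) => [cA|cBAB]; first exact: cp_in_A_normal.
have cb := fmap_composable (pB H) cd.
have loop : bd true j (pb d) = eB -> normal (cp j c d).
  move=> e; have {}e : pb c = eB by apply: (no_loop T2K a2 sepT2); rewrite cb.2.
  case: cBAB => [cB|[[c1 c2] ec]].
    by apply: cp_dimle_normal => //; left; rewrite cB e; exact: fmap_dimle.
  apply: cp_in_A_normal => //; suff -> : c = ia (pa c) by exact: in_A_ia.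
  rewrite {1}ec cp_dimler //; first exact: composable_glue.
  by rewrite e; exact: fmap_dimle.
case: (nd) => [dA|[dB|[[d1 d2] ed]]].
- have [dj|pbd] := in_A_pb dA; first by apply: cp_dimle_normal; auto.
  by apply: loop; rewrite pbd eBid.
- case: cBAB => [cB|[[c1 c2] ec]]; first by right; left; exact: cp_in_B.
  right; right; rewrite ec cpA; last 2 first.
  + exact: composable_glue.
  + by rewrite dB; exact: fmap_composable.
  rewrite dB -(fmap_cp (iB H) cb); apply: in_AB_cp => //.
  by rewrite bd_cp1.
- exact: loop.
Qed.

Lemma cp_normal_gt l c d : j < l -> composable l c d -> normal c -> normal d -> normal (cp l c d).
Proof.
move=> jl cd nc nd.
have ca := fmap_composable (pA H) cd; have cb := fmap_composable (pB H) cd.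
have gl : glued c <-> glued d.
  by rewrite /glued (composable_lt _ ca jl) (composable_lt _ cb jl).
(* Both factors have the same j-boundaries, so if one of them meets the gluing
   cell on both sides then so does the other. *)
have AB x : normal x -> glued x -> in_AB x.
  by move=> [xA|[xB|//]] [x1 x2]; [exact: in_A_AB|exact: in_B_AB].
have both : glued c -> normal (cp l c d).
  by move=> gc; right; right; apply: cp_in_AB => //; apply: AB => //; apply/gl.
case: (nc) => [cA|[cB|[gc _]]]; last exact: both.
  case: (nd) => [dA|[dB|[gd _]]]; [by left; exact: cp_in_A| |exact/both/gl].
  have [cj|pbc] := in_A_pb cA.
    by apply: cp_dimle_normal => //; left; exact: dimle_leq (ltnW jl) _.
  have [dj|pad] := in_B_pa dB.
    by apply: cp_dimle_normal => //; right; exact: dimle_leq (ltnW jl) _.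
  apply: both; split; first by rewrite (composable_lt _ ca jl) pad eAid.
  by rewrite pbc eBid.
case: (nd) => [dA|[dB|[gd _]]]; [|by right; left; exact: cp_in_B|exact/both/gl].
have [cj|pac] := in_B_pa cB.
  by apply: cp_dimle_normal => //; left; exact: dimle_leq (ltnW jl) _.
have [dj|pbd] := in_A_pb dA.
  by apply: cp_dimle_normal => //; right; exact: dimle_leq (ltnW jl) _.
apply: both; split; first by rewrite pac eAid.
by rewrite (composable_lt _ cb jl) pbd eBid.
Qed.

Lemma bd_normal b l c : normal c -> normal (bd b l c).
Proof.
case=> [cA|[cB|[[c1 c2] ec]]].
- by left; rewrite /in_A !fmap_bd -cA.
- by right; left; rewrite /in_B !fmap_bd -cB.
- have h := composable_glue c1 c2; rewrite ec; have [lj|jl|->] := ltngtP l j.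
  + by rewrite (bd_cp_lt _ h lj); left; rewrite -(fmap_bd (iA H)); exact: in_A_ia.
  + rewrite (bd_cp_gt _ h jl) -(fmap_bd (iA H)) -(fmap_bd (iB H)); right; right; apply: in_AB_cp.
      by rewrite bd_bd jl.
    by rewrite bd_bd jl.
  + case: b; first by rewrite bd_cp1 // -fmap_bd; left; exact: in_A_ia.
    by rewrite bd_cp0 // -fmap_bd; right; left; exact: in_B_ib.
Qed.

(** Boundaries and composites of normal cells are normal. Composition along
    dimensions less than j is trivial by the dichotomy, along dimensions greater
    than j it is done in both halves separately, by the exchange law. *)
Lemma all_normal c : normal c.
Proof.
elim/(gen_ind TK): c => [|b l c _|l c d cd nc nd]; last 2 first.
- exact: bd_normal.
- move: cd; have [lj|jl|->] := ltngtP l j => cd; last exact: cp_normal_min.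
    apply: cp_dimle_normal => //.
    by apply: composable_shallow lj cd => //; exact: low_or_high.
  exact: cp_normal_gt.
apply: (join_cases TJ) => i iT; first by left; rewrite -(iA_gen H) //; exact: in_A_ia.
by right; left; rewrite -(iB_gen H) //; exact: in_B_ib.
Qed.

(** The normal form of a cell is determined by its images under the two
    retractions, because each retraction collapses the factor from the other half. *)
Lemma halves_separate c c' : pa c = pa c' -> pb c = pb c' -> c = c'.
Proof.
move=> ea eb.
have AB x y : in_A x -> in_AB y -> pa x = pa y -> pb x = pb y -> x = y.
  move=> xA [[y1 y2] ey] e e'; rewrite ey cp_dimler -?e -?xA //.
    by rewrite {1}xA e; exact: composable_glue.
  by rewrite -e' xA pb_ia_src ?e //; exact: fmap_dimle.
have BB x y : in_B x -> in_AB y -> pa x = pa y -> pb x = pb y -> x = y.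
  move=> xB [[y1 y2] ey] e e'; rewrite ey cp_dimlel -?e' -?xB //.
    by rewrite {1}xB e'; exact: composable_glue.
  by rewrite -e xB pa_ib_tgt ?e' //; exact: fmap_dimle.
have lowA y : in_B y -> low j (pb y) -> in_A y.
  move=> yB [b [l [lj el]]].
  suff -> : y = ia (bd b l (gen T1 K 0)) by exact: in_A_ia.
  rewrite yB el !fmap_bd iA_gen // iB_gen // (bd_gen TK jT) //.
  by rewrite (tsize_join TJ); lia.
have AvB x y : in_A x -> in_B y -> pa x = pa y -> pb x = pb y -> x = y.
  move=> xA yB e e'; have [lo|hi] := low_or_high T2K j2 (pb y).
    by rewrite xA e -(lowA y yB lo).
  have pay : pa y = eA by rewrite yB; exact: pa_ib_high.
  by rewrite xA yB -e' xA pa_ia e pay pb_eA; exact: ia_eA.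
have [cA|[cB|cAB]] := all_normal c; have [cA'|[cB'|cAB']] := all_normal c'.
- by rewrite cA cA' ea.
- exact: AvB.
- exact: AB.
- exact/esym/AvB.
- by rewrite cB cB' eb.
- exact: BB.
- exact/esym/AB.
- exact/esym/BB.
- by rewrite cAB.2 cAB'.2 ea eb.
Qed.

End NormalForm.

Lemma single_tk T : tsize T = 0 -> T = single (tk T 0).
Proof. by case: T => -[a [|p s]] h //= _; exact: table_eq. Qed.

(** By induction on T: two cells with the same images under all functors to disks
    have the same images in both halves. *)
Lemma disks_separateP T : disks_separate T.
Proof.
elim/table_ind: T => [T /single_tk->|T T1 T2 j TJ a1 a2 sep1 sep2] K c c' TK h.
  have kE := height_single (tk T 0).
  exact: (h (tk T 0) (oid _) (eq_leq (esym kE))).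
have [T1h T2h] := (height_join TJ (height T)).1 (leqnn _).
have [H] := halves_exist TJ a1 a2 TK.
apply: (halves_separate TJ a1 a2 TK (disks_globes_separate sep2) (H := H)).
  apply: sep1 (leq_trans T1h TK) _ => k F kT.
  exact: (h k (ocomp F (pA H)) (leq_trans kT T1h)).
apply: sep2 (leq_trans T2h TK) _ => k F kT.
exact: (h k (ocomp F (pB H)) (leq_trans kT T2h)).
Qed.

Lemma globes_separateP T : globes_separate T.
Proof. exact/disks_globes_separate/disks_separateP. Qed.

(** * Enumerating the functors from Theta(T) to the globe *)

Section Enum.
Variable K : nat.

Definition pos_ok k z := (z <= 2 * K + 1) && ~~ mid K k z.

(** A functor from Theta(T) to the globe amounts to the word of the positions of its
    generators. Here the table is given as a first dimension k and a list s of pairs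
    (k'_i, k_{i+1}). *)
Fixpoint word_ok k (s : seq (nat * nat)) (u : seq nat) :=
  match s, u with
  | [::], [:: z] => pos_ok k z
  | p :: s', z :: u' =>
      [&& pos_ok k z, bpos K false p.1 z == bpos K true p.1 (head 0 u') & word_ok p.2 s' u']
  | _, _ => false
  end.

Fixpoint bounded k (s : seq (nat * nat)) :=
  (k <= K) && (if s is p :: s' then [&& p.1 < k, p.1 < p.2 & bounded p.2 s'] else true).

(** The only way to complete a word starting with a letter z that lies before the target
    of dimension k', the first gluing dimension: the next letter, having the source of z as
    target, can only be this source. *)
Fixpoint tail z (s : seq (nat * nat)) :=
  if s is p :: s' then minn z p.1 :: tail (minn z p.1) s' else [::].

(** Positions of dimension at most k; of these, those strictly before the target of
    dimension k'. *)
Definition positions k := iota 0 k.+1 ++ iota (2 * K + 1 - k) k.+1.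
Definition positions_before k k' := iota 0 k.+1 ++ iota (2 * K + 1 - k) (k - k').

(** The list of all words in increasing order for the pointwise order, which
    turns out to be total on them. If the first letter lies before the target of dimension
    k', the source of this letter bounds the next one and the rest is forced;
    otherwise the letter is determined by the rest. *)
Fixpoint words k (s : seq (nat * nat)) : seq (seq nat) :=
  if s is p :: s' then
    [seq z :: tail z s | z <- positions_before k p.1] ++
    [seq maxn (head 0 u) (2 * K + 1 - p.1) :: u | u <- words p.2 s' & p.1 < head 0 u]
  else [seq [:: z] | z <- positions k].

Lemma mem_positions k z : k <= K -> (z \in positions k) = pos_ok k z.
Proof. by move=> kK; rewrite mem_cat !mem_iota /pos_ok /mid; lia. Qed.

Lemma mem_positions_before k k' z : k <= K -> k' < k ->
  (z \in positions_before k k') = pos_ok k z && (z + k' < 2 * K + 1).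
Proof. by move=> kK k'k; rewrite mem_cat !mem_iota /pos_ok /mid; lia. Qed.

Lemma words_nil k : words k [::] = [seq [:: z] | z <- positions k].
Proof. by []. Qed.

Lemma words_cons k k' k2 s : words k ((k', k2) :: s) =
  [seq z :: tail z ((k', k2) :: s) | z <- positions_before k k'] ++
  [seq maxn (head 0 u) (2 * K + 1 - k') :: u | u <- words k2 s & k' < head 0 u].
Proof. by []. Qed.

Definition wle (u v : seq nat) := all2 leq u v.
Definition wlt u v := wle u v && (u != v).

Lemma word_ok_head k s u : word_ok k s u -> exists z u', u = z :: u' /\ pos_ok k z.
Proof. by case: s u => [|p s] [|z [|y u]] //= => [zk|/andP[zk _]|/andP[zk _]]; exists z; eexists. Qed.

Lemma word_tail k s z : bounded k s -> pos_ok k z ->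
  (if s is p :: _ then z + p.1 < 2 * K + 1 else true) -> word_ok k s (z :: tail z s).
Proof.
elim: s k z => [//|[k' k2] s IH] k z /= /and4P[kK k'k k'k2 bs] zk zk'.
rewrite zk IH //; last 2 first.
- by move: zk; rewrite /pos_ok /mid; lia.
- case: s bs {IH} => //= -[k3 k4] s /=; lia.
by rewrite andbT /=; apply/eqP; move: zk; rewrite /pos_ok /bpos /mid; case: ifP; case: ifP; lia.
Qed.

Lemma word_ok_tail k s z u : bounded k s -> word_ok k s (z :: u) ->
  (if s is p :: _ then z + p.1 < 2 * K + 1 else true) -> u = tail z s.
Proof.
elim: s k z u => [|[k' k2] s IH] k z [|y u] //=; first by move=> _ /andP[_ /andP[_]]; case: s {IH}.
move=> /and4P[kK k'k k'k2 bs] /and3P[zk /eqP e yu] zk'.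
have ey : y = minn z k'.
  by move: e zk; rewrite /pos_ok /bpos /mid; case: ifP; case: ifP; lia.
rewrite -ey; congr (_ :: _); apply: (IH k2) => //.
by case: s bs {IH yu} => //= -[k3 k4] s; lia.
Qed.

Lemma mem_words k s u : bounded k s -> (u \in words k s) = word_ok k s u.
Proof.
elim: s k u => [|[k' k2] s IH] k u.
  rewrite words_nil => /andP[kK _]; apply/mapP/idP => [[z]|].
    by rewrite mem_positions // => zk ->.
  by case: u => [//|z [|//]] zk; exists z; rewrite ?mem_positions.
move=> B; have [kK k'k k'k2 bs] : [/\ k <= K, k' < k, k' < k2 & bounded k2 s] by case/and4P: B.
rewrite words_cons mem_cat; apply/orP/idP.
  case=> /mapP[].
    move=> z; rewrite mem_positions_before // => /andP[zk zk'] ->.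
    exact: (@word_tail k ((k', k2) :: s)).
  move=> v; rewrite mem_filter IH // => /andP[hv vk] ->.
  have [y [v' [ev yk]]] := word_ok_head vk; rewrite {}ev in hv vk *; rewrite /= in hv *.
  rewrite vk andbT; move: yk; rewrite /pos_ok /bpos /mid => yk; apply/andP; split; first lia.
  by apply/eqP; case: ifP; case: ifP; lia.
case: u => [//|z u] h; have [zk e us] :
    [/\ pos_ok k z, bpos K false k' z = bpos K true k' (head 0 u) & word_ok k2 s u].
  by case/and3P: h => ? /eqP.
have [zk'|zk'] := ltnP (z + k') (2 * K + 1).
  left; apply/mapP; exists z; first by rewrite mem_positions_before // zk.
  congr (_ :: _); exact: (@word_ok_tail k ((k', k2) :: s)).
right; apply/mapP; exists u.
  rewrite mem_filter IH // us andbT; have [y [v' [ev yk]]] := word_ok_head us.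
  by move: e zk yk; rewrite ev /pos_ok /bpos /mid /=; case: ifP; case: ifP; lia.
congr (_ :: _); have [y [v' [ev yk]]] := word_ok_head us.
by move: e zk yk; rewrite ev /pos_ok /bpos /mid /=; case: ifP; case: ifP; lia.
Qed.

Lemma wle_refl u : wle u u.
Proof. by elim: u => //= a u; rewrite leqnn. Qed.

Lemma wle_trans v u w : wle u v -> wle v w -> wle u w.
Proof.
elim: u v w => [|a u IH] [|b v] [|c w] //= /andP[ab uv] /andP[bc vw].
by rewrite (leq_trans ab bc) (IH v).
Qed.

Lemma wle_anti u v : wle u v -> wle v u -> u = v.
Proof.
elim: u v => [|a u IH] [|b v] //= /andP[ab uv] /andP[ba vu].
by rewrite (IH v) // (@anti_leq a b) // ab.
Qed.

Lemma wlt_trans : transitive wlt.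
Proof.
move=> v u w /andP[uv n] /andP[vw n']; rewrite /wlt (wle_trans uv vw).
by apply/eqP => e; subst w; case/eqP: n; exact: wle_anti.
Qed.

Lemma wlt_irr : irreflexive wlt.
Proof. by move=> u; rewrite /wlt eqxx andbF. Qed.

Lemma wlt_cons a b u v : a <= b -> wle u v -> (a < b) || wlt u v -> wlt (a :: u) (b :: v).
Proof.
rewrite /wlt /= => -> -> /=; rewrite eqseq_cons negb_and.
by case/orP => [/ltn_eqF->|->] //; rewrite orbT.
Qed.

Lemma tail_le z z' s : z <= z' -> wle (tail z s) (tail z' s).
Proof.
elim: s z z' => [|p s IH] z z' zz' //=.
have h : minn z p.1 <= minn z' p.1 by lia.
by rewrite h IH.
Qed.

Lemma tail_le_word z k s y u : bounded k s -> word_ok k s (y :: u) -> z <= y -> z <= K ->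
  wle (tail z s) u.
Proof.
elim: s k z y u => [|[k' k2] s IH] k z y [|x u] //=.
  by move=> _ /and3P[_ _]; case: s {IH}.
move=> /and4P[kK k'k k'k2 bs] /and3P[yk /eqP e xu] zy zK.
have h : minn z k' <= x.
  by move: e yk; rewrite /pos_ok /bpos /mid; case: ifP; case: ifP; lia.
by rewrite h (IH k2 _ x) //; lia.
Qed.

Lemma words_sorted k s : bounded k s -> pairwise wlt (words k s).
Proof.
elim: s k => [|[k' k2] s IH] k.
  rewrite words_nil => /andP[kK _]; rewrite pairwise_map; have : pairwise ltn (positions k).
    rewrite pairwise_cat -!sorted_pairwise ?iota_ltn_sorted //; try exact: ltn_trans.
    rewrite !andbT; apply/allrelP => a b; rewrite !mem_iota; lia.
  apply: sub_pairwise => a b ab; have {}ab : a < b := ab; apply: wlt_cons => //; first exact: ltnW.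
  by rewrite ab.
move=> B; have [kK k'k k'k2 bs] : [/\ k <= K, k' < k, k' < k2 & bounded k2 s] by case/and4P: B.
rewrite words_cons pairwise_cat !pairwise_map; apply/and3P; split.
- apply/allrelP => u v /mapP[z]; rewrite mem_positions_before // => /andP[zk zk'] -> /mapP[w].
  rewrite mem_filter mem_words // => /andP[hw wk] ->.
  have [y [w' [ew yk]]] := word_ok_head wk; rewrite {}ew /= in hw wk *.
  rewrite /=; apply: wlt_cons.
  + by move: zk; rewrite leq_max; lia.
  + rewrite /= (tail_le_word bs wk) ?andbT; lia.
  + by apply/orP; left; rewrite leq_max; lia.
- have : pairwise ltn (positions_before k k').
    rewrite pairwise_cat -!sorted_pairwise ?iota_ltn_sorted //; try exact: ltn_trans.
    rewrite !andbT; apply/allrelP => a b; rewrite !mem_iota; lia.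
  apply: sub_pairwise => a b ab; have {}ab : a < b := ab; apply: wlt_cons; first exact: ltnW.
    by apply: (@tail_le _ _ ((k', k2) :: s)); exact: ltnW.
  by rewrite ab.
- have : pairwise wlt [seq u <- words k2 s | k' < head 0 u].
    exact/pairwise_filter/IH.
  apply: (@sub_in_pairwise _ (mem [seq u <- words k2 s | k' < head 0 u])); last exact: allss.
  move=> u v; rewrite !mem_filter !mem_words //.
  move=> /andP[_ /word_ok_head[a [u' [-> _]]]] /andP[_ /word_ok_head[b [v' [-> _]]]] uv.
  have /andP[uv' _] := uv; have /andP[ab _] := uv'.
  by apply: wlt_cons; rewrite ?uv ?orbT //=; lia.
Qed.

Lemma words_total k s u v : bounded k s -> word_ok k s u -> word_ok k s v ->
  wle u v \/ wlt v u.
Proof.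
move=> bs; rewrite -!mem_words // => us vs.
have /(pairwiseP [::]) P := words_sorted bs.
move: (us) (vs); rewrite -!index_mem => ius ivs.
have := P _ _ ius ivs; have := P _ _ ivs ius; rewrite !nth_index //.
have [uv _ /(_ isT)/andP[]|vu /(_ isT)|e _ _] := ltngtP (index u (words k s)) (index v (words k s)).
- by left.
- by right.
- by left; rewrite -(nth_index [::] us) e nth_index // wle_refl.
Qed.

(** * The levels of the functors determine the table *)

(** The level of a position is its dimension in the globe; that of a word is the
    greatest dimension of a cell in the image of the corresponding functor. *)
Definition level z := minn z (2 * K + 1 - z).
Definition lam u := \max_(z <- u) level z.
Definition lams k s := [seq lam u | u <- words k s].

Lemma lam_cons z u : lam (z :: u) = maxn (level z) (lam u).
Proof. exact: big_cons. Qed.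

Lemma lam_tail z s : lam (tail z s) <= z.
Proof.
elim: s z => [|p s IH] z; first by rewrite /lam big_nil.
by rewrite [tail _ _]/= lam_cons /level; have := IH (minn z p.1); lia.
Qed.

Lemma map_level_up k : k <= K -> map level (iota 0 k.+1) = iota 0 k.+1.
Proof. by move=> kK; apply: map_id_in => z; rewrite mem_iota /level; lia. Qed.

Lemma map_level_down k n : k <= K -> n <= k.+1 ->
  map level (iota (2 * K + 1 - k) n) = rev (iota (k.+1 - n) n).
Proof.
move=> kK nk; apply: (@eq_from_nth _ 0); first by rewrite size_map size_rev !size_iota.
move=> i; rewrite size_map size_iota => iT.
rewrite (nth_map 0) ?size_iota // nth_rev ?size_iota // !nth_iota //; last lia.
by rewrite /level; lia.
Qed.

Lemma lams_nil k : k <= K -> lams k [::] = iota 0 k.+1 ++ rev (iota 0 k.+1).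
Proof.
move=> kK; rewrite /lams words_nil -map_comp -{1}(map_level_up kK).
rewrite -[in rev _](subnn k.+1) -map_level_down // -map_cat.
by apply: eq_map => z /=; rewrite lam_cons /lam big_nil maxn0.
Qed.

Lemma words_split k s : bounded k s -> exists (c : nat -> seq nat) R,
  [/\ words k s = map c (iota 0 k.+1) ++ R, forall z, head 0 (c z) = z &
      forall u, u \in R -> k < head 0 u].
Proof.
case: s => [/andP[kK _]|[k' k2] s B].
  exists (fun z => [:: z]), [seq [:: z] | z <- iota (2 * K + 1 - k) k.+1].
  split=> // [|u /mapP[z]]; first by rewrite words_nil map_cat.
  by rewrite mem_iota => zk -> /=; lia.
have [kK k'k k'k2 bs] : [/\ k <= K, k' < k, k' < k2 & bounded k2 s] by case/and4P: B.
exists (fun z => z :: tail z ((k', k2) :: s)), ([seq z :: tail z ((k', k2) :: s) |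
  z <- iota (2 * K + 1 - k) (k - k')] ++
  [seq maxn (head 0 u) (2 * K + 1 - k') :: u | u <- words k2 s & k' < head 0 u]).
split=> // [|u]; first by rewrite words_cons map_cat catA.
rewrite mem_cat => /orP[] /mapP[z]; first by rewrite mem_iota => zk -> /=; lia.
by move=> _ ->; rewrite [head _ _]/=; lia.
Qed.

Lemma filter_words k' k s : bounded k s -> k' < k ->
  [seq u <- words k s | k' < head 0 u] = drop k'.+1 (words k s).
Proof.
move=> bs k'k; have [c [R [-> ch Rk]]] := words_split bs.
have -> : iota 0 k.+1 = iota 0 k'.+1 ++ iota k'.+1 (k - k').
  by rewrite -[k'.+1 in X in _ ++ X]add0n -iotaD; congr iota; lia.
rewrite map_cat -catA drop_size_cat ?size_map ?size_iota // filter_cat.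
rewrite (_ : filter _ _ = [::]) ?cat0s; last first.
  apply/eqP; rewrite -[_ == _]negbK -has_filter; apply/hasPn => u /mapP[z].
  by rewrite mem_iota => zk -> /=; rewrite ch; lia.
apply/all_filterP; rewrite all_cat; apply/andP; split; apply/allP => u.
  by move=> /mapP[z]; rewrite mem_iota => zk ->; rewrite ch; lia.
by move=> /Rk; exact: ltn_trans.
Qed.

(** The sequence of levels climbs to k, descends to k'+1 and goes on climbing
    from there: its peaks and valleys spell out the table. *)
Lemma lams_cons k k' k2 s : bounded k ((k', k2) :: s) ->
  lams k ((k', k2) :: s) = iota 0 k.+1 ++ rev (iota k'.+1 (k - k')) ++ drop k'.+1 (lams k2 s).
Proof.
move=> B.
have [kK k'k k'k2 bs] : [/\ k <= K, k' < k, k' < k2 & bounded k2 s] by case/and4P: B.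
rewrite /lams words_cons map_cat -map_drop -(filter_words bs k'k2) catA -!map_comp; congr (_ ++ _).
  rewrite -{1}(map_level_up kK).
  have -> : iota k'.+1 (k - k') = iota (k.+1 - (k - k')) (k - k') by congr iota; lia.
  rewrite -map_level_down // -?map_cat; last lia.
  apply/eq_in_map => z; rewrite mem_positions_before // => /andP[zk zk'].
  rewrite [ssrfun.comp _ _ _]/= !lam_cons; have := lam_tail (minn z k') s.
  by move: zk zk'; rewrite /pos_ok /mid /level; lia.
apply/eq_in_map => u; rewrite mem_filter mem_words // => /andP[hu uk].
have [y [u' [eu yk]]] := word_ok_head uk; rewrite {}eu /= in hu *.
by rewrite !lam_cons; move: yk; rewrite /pos_ok /mid /level; lia.
Qed.

Lemma nth_lams_up k s i : bounded k s -> i <= k -> nth 0 (lams k s) i = i.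
Proof.
move=> bs ik; have [kK] : k <= K by case: s bs => [|p s] /andP[].
have : exists R, lams k s = iota 0 k.+1 ++ R.
  by case: s bs => [|[k' k2] s] bs; rewrite ?lams_nil ?lams_cons //; eexists.
by case=> R ->; rewrite nth_cat size_iota ltnS ik nth_iota // ltnS.
Qed.

Lemma nth_lams_nil k i : k <= K -> i <= k -> nth 0 (lams k [::]) (k.+1 + i) = k - i.
Proof.
move=> kK ik; rewrite lams_nil // nth_cat size_iota ifF; last lia.
rewrite addKn; by rewrite nth_rev size_iota ?ltnS // nth_iota //; lia.
Qed.

Lemma nth_lams_cons k k' k2 s i : bounded k ((k', k2) :: s) -> i <= k - k' ->
  nth 0 (lams k ((k', k2) :: s)) (k.+1 + i) = if i == k - k' then k'.+1 else k - i.
Proof.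
move=> B; have [kK k'k k'k2 bs] : [/\ k <= K, k' < k, k' < k2 & bounded k2 s] by case/and4P: B.
move=> ik; rewrite lams_cons // nth_cat size_iota ifF; last lia.
rewrite addKn nth_cat size_rev size_iota; case: eqP => [->|ne].
  by rewrite ifF ?subnn ?nth_drop ?addn0 ?nth_lams_up; lia.
rewrite ifT; last lia.
by rewrite nth_rev size_iota ?nth_iota; lia.
Qed.

Lemma lams_inj k s l t : bounded k s -> bounded l t -> lams k s = lams l t -> k = l /\ s = t.
Proof.
have D k0 s0 : bounded k0 s0 -> nth 0 (lams k0 s0) k0.+1 = k0.
  case: s0 => [/andP[kK _]|[k' k2] s0 B].
    by rewrite -[k0.+1]addn0 nth_lams_nil // subn0.
  have [_ k'k _ _] : [/\ k0 <= K, k' < k0, k' < k2 & bounded k2 s0] by case/and4P: B.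
  by rewrite -[k0.+1]addn0 nth_lams_cons //; case: eqP; lia.
elim: s k l t => [|[k' k2] s IH] k l t bs bt e.
all: have {D} ekl : k = l.
1,3: have [kl|lk|//] := ltngtP k l;
  [have := D _ _ bs; rewrite e nth_lams_up //; lia | have := D _ _ bt; rewrite -e nth_lams_up //; lia].
all: subst l; split=> //.
  case: t bt e => // -[l' l2] t bt e.
  have [kK l'k _ _] : [/\ k <= K, l' < k, l' < l2 & bounded l2 t] by case/and4P: bt.
  have := nth_lams_cons bt (leqnn (k - l')).
  by rewrite eqxx -e nth_lams_nil //; lia.
have [kK k'k k'k2 bs2] : [/\ k <= K, k' < k, k' < k2 & bounded k2 s] by case/and4P: bs.
case: t bt e => [|[l' l2] t] bt e.
  have := nth_lams_cons bs (leqnn (k - k')).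
  by rewrite eqxx e nth_lams_nil //; lia.
have [_ l'k l'l2 bt2] : [/\ k <= K, l' < k, l' < l2 & bounded l2 t] by case/and4P: bt.
have [kl|lk|e'] := ltngtP k' l'.
- have := nth_lams_cons bt (leqnn (k - l')).
  by rewrite eqxx -e nth_lams_cons //; [case: eqP|]; lia.
- have := nth_lams_cons bs (leqnn (k - k')).
  by rewrite eqxx e nth_lams_cons //; [case: eqP|]; lia.
- subst l'; move: e; rewrite !lams_cons // => /eqP; rewrite eqseq_cat // => /andP[_].
  rewrite eqseq_cat // => /andP[_ /eqP e].
  suff /(IH _ _ _ bs2 bt2)[-> ->] : lams k2 s = lams l2 t by [].
  rewrite -(cat_take_drop k'.+1 (lams k2 s)) -(cat_take_drop k'.+1 (lams l2 t)) e; congr (_ ++ _).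
  have T k0 s0 : bounded k0 s0 -> k' < k0 -> take k'.+1 (lams k0 s0) = iota 0 k'.+1.
    move=> bs0 kk0; have : k'.+1 <= size (lams k0 s0).
      have [//|h] := ltnP k' (size (lams k0 s0)).
      have := nth_lams_up bs0 kk0; rewrite nth_default //; lia.
    move=> h; apply: (@eq_from_nth _ 0); first by rewrite size_takel // size_iota.
    move=> i; rewrite size_takel // => ik; rewrite nth_take // nth_lams_up // ?nth_iota //; lia.
  by rewrite !T.
Qed.

End Enum.

(** * The category Theta has no isomorphisms but the identities *)

Lemma word_okP K k s u : word_ok K k s u <->
  [/\ size u = (size s).+1,
      forall i, i <= size s -> pos_ok K (nth 0 (k :: unzip2 s) i) (nth 0 u i) &
      forall i, i < size s -> bpos K false (nth 0 (unzip1 s) i) (nth 0 u i) =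
                              bpos K true (nth 0 (unzip1 s) i) (nth 0 u i.+1)].
Proof.
elim: s k u => [|[k' k2] s IH] k u.
  split=> [|[]]; first by case: u => [|z []] //= zk; split=> // -[].
  by case: u => [|z []] //= _ /(_ 0 isT).
split=> [|[]].
  case: u => // z u /and3P[zk /eqP e /IH[us uk ue]]; split=> [|i iT|i iT]; first by rewrite /= us.
    by case: i iT.
  by case: i iT => [|i] iT; [rewrite /= nth0 | exact: ue].
case: u => // z u [us] uk ue; apply/and3P; split; first exact: (uk 0 isT).
  by have := ue 0 isT; rewrite /= nth0 => ->.
by apply/IH; split=> // i iT; [exact: (uk i.+1 iT) | exact: (ue i.+1 iT)].
Qed.

Section Words.
Variables (T : table) (K : nat).
Hypothesis TK : height T <= K.
Let X := Theta_of T.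
Let g := gen T K.

Lemma bounded_table : bounded K (sval T).1 (sval T).2.
Proof.
have tkK i : tk T i <= K := leq_trans (tk_height T i) TK.
have B n : n <= tsize T ->
    bounded K (tk T (tsize T - n)) (drop (tsize T - n) (sval T).2).
  elim: n => [_|n IH nT]; first by rewrite subn0 drop_size /= tkK.
  have iT : tsize T - n.+1 < tsize T by lia.
  have /andP[h1 h2] := tk'_lt iT.
  rewrite (drop_nth (0, 0)) // [bounded _ _ _]/= tkK.
  move: h1 h2 (IH (ltnW nT)).
  have e : (tsize T - n.+1).+1 = tsize T - n by lia.
  rewrite /tk' {2 3}/tk /= (nth_map (0, 0)) // (nth_map (0, 0)) // e.
  move=> -> ->; rewrite -e /tk /= (nth_map (0, 0)) //.
by have := B _ (leqnn _); rewrite subnn drop0.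
Qed.

Definition word (F : ofunctor X (globe K)) := [seq sval (F K (g i)) | i <- iota 0 (tsize T).+1].

Lemma nth_word F i : i <= tsize T -> nth 0 (word F) i = sval (F K (g i)).
Proof. by move=> iT; rewrite (nth_map 0) ?size_iota // nth_iota. Qed.

Lemma word_inj F G : word F = word G -> F = G.
Proof.
move=> e; apply: (functor_eqK TK) => i iT; apply: val_inj.
by rewrite /= -(nth_word F iT) e nth_word.
Qed.

Lemma word_in F : word F \in words K (sval T).1 (sval T).2.
Proof.
rewrite mem_words ?bounded_table //; apply/word_okP.
have [d m] := functor_ediag F TK; split; first by rewrite size_map size_iota.
  by move=> i iT; rewrite nth_word //; apply/andP; exact: d.
by move=> i iT; rewrite !nth_word //; [exact: m | exact: ltnW].
Qed.

Lemma words_word u : u \in words K (sval T).1 (sval T).2 -> exists F, word F = u.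
Proof.
rewrite mem_words ?bounded_table // => /word_okP[us uk ue].
have D : ediag K T (nth 0 u).
  by split=> i iT; [apply/andP; exact: uk | exact: ue].
have [F FE] := globe_functor TK D; exists F.
apply: (@eq_from_nth _ 0); first by rewrite us size_map size_iota.
by move=> i; rewrite size_map size_iota ltnS => iT; rewrite nth_word // FE.
Qed.

End Words.

Section Truncation.
Variable K : nat.

(** Truncation of the globe at dimension k: the cells of dimension at least k are all
    identified. *)
Definition pk k z := if (k < z) && (z + k <= 2 * K + 1) then k else z.

Lemma pk_bpos k b j z : pk k (bpos K b j z) = bpos K b j (pk k z).
Proof. by rewrite /pk /bpos /mid; case: b; repeat case: ifP; lia. Qed.

Lemma pk_gcpv k j x y : bpos K false j x = bpos K true j y ->
  pk k (gcpv K j x y) = gcpv K j (pk k x) (pk k y).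
Proof. by rewrite /pk /bpos /gcpv /mid; repeat case: ifP; lia. Qed.

Lemma bpos_mono b j z z' : z <= z' -> bpos K b j z <= bpos K b j z'.
Proof. by rewrite /bpos /mid; case: b; repeat case: ifP; lia. Qed.

Lemma pk_mono k z z' : z <= z' -> pk k z <= pk k z'.
Proof. by rewrite /pk; repeat case: ifP; lia. Qed.

Lemma pk0 z : z <= 2 * K + 1 -> pk 0 z = 0.
Proof. by rewrite /pk; case: ifP; lia. Qed.

Lemma pkK z : pk K.+1 z = z.
Proof. by rewrite /pk; case: ifP; lia. Qed.

Lemma bpos_match j x y : bpos K false j x = bpos K true j y ->
  (mid K j x /\ y = j) \/ (mid K j x = false /\ (x = y \/ j < y /\ x = 2 * K + 1 - j)).
Proof. by rewrite /bpos; case: ifP; case: ifP; rewrite /mid; lia. Qed.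

(** Composition in the globe is not monotone in general, but it becomes so
    when comparing, up to truncation at k + 1, cells that agree up to truncation at k. *)
Lemma gcpv_mono k j x y x' y' :
  bpos K false j x = bpos K true j y -> bpos K false j x' = bpos K true j y' ->
  pk k x = pk k x' -> pk k y = pk k y' ->
  pk k.+1 x <= pk k.+1 x' -> pk k.+1 y <= pk k.+1 y' ->
  pk k.+1 (gcpv K j x y) <= pk k.+1 (gcpv K j x' y').
Proof.
move=> /bpos_match c /bpos_match c'; rewrite /gcpv.
case: c c' => [[m ->]|[m c]] [[m' ->]|[m' c']]; rewrite ?m ?m' // {m'}.
  by move: m; rewrite /pk /mid; repeat case: ifP; lia.
by move: m; rewrite /pk /mid; repeat case: ifP; lia.
Qed.

End Truncation.

Lemma composable_sval K j (x y : ar (globe K) K) :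
  composable j x y -> bpos K false j (sval x) = bpos K true j (sval y).
Proof. by case=> _ /(congr1 sval); rewrite !sval_bd. Qed.

Section Order.
Variables (T : table) (K : nat).
Hypothesis TK : height T <= K.
Let X := Theta_of T.
Let g := gen T K.
Implicit Types F G : ofunctor X (globe K).

Let agree k F G := forall c, pk K k (sval (F K c)) = pk K k (sval (G K c)).

Lemma agree_gen k F G :
  (forall i, i <= tsize T -> pk K k (sval (F K (g i))) = pk K k (sval (G K (g i)))) -> agree k F G.
Proof.
move=> h; rewrite /agree; elim/(gen_ind TK) => [//|b l c _ IH|l c d cd IHc IHd].
  by rewrite !fmap_bd !sval_bd !pk_bpos IH.
have cF := fmap_composable F cd; have cG := fmap_composable G cd.
by rewrite !fmap_cp // !sval_cp // !pk_gcpv ?IHc ?IHd //; exact: composable_sval.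
Qed.

(** An order on functors to the globe that makes sense without reference to the
    generators of Theta(T), hence is invariant under isomorphism: compare in the first
    dimension where the truncations of the functors differ. *)
Definition precedes (A : omegacat) (F G : ofunctor A (globe K)) := exists k,
  [/\ forall c, pk K k (sval (F K c)) = pk K k (sval (G K c)),
      exists c, pk K k.+1 (sval (F K c)) <> pk K k.+1 (sval (G K c)) &
      forall c, pk K k.+1 (sval (F K c)) <= pk K k.+1 (sval (G K c))].

Lemma wle_word F G : wle (word F) (word G) ->
  forall i, i <= tsize T -> sval (F K (g i)) <= sval (G K (g i)).
Proof.
have wle_nth u v i : wle u v -> nth 0 u i <= nth 0 v i.
  by elim: u v i => [|a u IH] [|b v] [|i] //= /andP[ab]; last exact: IH.
by move=> /wle_nth h i iT; rewrite -!nth_word.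
Qed.

(** Compare at the first truncation that distinguishes the generators; by
    induction on cells the inequality extends from generators to all cells. *)
Lemma wlt_precedes F G : wlt (word F) (word G) -> precedes F G.
Proof.
case/andP=> FG ne; have le := wle_word FG.
pose P k := [exists i : 'I_(tsize T).+1,
  pk K k.+1 (sval (F K (g i))) != pk K k.+1 (sval (G K (g i)))].
have exP : exists k, P k.
  exists K; apply/existsP; apply: contrapT => h; case/eqP: ne; congr word; apply: (functor_eqK TK).
  move=> i iT; apply: val_inj => /=; rewrite -[LHS](pkK K) -[RHS](pkK K); apply/eqP.
  rewrite -ltnS in iT; apply: contrapT => /negP ni; case: h.
  by exists (Ordinal iT).
case: (ex_minnP exP) => k /existsP[i /eqP ni] kmin.
have ag : agree k F G.
  apply: agree_gen => l lT; case: k {i ni} kmin => [|k] kmin.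
    by rewrite !pk0 //; case: (_ K (g l)) => z /= /andP[].
  rewrite -ltnS in lT; apply/eqP; apply: contrapT => /negP nl.
  suff /kmin : P k by rewrite ltnn.
  by apply/existsP; exists (Ordinal lT).
exists k; split=> //; first by exists (g i).
elim/(gen_ind TK) => [l lT|b l c _ IH|l c d cd IHc IHd].
- exact/pk_mono/le.
- by rewrite !fmap_bd !sval_bd !pk_bpos; exact: bpos_mono.
- have cF := fmap_composable F cd; have cG := fmap_composable G cd.
  rewrite !fmap_cp // !sval_cp //; apply: gcpv_mono; try exact: composable_sval; by [|exact: ag].
Qed.

Lemma precedes_word F G : precedes F G -> wlt (word F) (word G).
Proof.
case=> k [ag [c nc] le].
have ok (H : ofunctor X (globe K)) : word_ok K (sval T).1 (sval T).2 (word H).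
  by have := word_in TK H; rewrite mem_words //; exact: bounded_table.
have [w|//] := words_total (bounded_table TK) (ok G) (ok F).
case: nc; apply: agree_gen => i iT; apply/eqP; rewrite eqn_leq le /=.
exact/pk_mono/wle_word.
Qed.

End Order.

(** Precomposition with an isomorphism f preserves the order and the levels of
    functors to the globe. Since these functors form a finite chain, whose sequence of
    levels determines T, this forces f to be an identity. *)
Section Rigid.
Variables (S T : table) (K : nat).
Hypotheses (SK : height S <= K) (TK : height T <= K).
Variables (f : ofunctor (Theta_of S) (Theta_of T)) (f' : ofunctor (Theta_of T) (Theta_of S)).
Hypotheses (ff' : ocomp f f' = oid _) (f'f : ocomp f' f = oid _).

Let f_f' c : f K (f' K c) = c.
Proof. exact: (congr1 (fun F : ofunctor _ _ => F K c) ff'). Qed.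

Lemma precedes_precomp (F G : ofunctor (Theta_of T) (globe K)) :
  precedes F G -> precedes (ocomp F f) (ocomp G f).
Proof.
case=> k [ag [c nc] le]; exists k; split=> [d||d]; [exact: ag| |exact: le].
by exists (f' K c); rewrite !ocompE f_f'.
Qed.

Lemma lam_le (U : table) (F : ofunctor (Theta_of U) (globe K)) m : height U <= K ->
  lam K (word F) <= m <-> forall c, level K (sval (F K c)) <= m.
Proof.
move=> UK; split=> [|h]; last first.
  by apply/bigmax_leqP_seq => z /mapP[i _ ->] _.
move=> /bigmax_leqP_seq h; elim/(gen_ind UK) => [i iU|b l c _ IH|l c d cd IHc IHd].
- by apply: h => //; apply/mapP; exists i => //; rewrite mem_iota.
- rewrite fmap_bd sval_bd; apply: leq_trans _ IH.
  by rewrite /level /bpos /mid; case: b; case: ifP; lia.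
- by rewrite fmap_cp // sval_cp //; [rewrite /gcpv; case: ifP|exact: fmap_composable].
Qed.

Lemma lam_precomp (F : ofunctor (Theta_of T) (globe K)) : lam K (word (ocomp F f)) = lam K (word F).
Proof.
apply/eqP; rewrite eqn_leq; apply/andP; split; apply/lam_le => // c.
  by have /(lam_le _ _ TK) := leqnn (lam K (word F)); apply.
by have /(lam_le _ _ SK)/(_ (f' K c)) := leqnn (lam K (word (ocomp F f))); rewrite ocompE f_f'.
Qed.

(** Precomposition with f, as a map between words. *)
Definition star (u : seq nat) : seq nat :=
  match pselect (exists F : ofunctor (Theta_of T) (globe K), word F = u) with
  | left h => word (ocomp (projT1 (cid h)) f)
  | right _ => [::]
  end.

Lemma star_word (F : ofunctor (Theta_of T) (globe K)) : star (word F) = word (ocomp F f).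
Proof.
rewrite /star; case: pselect => [h|]; last by case; exists F.
by case: cid => G /= /(word_inj TK) ->.
Qed.

(** Precomposition is an increasing bijection between finite chains, so it matches
    their enumerations. *)
Lemma map_star : map star (words K (sval T).1 (sval T).2) = words K (sval S).1 (sval S).2.
Proof.
apply: (irr_sorted_eq wlt_trans wlt_irr).
- rewrite sorted_pairwise; last exact: wlt_trans.
  rewrite pairwise_map; have := words_sorted (bounded_table TK).
  apply: sub_in_pairwise (allss _) => u v /(words_word TK)[F <-] /(words_word TK)[G <-] uv.
  by rewrite /= !star_word; apply/precedes_word/precedes_precomp/wlt_precedes.
- by apply: pairwise_sorted; apply: words_sorted; exact: bounded_table.
- move=> u; apply/mapP/idP => [[v /(words_word TK)[F <-] ->]|].
    by rewrite star_word word_in.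
  move=> /(words_word SK)[F <-]; exists (word (ocomp F f')); first exact: word_in.
  rewrite star_word; congr word; apply: ofunctor_eq => k c; rewrite !ocompE.
  have e : f' k (f k c) = c := congr1 (fun G : ofunctor _ _ => G k c) f'f.
  by rewrite e.
Qed.

Lemma table_rigid : S = T.
Proof.
have /lams_inj[] : lams K (sval T).1 (sval T).2 = lams K (sval S).1 (sval S).2.
- rewrite /lams -map_star -map_comp; apply/eq_in_map => u /(words_word TK)[F <-].
  by rewrite /= star_word lam_precomp.
- exact: bounded_table.
- exact: bounded_table.
by move=> e1 e2; apply: table_eq; case: (sval S) (sval T) e1 e2 => ? ? [? ?] /= -> ->.
Qed.

Lemma star_id : S = T ->
  forall F : ofunctor (Theta_of T) (globe K), word (ocomp F f) = word F.
Proof.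
move=> e F; rewrite -star_word.
have : map star (words K (sval T).1 (sval T).2) = map id (words K (sval T).1 (sval T).2).
  by rewrite map_id map_star e.
by move=> /eq_in_map -> //; exact: word_in.
Qed.

End Rigid.

(** An automorphism acts trivially on functors to the globe, which separate cells. *)
Lemma auto_id T (f f' : ofunctor (Theta_of T) (Theta_of T)) :
  ocomp f f' = oid _ -> ocomp f' f = oid _ -> f = oid _.
Proof.
move=> ff' f'f; apply: (functor_eq_cells (leqnn (height T))) => c.
apply: globes_separateP => // F.
have := star_id (leqnn _) (leqnn _) ff' f'f erefl F => /(word_inj (leqnn _)) e.
exact: (congr1 (fun G : ofunctor _ _ => G _ c) e).
Qed.

Transparent bd resize.

(** * Reversing Theta(T) *)

Lemma rev_resize r (C : omegacat) b i k (x : ar C k) :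
  @resize (rev_ocat r C) b i k x = @resize C (b (+) r i) i k x.
Proof.
have [ik|ki|e] := ltngtP i k.
- rewrite (@resize_lt (rev_ocat r C) _ _ _ ik) (@resize_lt C _ _ _ ik) /= /rsrc /rtgt.
  by case: b; case: (r i).
- by rewrite (@resize_gt (rev_ocat r C) _ _ _ ki) (@resize_gt C _ _ _ ki).
- by case: _ / e x => x; rewrite (@resize_id (rev_ocat r C)) (@resize_id C).
Qed.

Lemma rev_bd r (C : omegacat) K b j (x : ar C K) :
  @bd (rev_ocat r C) K b j x = @bd C K (b (+) r j) j x.
Proof.
rewrite /bd !rev_resize; have [jK|Kj] := leqP j K; first exact: (@resize_up C).
by rewrite !(resize_resize _ _ _ _ (ltnW Kj)) !resize_id.
Qed.

Lemma rev_rev_bd r (C : omegacat) K b j (x : ar C K) :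
  @bd (rev_ocat r (rev_ocat r C)) K b j x = @bd C K b j x.
Proof. by rewrite (@rev_bd r (rev_ocat r C)) (@rev_bd r C) -addbA addbb addbF. Qed.

Lemma rev_dimle r (C : omegacat) K k (x : ar C K) :
  @dimle (rev_ocat r C) K k x <-> @dimle C K k x.
Proof.
rewrite /dimle rev_bd; split=> [<-|h]; first exact: (@dimle_bd C).
exact: (@dimleP C) h (leqnn k).
Qed.

Opaque bd resize.

Lemma diag_const (C : omegacat) K T (y : nat -> ar C K) b l : diag T y ->
  (forall i, i < tsize T -> l < tk' T i) ->
  forall i, i <= tsize T -> bd b l (y i) = bd b l (y 0).
Proof.
move=> [_ M] lT; elim=> // i IH iT; rewrite -(IH (ltnW iT)).
have := bd_bd b true l (tk' T i) (y i.+1); rewrite lT // => <-.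
by rewrite -M // bd_bd lT.
Qed.

Lemma diag_ext (C : omegacat) K T (y y' : nat -> ar C K) :
  (forall i, i <= tsize T -> y i = y' i) -> diag T y -> diag T y'.
Proof.
move=> e [D M]; split=> i iT; first by rewrite -e //; exact: D.
by rewrite -!e //; [exact: M | exact: ltnW].
Qed.

Lemma diag_join (C : omegacat) K T T1 T2 j (y : nat -> ar C K) : is_join T T1 T2 j ->
  diag T y <-> [/\ diag T1 y, diag T2 (fun i => y (tsize T1 + i.+1)) &
                   bd false j (y (tsize T1)) = bd true j (y (tsize T1).+1)].
Proof.
move=> TJ; have e := tsize_join TJ; split=> [[D M]|[[D1 M1] [D2 M2] M0]].
  split; [split=> i iT..|].
  - by rewrite -(tk_join1 TJ) //; apply: D; lia.
  - by rewrite -(tk'_join1 TJ) //; apply: M; lia.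
  - by rewrite -(tk_join2 TJ) //; apply: D; lia.
  - by rewrite -(tk'_join2 TJ) //; rewrite [_ + i.+2]addnS; apply: M; lia.
  - by rewrite -(tk'_join0 TJ); apply: M; lia.
split.
  by apply: (join_cases TJ) => i iT; rewrite ?(tk_join2 TJ) ?(tk_join1 TJ) //; auto.
apply: (join_cases' TJ) => [i iT||i iT].
- by rewrite (tk'_join1 TJ) //; exact: M1.
- by rewrite (tk'_join0 TJ).
- by rewrite (tk'_join2 TJ); have := M2 i iT; rewrite /= [_ + i.+2]addnS.
Qed.

(** T' is obtained from T by exchanging, for each j with r j, the two parts of the
    table on both sides of a minimal entry j; the i-th cell of T' comes from the
    (f i)-th cell of T. *)
Inductive rearranged (r : nat -> bool) : table -> table -> (nat -> nat) -> Prop :=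
| RSingle T : tsize T = 0 -> rearranged r T T id
| RKeep T T1 T2 T' T1' T2' j f1 f2 : r j = false ->
    above j T1 -> above j T2 -> is_join T T1 T2 j -> is_join T' T1' T2' j ->
    rearranged r T1 T1' f1 -> rearranged r T2 T2' f2 ->
    rearranged r T T' (fun i => if i <= tsize T1 then f1 i
                                else tsize T1 + (f2 (i - (tsize T1).+1)).+1)
| RSwap T T1 T2 T' T1' T2' j f1 f2 : r j = true ->
    above j T1 -> above j T2 -> is_join T T1 T2 j -> is_join T' T2' T1' j ->
    rearranged r T1 T1' f1 -> rearranged r T2 T2' f2 ->
    rearranged r T T' (fun i => if i <= tsize T2 then tsize T1 + (f2 i).+1
                                else f1 (i - (tsize T2).+1)).

Section Rearranged.
Variable r : nat -> bool.

Lemma rearranged_tsize T T' f : rearranged r T T' f ->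
  tsize T' = tsize T /\ forall i, i <= tsize T -> f i <= tsize T.
Proof.
elim=> {T T' f} [T T0|T T1 T2 T' T1' T2' j f1 f2 _ _ _ TJ TJ' _ [e1 h1] _ [e2 h2]|
  T T1 T2 T' T1' T2' j f1 f2 _ _ _ TJ TJ' _ [e1 h1] _ [e2 h2]]; first by [].
- rewrite (tsize_join TJ) (tsize_join TJ') e1 e2; split=> // i iT.
  by case: (leqP i (tsize T1)) => iT1; [have := h1 i iT1 | have := h2 (i - (tsize T1).+1)]; lia.
- rewrite (tsize_join TJ) (tsize_join TJ') e1 e2; split=> [|i iT]; first lia.
  by case: (leqP i (tsize T2)) => iT2; [have := h2 i iT2 | have := h1 (i - (tsize T2).+1)]; lia.
Qed.

Lemma rearranged_above T T' f l : rearranged r T T' f -> above l T -> above l T'.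
Proof.
elim=> {T T' f} [//|T T1 T2 T' T1' T2' j f1 f2 _ _ _ TJ TJ' _ h1 _ h2|
  T T1 T2 T' T1' T2' j f1 f2 _ _ _ TJ TJ' _ h1 _ h2] /(join_above TJ)[lj l1 l2];
  by apply: (above_join TJ' lj); auto.
Qed.

Lemma rearranged_height T T' f : rearranged r T T' f -> height T' <= height T.
Proof.
elim=> {T T' f} [//|T T1 T2 T' T1' T2' j f1 f2 _ _ _ TJ TJ' _ h1 _ h2|
  T T1 T2 T' T1' T2' j f1 f2 _ _ _ TJ TJ' _ h1 _ h2];
  have [k1 k2] := (height_join TJ (height T)).1 (leqnn _);
  by apply/(height_join TJ'); split; [apply: leq_trans h1 _ | apply: leq_trans h2 _]
  || by apply/(height_join TJ'); split; [apply: leq_trans h2 _ | apply: leq_trans h1 _].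
Qed.

Lemma rearranged_exists T : exists T' f, rearranged r T T' f.
Proof.
elim/table_ind: T => [T T0|T T1 T2 j TJ a1 a2 [T1' [f1 h1]] [T2' [f2 h2]]].
  by exists T, id; exact: RSingle.
have b1 := rearranged_above h1 a1; have b2 := rearranged_above h2 a2.
case rj: (r j).
  have [T' TJ'] := join_exists b2 b1; exists T'; eexists.
  exact: RSwap rj a1 a2 TJ TJ' h1 h2.
have [T' TJ'] := join_exists b1 b2; exists T'; eexists.
exact: RKeep rj a1 a2 TJ TJ' h1 h2.
Qed.

Lemma rearranged_sym T T' f : rearranged r T T' f -> exists2 g, rearranged r T' T g &
  forall i, i <= tsize T -> f (g i) = i /\ g (f i) = i.
Proof.
elim=> {T T' f} [T T0|T T1 T2 T' T1' T2' j f1 f2 rj a1 a2 TJ TJ' h1 [g1 k1 e1] h2 [g2 k2 e2]|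
  T T1 T2 T' T1' T2' j f1 f2 rj a1 a2 TJ TJ' h1 [g1 k1 e1] h2 [g2 k2 e2]].
- by exists id; [exact: RSingle|].
all: have b1 := rearranged_above h1 a1; have b2 := rearranged_above h2 a2.
all: have [s1 F1] := rearranged_tsize h1; have [s2 F2] := rearranged_tsize h2.
all: have [_ G1] := rearranged_tsize k1; have [_ G2] := rearranged_tsize k2.
all: rewrite s1 in G1; rewrite s2 in G2.
- eexists; first exact: RKeep rj b1 b2 TJ' TJ k1 k2.
  move=> i; rewrite (tsize_join TJ) s1 => iT; case: (leqP i (tsize T1)) => iT1.
    by have [-> ->] := e1 i iT1; rewrite G1 // F1.
  have iT2 : i - (tsize T1).+1 <= tsize T2 by lia.
  have [E E'] := e2 _ iT2.
  have t n : (tsize T1 + n.+1 <= tsize T1) = false by lia.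
  have u n : tsize T1 + n.+1 - (tsize T1).+1 = n by lia.
  by rewrite !t !u E E'; lia.
- eexists; first exact: RSwap rj b2 b1 TJ' TJ k2 k1.
  move=> i; rewrite (tsize_join TJ) s1 s2 => iT; split.
    case: (leqP i (tsize T1)) => iT1.
      have [E _] := e1 i iT1; rewrite ifF; last by have := G1 i iT1; lia.
      by rewrite (_ : _ - _ = g1 i) //; lia.
    have iT2 : i - (tsize T1).+1 <= tsize T2 by lia.
    by have [E _] := e2 _ iT2; rewrite G2 // E; lia.
  case: (leqP i (tsize T2)) => iT2.
    have [_ E] := e2 i iT2; rewrite ifF; last by have := F2 i iT2; lia.
    by rewrite (_ : _ - _ = f2 i) //; lia.
  have iT1 : i - (tsize T2).+1 <= tsize T1 by lia.
  by have [_ E] := e1 _ iT1; rewrite F1 // E; lia.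
Qed.

(** The second assertion, about the two ends of the diagram, is what allows the
    induction to glue the rearranged parts. *)
Lemma rearranged_diag T T' f (C : omegacat) K (y : nat -> ar C K) : rearranged r T T' f ->
  @diag (rev_ocat r C) K T y -> @diag C K T' (fun i => y (f i)) /\
  forall l, above l T ->
    bd false l (y (f (tsize T))) = bd false l (if r l then y 0 else y (tsize T)) /\
    bd true l (y (f 0)) = bd true l (if r l then y (tsize T) else y 0).
Proof.
move=> h; elim: h y => {T T' f} [T T0|T T1 T2 T' T1' T2' j f1 f2 rj a1 a2 TJ TJ' h1 IH1 h2 IH2|
  T T1 T2 T' T1' T2' j f1 f2 rj a1 a2 TJ TJ' h1 IH1 h2 IH2] y D.
  split=> [|l _]; last by rewrite T0 if_same.
  by case: D => D _; split=> i iT; [apply/(rev_dimle r); exact: D | rewrite T0 in iT].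
all: have [D1 D2] := (@diag_join (rev_ocat r C) K _ _ _ _ y TJ).1 D; rewrite !rev_bd rj => M0.
all: have [E1 X1] := IH1 _ D1; have [E2 X2] := IH2 _ D2.
all: have [s1 _] := rearranged_tsize h1; have [s2 _] := rearranged_tsize h2.
all: have st := tsize_join TJ.
all: have t1 n : (tsize T1 + n.+1 <= tsize T1) = false by lia.
all: have t2 n : (tsize T2 + n.+1 <= tsize T2) = false by lia.
all: have u1 n : tsize T1 + n.+1 - (tsize T1).+1 = n by lia.
all: have u2 n : tsize T2 + n.+1 - (tsize T2).+1 = n by lia.
(* Below the cutting dimension, all cells of the diagram have the same boundaries. *)
all: have cst l b i : l < j -> i <= tsize T -> bd b l (y i) = bd b l (y 0);
  [move=> lj iT; have [_ aj] := above_join TJ (leqnn j) a1 a2;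
   have lT m : m < tsize T -> l < tk' T m := fun mT => leq_trans lj (aj m mT);
   have := @diag_const (rev_ocat r C) K T y (b (+) r l) l D lT i iT;
   by rewrite !rev_bd -addbA addbb addbF|].
- have lt l : r l -> above l T -> l < j.
    move=> rl /(join_above TJ)[lj _ _]; rewrite ltn_neqAle lj andbT.
    by apply: contraTneq rl => ->; rewrite rj.
  split=> [|l aT].
    apply/(diag_join _ TJ'); split.
    + by apply: diag_ext E1 => i; rewrite s1 => ->.
    + by apply: diag_ext E2 => i; rewrite s1 t1 u1.
    + have := (X1 j a1).1; have := (X2 j a2).2; rewrite rj.
      by rewrite s1 leqnn ltnn subnn => -> ->; rewrite addn1.
  have [lj l1 l2] := join_above TJ aT.
  have := (X1 l l1).2; have := (X2 l l2).1.
  rewrite st t1 u1 leq0n => -> ->; case rl: (r l) => //.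
  by rewrite !cst //; first [exact: lt | lia].
- have lt l : r l = false -> above l T -> l < j.
    move=> rl /(join_above TJ)[lj _ _]; rewrite ltn_neqAle lj andbT.
    by apply: contraFneq rl => ->; rewrite rj.
  split=> [|l aT].
    apply/(diag_join _ TJ'); split.
    + by apply: diag_ext E2 => i; rewrite s2 => ->.
    + by apply: diag_ext E1 => i; rewrite s2 t2 u2.
    + have := (X1 j a1).2; have := (X2 j a2).1; rewrite rj.
      by rewrite s2 leqnn ltnn subnn => -> ->; rewrite addn1 M0.
  have [lj l1 l2] := join_above TJ aT.
  have := (X1 l l1).1; have := (X2 l l2).2.
  have -> : tsize T = tsize T2 + (tsize T1).+1 by lia.
  rewrite t2 u2 leq0n => -> ->; case rl: (r l).
    by have -> : tsize T1 + (tsize T2).+1 = tsize T2 + (tsize T1).+1 by lia.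
  by rewrite !cst //; first [exact: lt | lia].
Qed.

End Rearranged.

Section RevFunctors.
Variables (r1 r2 r3 : nat -> bool).
Hypothesis r12 : forall j, r3 j = r1 j (+) r2 j.

Definition rev_add (C : omegacat) : ofunctor (rev_ocat r1 (rev_ocat r2 C)) (rev_ocat r3 C).
Proof.
refine (@OFunctor (rev_ocat r1 (rev_ocat r2 C)) (rev_ocat r3 C) (fun k x => x) _ _ _ _).
- by move=> j k jk x; rewrite /= /rsrc /rtgt /= /rsrc /rtgt r12; case: (r1 j); case: (r2 j).
- by move=> j k jk x; rewrite /= /rsrc /rtgt /= /rsrc /rtgt r12; case: (r1 j); case: (r2 j).
- by [].
- move=> j k jk x y; rewrite /= /rcomp /rsrc /rtgt /= /rcomp /rsrc /rtgt.
  move: (r12 j); case: (r1 j); case: (r2 j); case: (r3 j) => // _ e e'; exact: comp_congr.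
Defined.

Definition rev_split (C : omegacat) : ofunctor (rev_ocat r3 C) (rev_ocat r1 (rev_ocat r2 C)).
Proof.
refine (@OFunctor (rev_ocat r3 C) (rev_ocat r1 (rev_ocat r2 C)) (fun k x => x) _ _ _ _).
- by move=> j k jk x; rewrite /= /rsrc /rtgt /= /rsrc /rtgt r12; case: (r1 j); case: (r2 j).
- by move=> j k jk x; rewrite /= /rsrc /rtgt /= /rsrc /rtgt r12; case: (r1 j); case: (r2 j).
- by [].
- move=> j k jk x y; rewrite /= /rcomp /rsrc /rtgt /= /rcomp /rsrc /rtgt.
  move: (r12 j); case: (r1 j); case: (r2 j); case: (r3 j) => // _ e e'; exact: comp_congr.
Defined.

End RevFunctors.

Section RevNone.
Variable r : nat -> bool.
Hypothesis r0 : forall j, r j = false.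

Definition rev_trivial (C : omegacat) : ofunctor (rev_ocat r C) C.
Proof.
refine (@OFunctor (rev_ocat r C) C (fun k x => x) _ _ _ _).
- by move=> j k jk x; rewrite /= /rsrc r0.
- by move=> j k jk x; rewrite /= /rtgt r0.
- by [].
- move=> j k jk x y; rewrite /= /rcomp /rsrc /rtgt.
  by move: (r0 j); case: (r j) => // _ e e'; exact: comp_congr.
Defined.

Definition rev_trivial_inv (C : omegacat) : ofunctor C (rev_ocat r C).
Proof.
refine (@OFunctor C (rev_ocat r C) (fun k x => x) _ _ _ _).
- by move=> j k jk x; rewrite /= /rsrc r0.
- by move=> j k jk x; rewrite /= /rtgt r0.
- by [].
- move=> j k jk x y; rewrite /= /rcomp /rsrc /rtgt.
  by move: (r0 j); case: (r j) => // _ e e'; exact: comp_congr.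
Defined.

End RevNone.

Lemma rearranged_functor r S T f K : height S <= K -> rearranged r S T f ->
  exists F : ofunctor (Theta_of T) (rev_ocat r (Theta_of S)),
    forall i, i <= tsize T -> F K (gen T K i) = gen S K (f i).
Proof.
move=> SK h; have TK := leq_trans (rearranged_height h) SK.
have D : @diag (rev_ocat r (rev_ocat r (Theta_of S))) K S (gen S K).
  have [D M] := gen_diag SK; split=> i iS.
    exact/(@rev_dimle r (rev_ocat r (Theta_of S)))/(@rev_dimle r (Theta_of S))/D.
  by rewrite !(@rev_rev_bd r (Theta_of S)); exact: M.
have [E _] := rearranged_diag h D; have [F FE] := diag_functor TK E.
by exists F => i iT; rewrite FE.
Qed.

Definition rev_twice r (C : omegacat) : ofunctor (rev_ocat r (rev_ocat r C)) C :=
  ocomp (rev_trivial (fun=> erefl) C) (rev_add (fun j => esym (addbb (r j))) C).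

(** Rearranging the table accordingly, the generators correspond to each other; and
    rearranging twice restores T. *)
Lemma rev_Theta r T : exists T' (F : ofunctor (Theta_of T') (rev_ocat r (Theta_of T)))
    (G : ofunctor (rev_ocat r (Theta_of T)) (Theta_of T')),
  [/\ height T' <= height T, ocomp G F = oid _ & ocomp F G = oid _].
Proof.
have [T' [f h]] := rearranged_exists r T; have [g h' fg] := rearranged_sym h.
have T'T := rearranged_height h; have [s fT] := rearranged_tsize h.
have [_] := rearranged_tsize h'; rewrite s => gT.
have [F FE] := rearranged_functor (leqnn _) h; have [G GE] := rearranged_functor T'T h'.
exists T', F, (ocomp (rev_twice r _) (rev_ofunctor r G)); split=> //.
  apply: (functor_eqK T'T) => i; rewrite s => iT.
  transitivity (G _ (F _ (gen T' (height T) i))); first by [].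
  rewrite FE ?s // GE ?fT //; by have [_ ->] := fg i iT.
have FG : ocomp (rev_twice r _) (ocomp (rev_ofunctor r F) G) = oid (Theta_of T).
  apply: (functor_eqK (leqnn _)) => i iT.
  transitivity (F _ (G _ (gen T (height T) i))); first by [].
  rewrite GE // FE ?s ?gT //; by have [-> _] := fg i iT.
apply: ofunctor_eq => k x.
exact: (congr1 (fun H : ofunctor (Theta_of T) (Theta_of T) => H k x) FG).
Qed.

(** * Gaunt categories *)

Lemma arr_eq_ends (C : category) (a b c d : C) (f : hom a b) (g : hom c d) :
  arr_eq f g -> a = c /\ b = d.
Proof. by case. Qed.

Lemma arr_eq_eq (C : category) (a b : C) (f g : hom a b) : arr_eq f g -> f = g.
Proof.
move=> fg.
pose P c d (w : hom c d) := forall (e1 : c = a) (e2 : d = b),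
  f = ecast z (hom a z) e2 (ecast z (hom z d) e1 w).
suff: P _ _ g by move=> /(_ erefl erefl).
case: _ _ _ / fg => e1 e2.
by rewrite (Prop_irrelevance e1 erefl) (Prop_irrelevance e2 erefl).
Qed.

Lemma arr_eq_sym (C : category) (a b c d : C) (f : hom a b) (g : hom c d) :
  arr_eq f g -> arr_eq g f.
Proof. by case; constructor. Qed.

Lemma arr_eq_trans (C : category) (a b c d a' b' : C) (f : hom a b) (g : hom c d) (h : hom a' b') :
  arr_eq f g -> arr_eq g h -> arr_eq f h.
Proof. by case. Qed.

Lemma arr_eq_fhom (C D : category) (F : functor C D) (a b c d : C) (f : hom a b) (g : hom c d) :
  arr_eq f g -> arr_eq (fhom F f) (fhom F g).
Proof. by case; constructor. Qed.

Lemma arr_eq_functor (C D : category) (F G : functor C D) (a b : C) (f : hom a b) :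
  F = G -> arr_eq (fhom F f) (fhom G f).
Proof. by move=> <-; constructor. Qed.

Lemma arr_eq_cast (C : category) (a b a' b' : C) (h : hom a b) : a = a' -> b = b' ->
  exists h' : hom a' b', arr_eq h h'.
Proof. by move=> ea eb; case: _ / ea; case: _ / eb; exists h; constructor. Qed.

(** Isomorphisms are identities; then equivalences are isomorphisms of categories. *)
Definition gaunt (C : category) :=
  forall (a b : C) (f : hom a b), is_iso f -> arr_eq f (idm a).

Lemma gaunt_eq (C : category) (a b : C) (f : hom a b) : gaunt C -> is_iso f -> a = b.
Proof. by move=> gC /gC /arr_eq_ends[_ ->]. Qed.

Lemma nat_iso_eq (C D : category) (F G : functor C D) : gaunt D -> nat_iso F G -> F = G.
Proof.
move=> gD [s sI]; have e : fob F = fob G by apply: funext => x; exact: gaunt_eq gD (sI x).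
case: F G e s sI => [F0 F1 p q] [G0 G1 p' q'] /= e.
case: _ / e G1 p' q' => G1 p' q' s sI.
unshelve (eapply functor_eq); first by [].
move=> a b f /=; have sid x : nt s x = idm (F0 x) by apply: arr_eq_eq; exact: gD.
by have := ntP s f; rewrite !sid /= cmp1m cmpm1.
Qed.

Definition invertible (C : category) (F : functor C C) :=
  exists G, fcomp G F = fid C /\ fcomp F G = fid C.

Lemma equivalence_invertible (C : category) (F : functor C C) :
  gaunt C -> is_equivalence F -> invertible F.
Proof. by move=> gC [G [p q]]; exists G; split; exact: nat_iso_eq. Qed.

Lemma nat_iso_refl (C D : category) (F G : functor C D) : F = G -> nat_iso F G.
Proof. by case: _ /; exists (ntid F) => x; exact: is_iso_id. Qed.

Lemma invertible_equivalence (C : category) (F : functor C C) : invertible F -> is_equivalence F.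
Proof. by move=> [G [p q]]; exists G; split; exact: nat_iso_refl. Qed.

Section Invertible.
Variables (C : category) (F G : functor C C).
Hypotheses (GF : fcomp G F = fid C) (FG : fcomp F G = fid C).

Lemma invertible_obK a : G (F a) = a.
Proof. exact: (congr1 (fun H : functor C C => H a) GF). Qed.

Lemma invertible_obK' a : F (G a) = a.
Proof. exact: (congr1 (fun H : functor C C => H a) FG). Qed.

Lemma invertible_homK a b (f : hom a b) : arr_eq (fhom G (fhom F f)) f.
Proof. exact: (arr_eq_functor f GF). Qed.

Lemma invertible_homK' a b (f : hom a b) : arr_eq (fhom F (fhom G f)) f.
Proof. exact: (arr_eq_functor f FG). Qed.

Lemma invertible_faithful a b (f g : hom a b) : fhom F f = fhom F g -> f = g.
Proof.
move=> e; apply: arr_eq_eq; apply: arr_eq_trans (arr_eq_sym (invertible_homK f)) _.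
by rewrite e; exact: invertible_homK.
Qed.

Lemma invertible_full a b (h : hom (F a) (F b)) : exists f : hom a b, fhom F f = h.
Proof.
have [f fh] := arr_eq_cast (fhom G h) (invertible_obK a) (invertible_obK b).
exists f; apply: arr_eq_eq; apply: arr_eq_trans (arr_eq_fhom F (arr_eq_sym fh)) _.
exact: invertible_homK'.
Qed.

End Invertible.

Definition castm (C : category) (a b : C) (e : a = b) : hom a b := ecast z (hom a z) e (idm a).

Lemma castmK (C : category) (a b : C) (e : a = b) (e' : b = a) :
  cmp (castm e') (castm e) = idm a.
Proof. by case: _ / e e' => e'; rewrite (Prop_irrelevance e' erefl) /= cmp1m. Qed.

Lemma castm_comp (C : category) (a b c : C) (e : a = b) (e' : b = c) (e'' : a = c) :
  cmp (castm e') (castm e) = castm e''.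
Proof. by case: _ / e' e'' => e''; rewrite (Prop_irrelevance e'' e) /= cmp1m. Qed.

Lemma castm_fhom (C D : category) (F : functor C D) (a b : C) (e : a = b) (e' : F a = F b) :
  fhom F (castm e) = castm e'.
Proof. by case: _ / e e' => e'; rewrite (Prop_irrelevance e' erefl) /= fhom1. Qed.

Definition retract (C : category) (a b : C) :=
  exists (s : hom a b) (r : hom b a), cmp r s = idm a.

Lemma retract_invertible (C : category) (F G : functor C C) (a b : C) :
  fcomp G F = fid C -> fcomp F G = fid C -> retract a (F b) -> retract (G a) b.
Proof.
move=> GF FG [s [r rs]]; rewrite -(invertible_obK GF b).
by exists (fhom G s), (fhom G r); rewrite -fhomM rs fhom1.
Qed.

(** * Maps between disks *)

Transparent gen.
Lemma gen_resize T K i : height T <= K -> gen T K i = resize false K (gen T (height T) i).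
Proof. by move=> TK; rewrite /gen resize_resize //; exact: tk_height. Qed.
Opaque gen.

Lemma disk_map_exists b i l : exists F : ofunctor (Theta_of (single i)) (Theta_of (single l)),
  F (maxn i l) (gen (single i) (maxn i l) 0) = bd b i (gen (single l) (maxn i l) 0).
Proof. by apply: disk_functor; [exact: leq_maxl | exact: dimle_bd]. Qed.

(** For i < l, the inclusion of the source (or target) of dimension i of the disk
    D_l; for i >= l, the collapse of D_i onto D_l. *)
Definition disk_arrow b i l := projT1 (cid (disk_map_exists b i l)).

Transparent bd.
Lemma disk_arrowE b i l K : i <= K -> l <= K ->
  disk_arrow b i l K (gen (single i) K 0) = bd b i (gen (single l) K 0).
Proof.
move=> iK lK; set M := maxn i l; have MK : M <= K by rewrite geq_max iK.
have up k : k <= M -> gen (single k) K 0 = resize false K (gen (single k) M 0).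
  move=> kM; have hk := height_single k.
  rewrite gen_resize ?hk ?(leq_trans kM) // [in RHS]gen_resize ?hk //.
  by rewrite resize_resize.
rewrite !up ?leq_maxl ?leq_maxr // fmap_resize.
have -> : disk_arrow b i l M (gen (single i) M 0) = bd b i (gen (single l) M 0).
  by rewrite /disk_arrow; case: cid.
rewrite bd_resize // /bd resize_resize ?leq_maxl //; apply: resize_up; exact: iK.
Qed.
Opaque bd.

Lemma disk_arrowP k l K (F : ofunctor (Theta_of (single k)) (Theta_of (single l))) :
  k <= K -> l <= K -> exists b i,
  [/\ i <= k, i <= l & F K (gen (single k) K 0) = bd b i (gen (single l) K 0)].
Proof.
move=> kK lK; have [b [i [il e]]] := disk_cells (F K (gen (single k) K 0)) lK.
have [ik|ki] := leqP i k; first by exists b, i.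
exists b, k; split=> //; first by rewrite ltnW // (leq_trans ki).
have <- := dimleP b (fmap_dimle F (gen_disk_dimle kK)) (leqnn k).
by rewrite e bd_bd ki.
Qed.

Lemma disk_not_dimle k K i : k <= K -> dimle i (gen (single k) K 0) -> k <= i.
Proof.
move=> kK; have [//|ik e] := leqP k i.
have e' : bd false i (gen (single k) K 0) = bd false k (gen (single k) K 0).
  by rewrite e (dimleP false (gen_disk_dimle kK) (leqnn k)).
by have [] := disk_bd_inj (ltnW ik) (leqnn k) kK e'; lia.
Qed.

Lemma bd_gen_disk b k K i : k <= K -> k <= i ->
  bd b i (gen (single k) K 0) = gen (single k) K 0.
Proof. by move=> kK ki; exact: dimleP (gen_disk_dimle kK) ki. Qed.

Lemma disk_cell_dimle k K (c : ar (Theta_of (single k)) K) : k <= K -> dimle k c.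
Proof.
move=> kK; have [b [i [ik ->]]] := disk_cells c kK; exact: dimle_bd.
Qed.

(** Repeating sources of the last cell completes a partial diagram. *)
Lemma diag_extend (C : omegacat) K T m (y : nat -> ar C K) :
  (forall i, i <= m -> dimle (tk T i) (y i)) ->
  (forall i, i < m -> bd false (tk' T i) (y i) = bd true (tk' T i) (y i.+1)) ->
  exists2 y', diag T y' & forall i, i <= m -> y' i = y i.
Proof.
move=> yd ym.
pose y' := nat_rect (fun=> ar C K) (y 0) (fun i z => if i < m then y i.+1 else bd false (tk' T i) z).
have y'E i : i <= m -> y' i = y i by case: i => //= i ->.
exists y' => //; split=> i iT.
  have [im|mi] := leqP i m; first by rewrite y'E //; exact: yd.
  case: i iT mi => // i iT mi; rewrite /= ltnNge -ltnS mi /=; apply: dimle_bd.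
  by have /andP[_ /ltnW] := tk'_lt iT.
have [im|mi] := ltnP i m; first by rewrite !y'E ?ym // ltnW.
by rewrite /= [i < m]ltnNge mi bd_bd ltnn.
Qed.

Lemma first_disk_retract T : exists (s : ofunctor (Theta_of (single (tk T 0))) (Theta_of T))
    (r : ofunctor (Theta_of T) (Theta_of (single (tk T 0)))), ocomp r s = oid _.
Proof.
set K := height T; have kK : tk T 0 <= K := tk_height T 0.
have [gd _] := gen_diag (leqnn K).
have [s sE] := disk_functor kK (gd 0 isT).
have [|//|y yD yE] := @diag_extend (Theta_of (single (tk T 0))) K T 0 (fun=> gen (single (tk T 0)) K 0).
  by case=> // _; exact: gen_disk_dimle.
have [r rE] := diag_functor (leqnn K) yD; exists s, r.
by apply: (disk_functor_eq kK); rewrite ocompE sE rE // yE.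
Qed.

(** The table of two (b+1)-disks glued along a b-disk: the shape of a single
    composition. *)
Definition pair_table b : table := exist _ (b.+1, [:: (b, b.+1)])
  (introT andP (conj (introT andP (conj (ltnSn b) (ltnSn b))) isT)).

Lemma height_pair b : height (pair_table b) = b.+1.
Proof.
apply/eqP; rewrite eqn_leq (tk_height (pair_table b) 0 : b.+1 <= _) andbT.
by apply/heightP => -[|[|]].
Qed.

(** The first two cells of the diagram, cut down to dimension b+1, make up the
    section; the retraction collapses the rest of the diagram. *)
Lemma pair_retract T : 0 < tsize T -> let b := tk' T 0 in
  exists (s : ofunctor (Theta_of (pair_table b)) (Theta_of T))
    (r : ofunctor (Theta_of T) (Theta_of (pair_table b))), ocomp r s = oid _.
Proof.
move=> T0 b; set P := pair_table b; set K := height T.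
have /andP[b0 b1] := tk'_lt T0.
have PK : height P <= K by rewrite height_pair; exact: leq_trans b0 (tk_height T 0).
have [gd gm] := gen_diag (leqnn K); have [pd pm] := gen_diag PK.
have [s sE] : exists F : ofunctor (Theta_of P) (Theta_of T), forall i, i <= 1 ->
    F K (gen P K i) = bd false b.+1 (gen T K i).
  apply: (diag_functor PK); split=> [[|[|//]] _|[|//] _]; try exact: dimle_bd.
  by rewrite !bd_bd ltnSn; exact: gm.
have [||y yD yE] := @diag_extend (Theta_of P) K T 1 (gen P K).
- by case=> [|[|//]] _; apply: dimle_leq (pd _ _) => //.
- by case=> // _; exact: (pm 0).
have [r rE] := diag_functor (leqnn K) yD; exists s, r.
apply: (functor_eqK PK) => i iP; rewrite ocompE sE // fmap_bd rE; last first.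
  by apply: leq_trans iP T0.
rewrite yE //; apply: (dimleP false (pd i iP)).
by case: i iP => [|[|]].
Qed.

Opaque disk_arrow.

(** * Disks in Theta_n *)

Section Disks.
Variable n : option nat.

Definition bounded_by k : Prop := if n is Some m then k <= m else true.

Lemma bounded_by_leq i k : i <= k -> bounded_by k -> bounded_by i.
Proof. by rewrite /bounded_by; case: n => // m; exact: leq_trans. Qed.

Lemma bounded_by_height (T : Theta_table n) : bounded_by (height (sval T)).
Proof. by case: T => T h; exact: h. Qed.

Definition diskdim := {k : nat | bounded_by k}.

Lemma sig_eq A (P : A -> Prop) (x y : {a | P a}) : sval x = sval y -> x = y.
Proof.
case: x y => [x p] [y q] /= e; case: _ / e q => q.
by congr exist; exact: Prop_irrelevance.
Qed.

Lemma diskdim_eq (x y : diskdim) : sval x = sval y -> x = y.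
Proof. exact: sig_eq. Qed.

Lemma disk_bounded (x : diskdim) : bounded_by (height (single (sval x))).
Proof. by rewrite height_single; case: x => x h; exact: h. Qed.

Definition D (x : diskdim) : Theta n := exist _ (single (sval x)) (disk_bounded x).

Definition fun_of (S T : Theta n) (f : hom S T) : ofunctor (Theta_of (sval S)) (Theta_of (sval T)) := f.

Lemma table_ob_eq (S T : Theta n) : sval S = sval T -> S = T.
Proof. exact: sig_eq. Qed.

Lemma Theta_gaunt : gaunt (Theta n).
Proof.
move=> S T f [g [gf fg]].
have e : S = T.
  apply: table_ob_eq.
  exact: (table_rigid (leq_maxl (height (sval S)) (height (sval T))) (leq_maxr _ _) fg gf).
case: _ / e f g gf fg => f g gf fg.
have -> : f = idm S by exact: (auto_id fg gf).
by constructor.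
Qed.

Lemma D_inj x y : D x = D y -> x = y.
Proof. by move=> /(congr1 sval) /(congr1 (fun T => tk T 0)); exact: diskdim_eq. Qed.

Definition arrow b (x y : diskdim) : hom (D x) (D y) := disk_arrow b (sval x) (sval y).

Lemma hom_disk_eq (x : diskdim) (T : Theta n) (f g : hom (D x) T) K : sval x <= K ->
  fun_of f K (gen (single (sval x)) K 0) = fun_of g K (gen (single (sval x)) K 0) -> f = g.
Proof. by move=> xK e; exact: (disk_functor_eq xK e). Qed.

Lemma fun_of_cmp (R S T : Theta n) (f : hom S T) (g : hom R S) K c :
  fun_of (cmp f g) K c = fun_of f K (fun_of g K c).
Proof. by []. Qed.

Lemma fun_of_id (T : Theta n) K c : fun_of (idm T) K c = c.
Proof. by []. Qed.

Lemma arrowE b x y K : sval x <= K -> sval y <= K ->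
  fun_of (arrow b x y) K (gen (single (sval x)) K 0) = bd b (sval x) (gen (single (sval y)) K 0).
Proof. exact: disk_arrowE. Qed.

Lemma arrow_up b c x y : sval y <= sval x -> arrow b x y = arrow c x y.
Proof.
move=> yx; apply: (hom_disk_eq (leqnn _)); rewrite !arrowE //.
by rewrite !bd_gen_disk.
Qed.

Lemma arrow_id b x : arrow b x x = idm (D x).
Proof.
by apply: (hom_disk_eq (leqnn _)); rewrite arrowE // fun_of_id bd_gen_disk.
Qed.

Lemma arrow_comp b c x y z : sval x < sval y \/ sval z <= sval y ->
  cmp (arrow c y z) (arrow b x y) = arrow (if sval x < sval y then b else c) x z.
Proof.
move=> h; pose K := maxn (sval x) (maxn (sval y) (sval z)).
have [xK yK zK] : [/\ sval x <= K, sval y <= K & sval z <= K] by rewrite /K; split; lia.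
apply: (hom_disk_eq xK); rewrite fun_of_cmp !arrowE // fmap_bd arrowE // bd_bd.
case: ltnP h => // yx [//|zy]; rewrite !bd_gen_disk //; exact: leq_trans zy yx.
Qed.

Lemma arrow_neq x y : sval x < sval y -> arrow false x y <> arrow true x y.
Proof.
move=> xy e; have := congr1 (fun f : hom (D x) (D y) => fun_of f (sval y) (gen (single (sval x)) (sval y) 0)) e.
rewrite !arrowE ?(ltnW xy) //.
by move=> /(disk_bd_inj (ltnW xy) (ltnW xy) (leqnn _))[_ []]; lia.
Qed.

Lemma arrow_inj b c x y : sval x < sval y -> arrow b x y = arrow c x y -> b = c.
Proof. by move=> /arrow_neq ne; case: b; case: c => // e; case: ne; rewrite e. Qed.

Lemma arrowP x y (f : hom (D x) (D y)) : exists b z,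
  [/\ sval z <= sval x, sval z <= sval y & f = cmp (arrow b z y) (arrow b x z)].
Proof.
pose K := maxn (sval x) (sval y).
have [b [i [ix iy e]]] := disk_arrowP (fun_of f) (leq_maxl _ _ : _ <= K) (leq_maxr _ _ : _ <= K).
have [xK yK] : sval x <= K /\ sval y <= K by rewrite /K; split; lia.
exists b, (exist _ i (bounded_by_leq ix (svalP x))); split=> //.
apply: (hom_disk_eq xK); rewrite [LHS]e fun_of_cmp !arrowE //=; last exact: leq_trans ix xK.
rewrite fmap_bd arrowE //=; last exact: leq_trans ix xK.
by rewrite bd_bd ltnNge ix.
Qed.

(** Functors do not raise dimensions, so the top cell of D x cannot be the image of
    a cell of D z. *)
Lemma no_factor x z (f : hom (D z) (D x)) (g : hom (D x) (D z)) :
  sval z < sval x -> cmp f g <> idm (D x).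
Proof.
move=> zx e; have := congr1 (fun f : hom (D x) (D x) => fun_of f (sval x) (gen (single (sval x)) (sval x) 0)) e.
rewrite fun_of_cmp fun_of_id => e'.
have := disk_cell_dimle (fun_of g (sval x) (gen (single (sval x)) (sval x) 0)) (ltnW zx).
move=> /(fmap_dimle (fun_of f)); rewrite e' => /(disk_not_dimle (leqnn _)).
by rewrite leqNgt zx.
Qed.

Lemma split_mono_arrow x y (f : hom (D x) (D y)) r : sval x < sval y -> cmp r f = idm (D x) ->
  exists b, f = arrow b x y.
Proof.
move=> xy rf; have [b [z [zx zy e]]] := arrowP f; exists b.
have [zx'|xz] := ltnP (sval z) (sval x).
  by case: (no_factor (f := cmp r (arrow b z y)) (g := arrow b x z) zx'); rewrite -cmpA -e.
have e' : x = z by apply: diskdim_eq; lia.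
by case: _ / e' e {zx zy xz} => ->; rewrite arrow_id cmpm1.
Qed.

Lemma split_epi_arrow x y (f : hom (D x) (D y)) s b : sval y <= sval x -> cmp f s = idm (D y) ->
  f = arrow b x y.
Proof.
move=> yx fs; have [c [z [zx zy e]]] := arrowP f.
have [zy'|yz] := ltnP (sval z) (sval y).
  by case: (no_factor (f := arrow c z y) (g := cmp (arrow c x z) s) zy'); rewrite cmpA -e.
have e' : y = z by apply: diskdim_eq; lia.
by case: _ / e' e {zx zy yz} => ->; rewrite arrow_id cmp1m; exact: arrow_up.
Qed.

(** The idempotent of D x defining Y factors through some D z as a collapse followed by
    an inclusion, so that Y and D z split the same idempotent. *)
Lemma retract_disk x (Y : Theta n) : retract Y (D x) -> exists2 z, Y = D z & sval z <= sval x.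
Proof.
move=> [s [r rs]]; have [b [z [zx _ e]]] := arrowP (cmp s r); exists z => //.
have pq : cmp (arrow b x z) (arrow b z x) = idm (D z).
  have [zx'|xz] := ltnP (sval z) (sval x); first by rewrite arrow_comp ?zx' ?arrow_id; auto.
  have e' : x = z by apply: diskdim_eq; lia.
  by case: _ / e'; rewrite arrow_id cmp1m.
apply: (@gaunt_eq _ _ _ (cmp (arrow b x z) s) Theta_gaunt); exists (cmp r (arrow b z x)); split.
  by rewrite -cmpA (cmpA _ _ s) -e -(cmpA s r s) rs cmpm1.
by rewrite -cmpA (cmpA s) e -cmpA pq cmpm1.
Qed.

Lemma disk_retract x y : sval x <= sval y -> retract (D x) (D y).
Proof.
move=> xy; exists (arrow false x y), (arrow false y x).
have [xy'|yx] := ltnP (sval x) (sval y); first by rewrite arrow_comp ?xy' ?arrow_id; auto.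
have e' : x = y by apply: diskdim_eq; lia.
by case: _ / e'; rewrite arrow_id cmp1m.
Qed.

(** * Maps out of Theta(T) and its maximal disks *)

(** The arrows corresponding to the generators of Theta(T). *)
Definition is_leg (T : Theta n) x (f : hom (D x) T) := exists i,
  [/\ i <= tsize (sval T), sval x = tk (sval T) i &
      fun_of f (height (sval T)) (gen (single (sval x)) _ 0) = gen (sval T) _ i].

Lemma leg_exists (T : Theta n) i : i <= tsize (sval T) ->
  exists x (f : hom (D x) T), sval x = tk (sval T) i /\
    fun_of f (height (sval T)) (gen (single (sval x)) _ 0) = gen (sval T) _ i.
Proof.
move=> iT; have kT := tk_height (sval T) i.
pose x : diskdim := exist _ _ (bounded_by_leq kT (bounded_by_height T)).
have [gd _] := gen_diag (leqnn (height (sval T))).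
have [f fE] := disk_functor kT (gd i iT).
by exists x, f.
Qed.

Lemma legs_epi (T Y : Theta n) (h h' : hom T Y) :
  (forall x (f : hom (D x) T), is_leg f -> cmp h f = cmp h' f) -> h = h'.
Proof.
move=> e; apply: (functor_eqK (leqnn (height (sval T)))) => i iT.
have [x [f [xi fE]]] := leg_exists iT.
have := e x f; have l : is_leg f by exists i.
move=> /(_ l) /(congr1 (fun f : hom (D x) Y => fun_of f (height (sval T)) (gen (single (sval x)) _ 0))).
by rewrite !fun_of_cmp fE.
Qed.

Lemma disks_mono x (T : Theta n) (h h' : hom (D x) T) :
  (forall y (p : hom T (D y)), cmp p h = cmp p h') -> h = h'.
Proof.
move=> e; pose K := maxn (sval x) (height (sval T)).
apply: (hom_disk_eq (leq_maxl _ _ : _ <= K)); apply: disks_separateP; first exact: leq_maxr.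
move=> k F kT; pose y : diskdim := exist _ k (bounded_by_leq kT (bounded_by_height T)).
exact: (congr1 (fun f : hom (D x) (D y) => fun_of f K (gen (single (sval x)) K 0)) (e y F)).
Qed.

(** The universal property of Theta(T) inside Theta_n, for families given
    on all arrows from disks and not only on the legs. *)
Lemma legs_glue (T Y : Theta n) (c : forall x, hom (D x) T -> hom (D x) Y) :
  (forall b x y (f : hom (D y) T), c x (cmp f (arrow b x y)) = cmp (c y f) (arrow b x y)) ->
  exists h : hom T Y, forall x (f : hom (D x) T), is_leg f -> cmp h f = c x f.
Proof.
move=> cN; set K := height (sval T).
have [gd gm] := gen_diag (leqnn K).
have /choice[y yE] : forall i, exists z : ar (Theta_of (sval Y)) K,
    forall x (f : hom (D x) T), i <= tsize (sval T) -> sval x = tk (sval T) i ->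
    fun_of f K (gen (single (sval x)) K 0) = gen (sval T) K i ->
    fun_of (c x f) K (gen (single (sval x)) K 0) = z.
  move=> i; have [iT|Ti] := leqP i (tsize (sval T)); last first.
    have [x [f _]] := leg_exists (leqnn (tsize (sval T))).
    by exists (fun_of (c x f) K (gen (single (sval x)) K 0)).
  have [x [f [xi fE]]] := leg_exists iT; exists (fun_of (c x f) K (gen (single (sval x)) K 0)).
  move=> x' f' _ xi' fE'; have e : x = x' by apply: diskdim_eq; rewrite xi.
  case: _ / e f' xi' fE' => f' xi' fE'; suff -> : f' = f by [].
  by apply: (@hom_disk_eq _ _ _ _ K); [rewrite xi; exact: tk_height | rewrite fE' -fE].
have D : diag (sval T) y.
  split=> i iT.
    have [x [f [xi fE]]] := leg_exists iT; rewrite -(yE i x f) // -xi.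
    by apply: fmap_dimle; apply: gen_disk_dimle; rewrite xi; exact: tk_height.
  have [x [f [xi fE]]] := leg_exists (ltnW iT); have [x' [f' [xi' fE']]] := leg_exists iT.
  have /andP[zx zx'] := tk'_lt iT; have xK := tk_height (sval T) i.
  have xK' : sval x <= K by rewrite xi.
  have x'K : sval x' <= K by rewrite xi'; exact: tk_height.
  have zK := leq_trans (ltnW zx) xK.
  pose z : diskdim := exist _ _ (bounded_by_leq zK (bounded_by_height T)).
  have E : cmp f (arrow false z x) = cmp f' (arrow true z x').
    apply: (@hom_disk_eq z _ _ _ K zK); rewrite !fun_of_cmp !arrowE //.
    by rewrite !fmap_bd fE fE'; exact: gm.
  have := congr1 (fun g : hom (D z) T => fun_of (c z g) K (gen (single (sval z)) K 0)) E.
  rewrite /= !cN !fun_of_cmp !arrowE // !fmap_bd.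
  by rewrite (yE i x f (ltnW iT) xi fE) (yE i.+1 x' f' iT xi' fE').
have [h hE] := diag_functor (leqnn K) D; exists h => x f [i [iT xi fE]].
apply: (@hom_disk_eq _ _ _ _ K); first by rewrite xi tk_height.
by rewrite fun_of_cmp fE [LHS]hE // (yE i x f).
Qed.

End Disks.

(** * Automorphisms of Theta_n fix the disks *)

(** A property invariant under automorphisms of C, saying that a has three arrows to
    b that do not factor through c. *)
Definition three_arrows (C : category) (a b c : C) := exists f1 f2 f3 : hom a b,
  [/\ f1 <> f2, f1 <> f3, f2 <> f3 &
      forall (g : hom c b) (h : hom a c), [/\ f1 <> cmp g h, f2 <> cmp g h & f3 <> cmp g h]].

Lemma three_arrows_reflect (C : category) (F G : functor C C) (a b c : C) :
  fcomp G F = fid C -> fcomp F G = fid C ->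
  three_arrows (F a) (F b) (F c) -> three_arrows a b c.
Proof.
move=> GF FG [f1 [f2 [f3 [n12 n13 n23 nf]]]].
have [g1 e1] := invertible_full GF FG f1; have [g2 e2] := invertible_full GF FG f2.
have [g3 e3] := invertible_full GF FG f3; exists g1, g2, g3; split.
- by move=> e; apply: n12; rewrite -e1 -e2 e.
- by move=> e; apply: n13; rewrite -e1 -e3 e.
- by move=> e; apply: n23; rewrite -e2 -e3 e.
- move=> g h; have [m1 m2 m3] := nf (fhom F g) (fhom F h).
  by split=> e; [apply: m1 | apply: m2 | apply: m3]; rewrite -fhomM -e.
Qed.

Section Automorphisms.
Variable n : option nat.

(** The shape of a composition has three non-degenerate cells of top dimension: the two
    factors and their composite. A disk has two in each dimension below its own. *)
Lemma three_arrows_pair (x y : diskdim n) (P : Theta n) :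
  sval x = (sval y).+1 -> sval P = pair_table (sval y) -> three_arrows (D x) P (D y).
Proof.
case: P => T hT xy /= eT; subst T; set P := exist _ _ hT : Theta n; set b := sval y.
set K := b.+1; have xK : sval x <= K by rewrite xy.
have PK : height (pair_table b) <= K by rewrite height_pair.
set u := gen (single (sval x)) K 0; set g := gen (pair_table b) K.
have ux i : dimle i u -> b.+1 <= i by move=> /(disk_not_dimle xK); rewrite xy.
have ux' i : sval x <= i -> dimle i u by move=> xi; exact: dimle_leq xi (gen_disk_dimle xK).
have cell c : exists f : hom (D x) P, fun_of f K u = c.
  apply: (disk_functor xK); rewrite xy; exact: dimleK.
have gm : bd false b (g 0) = bd true b (g 1) by have [_ /(_ 0 isT)] := gen_diag PK.
have g01 : composable b (g 0) (g 1) by [].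
have [f1 e1] := cell (g 0); have [f2 e2] := cell (g 1); have [f3 e3] := cell (cp b (g 0) (g 1)).
have ub c : bd c b u <> u.
  move=> e; have : dimle b u by rewrite -e; exact: dimle_bd.
  by move=> /ux; rewrite ltnn.
have bu c c' : bd c b (bd c' b u) = bd c' b u by rewrite bd_bd ltnn.
have [p1 p10 p11] : exists2 p : hom P (D x), fun_of p K (g 0) = u & fun_of p K (g 1) = bd false b u.
  have [|F FE] := @diag_functor (pair_table b) K PK (Theta_of (single (sval x)))
    (fun i => if i == 0 then u else bd false b u).
    split=> [[|[|//]] _|[|//] _] /=; [by apply: ux'; rewrite xy| |by rewrite bu].
    by apply: dimle_bd; exact: leqnSn.
  by exists F; exact: FE.
have [p2 p20 p21] : exists2 p : hom P (D x), fun_of p K (g 0) = bd true b u & fun_of p K (g 1) = u.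
  have [|F FE] := @diag_functor (pair_table b) K PK (Theta_of (single (sval x)))
    (fun i => if i == 0 then bd true b u else u).
    split=> [[|[|//]] _|[|//] _] /=; [| by apply: ux'; rewrite xy|by rewrite bu].
    by apply: dimle_bd; exact: leqnSn.
  by exists F; exact: FE.
have p1c : fun_of p1 K (cp b (g 0) (g 1)) = u.
  have := fmap_composable (fun_of p1) g01; rewrite fmap_cp // [fmap _ _]p10 [fmap _ _]p11 => h.
  by rewrite cp_dimler //; exact: dimle_bd.
have p2c : fun_of p2 K (cp b (g 0) (g 1)) = u.
  have := fmap_composable (fun_of p2) g01; rewrite fmap_cp // [fmap _ _]p20 [fmap _ _]p21 => h.
  by rewrite cp_dimlel //; exact: dimle_bd.
pose ev (f : hom (D x) P) (p : hom P (D x)) := fun_of p K (fun_of f K u).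
have nf f p : ev f p = u -> forall (s : hom (D y) P) t, f <> cmp s t.
  move=> e s t ef; have yK : sval y <= K by rewrite /K /b.
  have := fmap_dimle (fun_of (cmp p s)) (disk_cell_dimle (fun_of t K u) yK).
  have -> : fun_of (cmp p s) K (fun_of t K u) = u.
    by transitivity (fun_of p K (fun_of f K u)); [rewrite ef | exact: e].
  by move=> /ux; rewrite ltnn.
exists f1, f2, f3; split.
- by move=> e; apply: (ub false); rewrite -p11 -e2 -e e1.
- by move=> e; apply: (ub true); rewrite -p20 -e1 e e3.
- by move=> e; apply: (ub false); rewrite -p11 -e2 e e3.
- move=> s t; split; [apply: (nf f1 p1)|apply: (nf f2 p2)|apply: (nf f3 p1)].
  + by rewrite /ev e1.
  + by rewrite /ev e2.
  + by rewrite /ev e3.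
Qed.

Lemma not_three_arrows_disk (x y z : diskdim n) :
  sval x = (sval y).+1 -> sval x < sval z -> ~ three_arrows (D x) (D z) (D y).
Proof.
move=> xy xz [f1 [f2 [f3 [n12 n13 n23 nf]]]].
have H f : (forall (g : hom (D y) (D z)) h, f <> cmp g h) -> exists b, f = arrow b x z.
  move=> nff; have [b [w [wx wz e]]] := arrowP f; exists b.
  have [wx'|xw] := ltnP (sval w) (sval x).
    case: (nff (cmp (arrow b w z) (arrow b y w)) (arrow b x y)).
    rewrite e -cmpA; congr cmp; rewrite arrow_comp; last by right; lia.
    by case: ifP.
  have e' : x = w by apply: diskdim_eq; lia.
  by case: _ / e' e {wx wz xw} => ->; rewrite arrow_id cmpm1.
have [b1 e1] : exists b, f1 = arrow b x z by apply: H => g h; case: (nf g h).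
have [b2 e2] : exists b, f2 = arrow b x z by apply: H => g h; case: (nf g h).
have [b3 e3] : exists b, f3 = arrow b x z by apply: H => g h; case: (nf g h).
by move: n12 n13 n23; rewrite e1 e2 e3; case: b1 {e1}; case: b2 {e2}; case: b3 {e3}.
Qed.

Section Fixed.
Variables F G : functor (Theta n) (Theta n).
Hypotheses (GF : fcomp G F = fid _) (FG : fcomp F G = fid _).

(** By induction on the dimension of x, put T := F (D x). The proper retracts of T
    are the smaller disks. The first disk of T is a retract of T, so unless
    T is a disk, which must be D x, it is smaller than D x. In the same way the
    pair table at the first gluing dimension b is a retract of T, hence is T. But
    T has as many (b+1)-cells as D x, by the induction hypothesis for the disks of
    dimensions b and b+1, and three_arrows_pair contradicts not_three_arrows_disk. *)
Lemma fixes_disks x : F (D x) = D x.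
Proof.
have [k] := ubnP (sval x); elim: k x => // k IH x; rewrite ltnS => xk.
pose T := F (D x).
have R Y : retract Y T -> (exists2 z, sval z < sval x & Y = D z) \/ Y = T.
  move=> /(retract_invertible GF FG)/retract_disk[z e zx].
  have {}e : Y = F (D z) by rewrite -e (invertible_obK' FG).
  have [zx'|xz] := ltnP (sval z) (sval x).
    by left; exists z => //; rewrite e IH //; exact: leq_trans zx' xk.
  by right; rewrite e /T; congr (F (D _)); apply: diskdim_eq; lia.
have Dinj z : D z = T -> sval z < sval x -> False.
  move=> e zx; have := IH z (leq_trans zx xk); rewrite e => /(congr1 G).
  rewrite -[in LHS]e !(invertible_obK GF) => /D_inj ezx.
  by move: zx; rewrite ezx ltnn.
have T0 := bounded_by_leq (tk_height (sval T) 0) (bounded_by_height T).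
pose z : diskdim n := exist _ _ T0.
have Rz : retract (D z) T by have [s [r e]] := first_disk_retract (sval T); exists s, r.
have [sT|T1] := posnP (tsize (sval T)).
  have eT : T = D z by apply: table_ob_eq; exact: single_tk.
  have [zx|xz|e] := ltngtP (sval z) (sval x).
  - by case: (Dinj z).
  - have Rx : retract (D x) T by rewrite eT; apply: disk_retract; exact: ltnW.
    by case: (R _ Rx) => [[w wx /D_inj e]|/esym//]; move: wx; rewrite e ltnn.
  - by rewrite -/T eT; congr D; exact: diskdim_eq.
have zx : sval z < sval x.
  have [[w wx /D_inj->//]|e] := R _ Rz.
  by move: T1; rewrite -e.
have [s [r sr]] := pair_retract T1; set b := tk' (sval T) 0 in s r sr.
have /andP[b0 _] := tk'_lt T1.
have hP : bounded_by n (height (pair_table b)).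
  by rewrite height_pair; exact: bounded_by_leq b0 T0.
pose P : Theta n := (exist _ (pair_table b) hP : Theta_table n).
have eP : P = T.
  have [[w wx e]|//] : (exists2 w, sval w < sval x & P = D w) \/ P = T by apply: R; exists s, r.
  by have := congr1 (fun T => tsize (sval T)) e.
pose y : diskdim n := exist _ b (bounded_by_leq (ltnW b0) T0).
pose y' : diskdim n := exist _ b.+1 (bounded_by_leq b0 T0).
have y'x : sval y' < sval x by exact: leq_ltn_trans b0 zx.
have := @three_arrows_pair y' y P erefl erefl; rewrite eP /T.
have yx : sval y < sval x by exact: ltn_trans b0 zx.
rewrite -{1}(IH y' (leq_trans y'x xk)) -(IH y (leq_trans yx xk)).
move=> /(three_arrows_reflect GF FG) h.
by case: (@not_three_arrows_disk y' y x erefl y'x h).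
Qed.

End Fixed.
End Automorphisms.

(** * The signature of an automorphism of Theta_n *)

Section Signature.
Variable n : option nat.
Implicit Types x y z : diskdim n.

Definition fixes (F : functor (Theta n) (Theta n)) := forall x, F (D x) = D x.

Section Conj.
Variables (F : functor (Theta n) (Theta n)) (FD : fixes F).

Definition to_disk x : hom (F (D x)) (D x) := castm (FD x).
Definition from_disk x : hom (D x) (F (D x)) := castm (esym (FD x)).

Lemma to_from x : cmp (to_disk x) (from_disk x) = idm _.
Proof. exact: castmK. Qed.

Lemma from_to x : cmp (from_disk x) (to_disk x) = idm _.
Proof. exact: castmK. Qed.

(** Automorphisms fix the disks, but only up to propositional equality; conjugating
    by the identities makes them act on the arrows between disks. *)
Definition disk_act x y (f : hom (D x) (D y)) : hom (D x) (D y) :=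
  cmp (to_disk y) (cmp (fhom F f) (from_disk x)).

Lemma disk_actE x y (f : hom (D x) (D y)) : cmp (fhom F f) (from_disk x) = cmp (from_disk y) (disk_act f).
Proof. by rewrite /disk_act cmpA from_to cmp1m. Qed.

Lemma disk_act_id x : disk_act (idm (D x)) = idm _.
Proof. by rewrite /disk_act fhom1 cmp1m to_from. Qed.

Lemma disk_act_comp x y z (f : hom (D y) (D z)) (g : hom (D x) (D y)) :
  disk_act (cmp f g) = cmp (disk_act f) (disk_act g).
Proof. by rewrite /disk_act fhomM -!cmpA -disk_actE. Qed.

Lemma disk_act_arrow_up b x y : sval y <= sval x -> disk_act (arrow b x y) = arrow b x y.
Proof.
move=> yx; apply: (@split_epi_arrow _ _ _ _ (disk_act (arrow b y x))) => //.
rewrite -disk_act_comp -[RHS]disk_act_id; congr disk_act.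
have [yx'|xy] := ltnP (sval y) (sval x); first by rewrite arrow_comp ?arrow_id; auto.
have e : x = y by apply: diskdim_eq; lia.
by case: _ / e; rewrite arrow_id cmp1m.
Qed.

Lemma disk_act_arrow_down b x y : sval x < sval y -> exists b', disk_act (arrow b x y) = arrow b' x y.
Proof.
move=> xy; apply: (@split_mono_arrow _ _ _ _ (disk_act (arrow b y x))) => //.
by rewrite -disk_act_comp arrow_comp ?xy ?arrow_id ?disk_act_id; auto.
Qed.

Hypothesis F_faithful : forall (a b : Theta n) (f g : hom a b), fhom F f = fhom F g -> f = g.

Lemma disk_act_inj x y (f g : hom (D x) (D y)) : disk_act f = disk_act g -> f = g.
Proof.
move=> e; apply: F_faithful.
have: cmp (fhom F f) (from_disk x) = cmp (fhom F g) (from_disk x) by rewrite !disk_actE e.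
by move=> /(congr1 (fun h => cmp h (to_disk x))); rewrite -!cmpA from_to !cmpm1.
Qed.

(** Whether F exchanges the source and target inclusions of D x into D y. The
    signature consists of these bits for consecutive dimensions. *)
Definition sgn x y : bool := `[< disk_act (arrow false x y) = arrow true x y >].

Lemma disk_act_sgn b x y : sval x < sval y -> disk_act (arrow b x y) = arrow (b (+) sgn x y) x y.
Proof.
move=> xy; have ne := arrow_neq xy.
have E : disk_act (arrow false x y) = arrow (sgn x y) x y.
  rewrite /sgn; case: asboolP => // h; have [[] e] := disk_act_arrow_down false xy; last exact: e.
  by case: h.
case: b => //; have [b e] := disk_act_arrow_down true xy; rewrite e.
congr (arrow _ x y); have nb : b <> sgn x y.
  by move=> eb; case: ne; apply: disk_act_inj; rewrite E e eb.
by move: nb; case: b {e}; case: (sgn x y).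
Qed.

Lemma disk_act_trivial : (forall x y, sval y = (sval x).+1 -> sgn x y = false) ->
  forall x y (f : hom (D x) (D y)), disk_act f = f.
Proof.
move=> triv x y f.
have A b x0 y0 : disk_act (arrow b x0 y0) = arrow b x0 y0.
  have [xy|yx] := ltnP (sval x0) (sval y0); last exact: disk_act_arrow_up.
  pose z : diskdim n := exist _ _ (bounded_by_leq xy (svalP y0)).
  have zE : sval z = (sval x0).+1 by [].
  have [b' e] := disk_act_arrow_down b xy; rewrite e.
  have c c0 : cmp (arrow b y0 z) (arrow c0 x0 y0) = arrow c0 x0 z.
    by rewrite arrow_comp ?xy //; left.
  have zy : sval z <= sval y0 by [].
  have := disk_act_comp (arrow b y0 z) (arrow b x0 y0).
  rewrite e !c (disk_act_arrow_up b zy) c disk_act_sgn ?zE // triv // addbF => h.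
  by rewrite (@arrow_inj _ b b' x0 z) ?zE.
by have [b [z [_ _ ->]]] := arrowP f; rewrite disk_act_comp !A.
Qed.

Hypothesis F_full : forall (a b : Theta n) (h : hom (F a) (F b)), exists f, fhom F f = h.

Lemma disk_cancel y (T : Theta n) (f g : hom T (D y)) :
  cmp (from_disk y) f = cmp (from_disk y) g -> f = g.
Proof. by move=> /(congr1 (fun h => cmp (to_disk y) h)); rewrite !cmpA to_from !cmp1m. Qed.

(** If F fixes the disks and their arrows, the universal property of Theta(T)
    yields a comparison from T to F T. Its effect on an
    arbitrary arrow from a disk, from which naturality follows, is checked after
    composing with arrows to disks, which are jointly monic. *)
Lemma comparison : (forall x y (f : hom (D x) (D y)), disk_act f = f) -> inhabited (nattrans (fid _) F).
Proof.
move=> triv.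
have alP (T : Theta n) : {h : hom T (F T) |
    forall x (f : hom (D x) T), cmp h f = cmp (fhom F f) (from_disk x)}.
  apply: cid; have [|h hE] := @legs_glue n T (F T) (fun x f => cmp (fhom F f) (from_disk x)).
    by move=> b x y f; rewrite fhomM -!cmpA disk_actE triv.
  exists h => x f; apply: disks_mono => y p.
  have [p' p'E] := F_full (cmp (from_disk y) p).
  have P x0 (f0 : hom (D x0) T) : cmp p (cmp (fhom F f0) (from_disk x0)) = cmp p' f0.
    by apply: disk_cancel; rewrite cmpA -p'E cmpA -fhomM disk_actE triv.
  have -> : cmp p (cmp h f) = cmp p' f.
    rewrite cmpA; congr cmp; apply: legs_epi => x0 f0 l; rewrite -cmpA hE //.
  by rewrite P.
constructor; apply: (@NatTrans _ _ (fid _) F (fun T => sval (alP T))) => S T g /=.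
have alE U := svalP (alP U); apply: legs_epi => x f _.
by rewrite -!cmpA !alE fhomM -cmpA.
Qed.

End Conj.

Section Transformation.
Variables F F' : functor (Theta n) (Theta n).
Variables (FD : fixes F) (FD' : fixes F').
Hypothesis F_faithful : forall (a b : Theta n) (f g : hom a b), fhom F f = fhom F g -> f = g.
Hypothesis F'_faithful : forall (a b : Theta n) (f g : hom a b), fhom F' f = fhom F' g -> f = g.

(** Endomorphisms of a disk are identities or factor through a smaller disk. The second
    case is excluded for the component at D x, by induction: such an endomorphism would
    not distinguish the two inclusions of the disk of dimension one less, while it
    intertwines the two actions on these inclusions. *)
Lemma nattrans_disk (s : nattrans F F') x :
  cmp (to_disk FD' x) (cmp (s (D x)) (from_disk FD x)) = idm _ /\
  forall y, sval x = (sval y).+1 -> sgn FD y x = sgn FD' y x.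
Proof.
pose t x := cmp (to_disk FD' x) (cmp (s (D x)) (from_disk FD x)).
have tN y z (f : hom (D y) (D z)) : cmp (t z) (disk_act FD f) = cmp (disk_act FD' f) (t y).
  apply: (@disk_cancel _ FD'); rewrite /t.
  rewrite cmpA (cmpA _ (to_disk FD' z)) from_to cmp1m -cmpA -disk_actE.
  by rewrite (cmpA (from_disk FD' z)) -disk_actE -!cmpA (cmpA (from_disk FD' y)) from_to cmp1m
    !cmpA (ntP s).
suff H k : forall x, sval x = k -> t x = idm _ /\
    forall y, sval x = (sval y).+1 -> sgn FD y x = sgn FD' y x by exact: (H (sval x)).
elim: k {x} => [|k IH] x xk.
  have [b [z [zx _ e]]] := arrowP (t x); split=> [|y]; last by rewrite xk.
  have e' : x = z by apply: diskdim_eq; lia.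
  by case: _ / e' e {zx} => ->; rewrite arrow_id cmp1m.
have key y : sval x = (sval y).+1 -> t x = idm _ /\ sgn FD y x = sgn FD' y x.
  move=> xy; have yx : sval y < sval x by rewrite xy.
  have ty : t y = idm _ by apply: (IH y _).1; move: xk; rewrite xy => -[].
  have N c : cmp (t x) (arrow (c (+) sgn FD y x) y x) = arrow (c (+) sgn FD' y x) y x.
    by rewrite -disk_act_sgn // tN ty cmpm1 disk_act_sgn.
  have [b [z [zx _ e]]] := arrowP (t x).
  have [zx'|xz] := ltnP (sval z) (sval x); last first.
    have e' : x = z by apply: diskdim_eq; lia.
    case: _ / e' e {zx xz} => e; have {}e : t x = idm _ by rewrite e arrow_id cmp1m.
    split=> //; have := N false; rewrite e cmp1m !addFb; exact: arrow_inj.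
  have I c : cmp (t x) (arrow c y x) = cmp (arrow b z x) (arrow false y z).
    rewrite e -cmpA arrow_comp ?yx; last by left.
    by rewrite (arrow_up c false) //; lia.
  have := N false; rewrite I -(I (true (+) sgn FD y x)) N => /(arrow_inj yx).
  by case: (sgn FD' y x).
have ky : bounded_by n k by apply: bounded_by_leq (svalP x); rewrite xk.
by split=> [|y /key[]//]; apply: (key (exist _ k ky) _).1.
Qed.

End Transformation.

Lemma disk_act_fcomp (F G : functor (Theta n) (Theta n)) (FD : fixes F) (GD : fixes G)
    (GFD : fixes (fcomp G F)) x y (f : hom (D x) (D y)) :
  disk_act GFD f = disk_act GD (disk_act FD f).
Proof.
have E w : G (F (D w)) = G (D w) by rewrite FD.
have E' w : G (D w) = G (F (D w)) by rewrite FD.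
rewrite /disk_act /to_disk /from_disk !fhomM (castm_fhom _ (E y)) (castm_fhom _ (E' x)) !cmpA.
rewrite (castm_comp _ _ (GFD y)) -!cmpA (castm_comp _ _ (esym (GFD x))) //.
Qed.

Lemma disk_act_fid (F : functor (Theta n) (Theta n)) (FD : fixes F) x y (f : hom (D x) (D y)) :
  F = fid _ -> disk_act FD f = f.
Proof.
move=> e; subst F; rewrite /disk_act /to_disk /from_disk.
rewrite (Prop_irrelevance (FD y) erefl) (Prop_irrelevance (FD x) erefl).
by transitivity (cmp (idm (D y)) (cmp f (idm (D x)))); [|rewrite cmpm1 cmp1m].
Qed.

Section Inverse.
Variables F G : functor (Theta n) (Theta n).
Hypotheses (GF : fcomp G F = fid _) (FG : fcomp F G = fid _).

Let FD : fixes F := fixes_disks GF FG.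
Let GD : fixes G := fixes_disks FG GF.
Let F_faithful := @invertible_faithful _ F G GF.
Let F_full := @invertible_full _ F G GF FG.
Let G_full := @invertible_full _ G F FG GF.

Lemma invertible_legs_epi (T Y : Theta n) (h h' : hom (F T) Y) :
  (forall x (f : hom (D x) T), cmp h (fhom F f) = cmp h' (fhom F f)) -> h = h'.
Proof.
have e : F (G Y) = Y := invertible_obK' FG Y.
case: _ / e h h' => h h' hh'; have [g gE] := F_full h; have [g' gE'] := F_full h'.
rewrite -gE -gE'; congr (fhom F _); apply: legs_epi => x f _.
by apply: F_faithful; rewrite !fhomM gE gE'; exact: hh'.
Qed.

(** Components at disks are determined, and the images under F of the legs of T
    are jointly epic. *)
Lemma nattrans_unique (F' G' : functor (Theta n) (Theta n)) (s s' : nattrans F F') :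
  fcomp G' F' = fid _ -> fcomp F' G' = fid _ -> s = s'.
Proof.
move=> GF' FG'; pose FD' : fixes F' := fixes_disks GF' FG'.
have F'_faithful := @invertible_faithful _ F' G' GF'.
have R x (u : hom (F (D x)) (F' (D x))) :
    u = cmp (from_disk FD' x) (cmp (cmp (to_disk FD' x) (cmp u (from_disk FD x))) (to_disk FD x)).
  by rewrite -!cmpA from_to cmpm1 cmpA from_to cmp1m.
have sD x : s (D x) = s' (D x).
  have [e _] := nattrans_disk FD FD' F_faithful F'_faithful s x.
  have [e' _] := nattrans_disk FD FD' F_faithful F'_faithful s' x.
  by rewrite [LHS]R [RHS]R e e'.
apply: nattrans_eq => T; apply: invertible_legs_epi => x f.
by rewrite !ntP sD.
Qed.

Lemma disk_act_inverse x y (f : hom (D x) (D y)) : disk_act GD (disk_act FD f) = f.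
Proof.
have E : fixes (fcomp G F) by rewrite GF.
by rewrite -(disk_act_fcomp FD GD E) (disk_act_fid E).
Qed.

Lemma trivial_comparison : (forall x y, sval y = (sval x).+1 -> sgn FD x y = false) ->
  inhabited (nattrans (fid _) F) /\ inhabited (nattrans (fid _) G).
Proof.
move=> triv; have cF := disk_act_trivial F_faithful triv.
split; first exact: comparison F_full cF.
apply: (comparison G_full) => x y f.
by rewrite -[in LHS](cF _ _ f) disk_act_inverse.
Qed.

End Inverse.

Lemma is_iso_two_of_six (C : category) (a b c d : C) (f : hom a b) (g : hom b c) (h : hom c d) :
  is_iso (cmp g f) -> is_iso (cmp h g) -> is_iso f.
Proof.
move=> [u [u1 u2]] [v [v1 v2]].
have gl : cmp (cmp v h) g = idm b by rewrite -cmpA.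
have gr : cmp g (cmp f u) = idm c by rewrite cmpA.
have e : cmp v h = cmp f u by rewrite -[LHS]cmpm1 -gr cmpA gl cmp1m.
exists (cmp u g); split; first by rewrite -cmpA.
by rewrite cmpA -e gl.
Qed.

(** The comparisons id => F and id => G compose to endomorphisms of id, which
    are identities; so they are invertible, and Theta_n is gaunt. *)
Lemma trivial_id (F G : functor (Theta n) (Theta n)) (GF : fcomp G F = fid _)
    (FG : fcomp F G = fid _) :
  (forall x y, sval y = (sval x).+1 -> sgn (fixes_disks GF FG) x y = false) -> F = fid _.
Proof.
move=> /trivial_comparison[[s] [s']].
have unit_iso (L : functor (Theta n) (Theta n)) (t : nattrans (fid _) L) T : L = fid _ -> is_iso (t T).
  move=> e; subst L; suff -> : t = ntid (fid _) by exact: is_iso_id.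
  by apply: (@nattrans_unique (fid _) (fid _) _ _ (fid _) (fid _)); exact: fcompF1.
have t1P a b (f : hom a b) : cmp (cmp (s' (F b)) (s b)) f = cmp (fhom (fcomp G F) f) (cmp (s' (F a)) (s a)).
  by rewrite -cmpA (ntP s) cmpA (ntP s') cmpA.
have t2P a b (f : hom a b) : cmp (cmp (s (G b)) (s' b)) f = cmp (fhom (fcomp F G) f) (cmp (s (G a)) (s' a)).
  by rewrite -cmpA (ntP s') cmpA (ntP s) cmpA.
apply/esym/(nat_iso_eq (@Theta_gaunt n)); exists s => T.
have i1 := unit_iso _ (@NatTrans _ _ (fid _) (fcomp G F) _ t1P) T GF.
have i2 := unit_iso _ (@NatTrans _ _ (fid _) (fcomp F G) _ t2P) (F T) FG.
exact: is_iso_two_of_six i1 i2.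
Qed.

(** Signatures add up under composition, so that of F' G is trivial. *)
Lemma same_sgn_eq (F G F' G' : functor (Theta n) (Theta n)) (GF : fcomp G F = fid _)
    (FG : fcomp F G = fid _) (GF' : fcomp G' F' = fid _) (FG' : fcomp F' G' = fid _) :
  (forall x y, sval y = (sval x).+1 ->
     sgn (fixes_disks GF FG) x y = sgn (fixes_disks GF' FG') x y) -> F = F'.
Proof.
move=> h; set FD := fixes_disks GF FG in h; set FD' := fixes_disks GF' FG' in h.
pose GD := fixes_disks FG GF.
have L1 : fcomp (fcomp F G') (fcomp F' G) = fid _.
  by rewrite fcompA -(fcompA F G' F') GF' fcompF1.
have L2 : fcomp (fcomp F' G) (fcomp F G') = fid _.
  by rewrite fcompA -(fcompA F' G F) GF fcompF1.
have e : fcomp F' G = fid _.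
  apply: (trivial_id (GF := L1) (FG := L2)) => x y xy.
  have lt : sval x < sval y by rewrite xy.
  have F_f := @invertible_faithful _ F G GF.
  have F'_f := @invertible_faithful _ F' G' GF'.
  have L_f := @invertible_faithful _ _ _ L1.
  have := disk_act_sgn (fixes_disks L1 L2) L_f false lt.
  rewrite (disk_act_fcomp GD FD').
  have -> : disk_act GD (arrow false x y) = arrow (sgn FD x y) x y.
    by rewrite -[RHS](disk_act_inverse GF FG) (disk_act_sgn FD F_f _ lt) addbb.
  by rewrite (disk_act_sgn FD' F'_f _ lt) h // addbb => /(arrow_inj lt)/esym.
by rewrite -(fcomp1F F) -e -fcompA GF fcompF1.
Qed.

End Signature.

(** * Natural isomorphisms *)

Lemma nat_iso_sym (C D : category) (F G : functor C D) : nat_iso F G -> nat_iso G F.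
Proof.
move=> [s sI]; pose t x := sval (cid (sI x)).
have [tl tr] : (forall x, cmp (t x) (s x) = idm _) /\ (forall x, cmp (s x) (t x) = idm _).
  by split=> x; rewrite /t; case: cid => ? [].
have tP a b (f : hom a b) : cmp (t b) (fhom G f) = cmp (fhom F f) (t a).
  by rewrite -[LHS]cmpm1 -(tr a) -!cmpA (cmpA (fhom G f)) -ntP -cmpA (cmpA (t b)) tl cmp1m.
exists (NatTrans tP) => x; exists (s x); split; [exact: tr | exact: tl].
Qed.

Lemma nat_iso_trans (C D : category) (F G H : functor C D) :
  nat_iso F G -> nat_iso G H -> nat_iso F H.
Proof.
by move=> [s sI] [t tI]; exists (ntcomp t s) => x; exact: is_iso_cmp (tI x) (sI x).
Qed.

Lemma nat_iso_whiskerl (C D E : category) (L : functor D E) (F G : functor C D) :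
  nat_iso F G -> nat_iso (fcomp L F) (fcomp L G).
Proof.
move=> [s sI]; have P a b (f : hom a b) :
    cmp (fhom L (s b)) (fhom (fcomp L F) f) = cmp (fhom (fcomp L G) f) (fhom L (s a)).
  by rewrite /= -!fhomM ntP.
exists (@NatTrans _ _ (fcomp L F) (fcomp L G) (fun x => fhom L (s x)) P) => x.
by apply: (@is_iso_fhom _ _ L); exact: sI.
Qed.

Lemma nat_iso_whiskerr (C D E : category) (L : functor C D) (F G : functor D E) :
  nat_iso F G -> nat_iso (fcomp F L) (fcomp G L).
Proof.
move=> [s sI]; have P a b (f : hom a b) :
    cmp (s (L b)) (fhom (fcomp F L) f) = cmp (fhom (fcomp G L) f) (s (L a)) by exact: (ntP s (fhom L f)).
by exists (@NatTrans _ _ (fcomp F L) (fcomp G L) (fun x => s (L x)) P) => x; exact: sI.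
Qed.

Lemma nat_iso_full_incl (B C : category) (X : Type) (f : X -> C) (F G : functor B (full f)) :
  nat_iso (fcomp (full_incl f) F) (fcomp (full_incl f) G) -> nat_iso F G.
Proof.
move=> [s sI]; exists (@NatTrans _ _ F G (fun x => s x) (fun a b h => ntP s h)) => x.
exact: sI.
Qed.

(** * The automorphisms op *)

Section Op.
Variable n : option nat.

Lemma reversedD (d d' : Z2n n) j :
  reversed (d + d')%R j = reversed d j (+) reversed d' j.
Proof.
rewrite /reversed; case: insub => // i.
have -> : (d + d')%R i = (d i + d' i)%R by [].
by case: (d i) => [[|[|//]] ?]; case: (d' i) => [[|[|//]] ?].
Qed.

Lemma reversed0 j : reversed (0%R : Z2n n) j = false.
Proof. by rewrite /reversed; case: insub. Qed.

Lemma opnD (d d' : Z2n n) : nat_iso (fcomp (opn d) (opn d')) (opn (d + d')%R).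
Proof.
pose t (A : nCat n) : hom (fcomp (opn d) (opn d') A) (opn (d + d')%R A) :=
  rev_add (reversedD d d') (sval A).
have tP (A B : nCat n) (f : hom A B) :
    cmp (t B) (fhom (fcomp (opn d) (opn d')) f) = cmp (fhom (opn (d + d')%R) f) (t A).
  exact: ofunctor_eq.
exists (NatTrans tP) => A; exists (rev_split (reversedD d d') (sval A)).
by split; exact: ofunctor_eq.
Qed.

Lemma opn0 : nat_iso (opn (0%R : Z2n n)) (fid _).
Proof.
pose t (A : nCat n) : hom (opn (0%R : Z2n n) A) (fid _ A) := rev_trivial reversed0 (sval A).
have tP (A B : nCat n) (f : hom A B) :
    cmp (t B) (fhom (opn (0%R : Z2n n)) f) = cmp (fhom (fid _) f) (t A).
  exact: ofunctor_eq.
exists (NatTrans tP) => A; exists (rev_trivial_inv reversed0 (sval A)).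
by split; exact: ofunctor_eq.
Qed.

Lemma induced_op_unique d (F F' : functor (Theta n) (Theta n)) :
  induced_op d F -> induced_op d F' -> F = F'.
Proof.
move=> i i'; apply: (nat_iso_eq (@Theta_gaunt n)).
exact: nat_iso_full_incl (nat_iso_trans i (nat_iso_sym i')).
Qed.

Lemma induced_opD d d' (F F' : functor (Theta n) (Theta n)) :
  induced_op d F -> induced_op d' F' -> induced_op (d + d')%R (fcomp F F').
Proof.
move=> i i'; rewrite /induced_op fcompA.
apply: nat_iso_trans (nat_iso_whiskerr F' i) _.
rewrite -fcompA; apply: nat_iso_trans (nat_iso_whiskerl (opn d) i') _.
by rewrite fcompA; apply: nat_iso_whiskerr; exact: opnD.
Qed.

Lemma induced_op0 : induced_op (0%R : Z2n n) (fid (Theta n)).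
Proof.
rewrite /induced_op fcompF1 -[X in nat_iso X]fcomp1F.
by apply: nat_iso_whiskerr; apply: nat_iso_sym; exact: opn0.
Qed.

(** Transport of the reversal along the isomorphisms between reversed
    objects of Theta_n and objects of Theta_n. *)
Lemma induced_op_exists d : exists F : functor (Theta n) (Theta n), induced_op d F.
Proof.
have ch (T : Theta n) : {U : Theta n & {FG : ofunctor (Theta_of (sval U)) (rev_ocat (reversed d) (Theta_of (sval T))) *
    ofunctor (rev_ocat (reversed d) (Theta_of (sval T))) (Theta_of (sval U)) |
    ocomp FG.2 FG.1 = oid _ /\ ocomp FG.1 FG.2 = oid _}}.
  have [T' h] := cid (rev_Theta (reversed d) (sval T)).
  have [F {}h] := cid h; have [G [hT e1 e2]] := cid h.
  have bT' : bounded_by n (height T') by exact: bounded_by_leq hT (bounded_by_height T).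
  by exists (exist _ T' bT'), (F, G).
pose o (T : Theta n) : Theta n := projT1 (ch T).
pose to T := (sval (projT2 (ch T))).1; pose from T := (sval (projT2 (ch T))).2.
have fromto T : ocomp (from T) (to T) = oid _ := (svalP (projT2 (ch T))).1.
have tofrom T : ocomp (to T) (from T) = oid _ := (svalP (projT2 (ch T))).2.
pose h (S T : Theta n) (f : hom S T) : hom (o S) (o T) :=
  ocomp (from T) (ocomp (rev_ofunctor (reversed d) f) (to S)).
have h1 T : h T T (idm T) = idm (o T).
  rewrite /h; transitivity (ocomp (from T) (to T)); last exact: fromto.
  exact: ofunctor_eq.
have tf T k (x : ar (rev_ocat (reversed d) (Theta_of (sval T))) k) : to T k (from T k x) = x.
  exact: (congr1 (fun F : ofunctor _ _ => F k x) (tofrom T)).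
have hM R S T (f : hom S T) (g : hom R S) : h _ _ (cmp f g) = cmp (h _ _ f) (h _ _ g).
  apply: ofunctor_eq => k x; rewrite /h.
  transitivity (from T k (fun_of f k (to S k (from S k (fun_of g k (to R k x)))))); last by [].
  by rewrite tf.
exists (Functor h1 hM).
pose t (T : Theta n) :
  hom (fcomp (Theta_incl n) (Functor h1 hM) T) (fcomp (opn d) (Theta_incl n) T) := to T.
have tP (S T : Theta n) (f : hom S T) :
    cmp (t T) (fhom (fcomp (Theta_incl n) (Functor h1 hM)) f) =
    cmp (fhom (fcomp (opn d) (Theta_incl n)) f) (t S).
  by apply: ofunctor_eq => k x; exact: tf.
exists (NatTrans tP) => T; exists (from T); split; [exact: fromto | exact: tofrom].
Qed.

Definition op d : functor (Theta n) (Theta n) := sval (cid (induced_op_exists d)).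

Lemma op_induced d : induced_op d (op d).
Proof. exact: svalP (cid (induced_op_exists d)). Qed.

Lemma opD d d' : op (d + d')%R = fcomp (op d) (op d').
Proof.
apply: induced_op_unique (op_induced _) _; apply: induced_opD; exact: op_induced.
Qed.

Lemma op0 : op 0%R = fid _.
Proof. exact: induced_op_unique (op_induced _) induced_op0. Qed.

Lemma opK d : fcomp (op d) (op d) = fid _.
Proof.
rewrite -opD -op0; congr op; apply: funext => i.
have -> : (d + d)%R i = (d i + d i)%R by [].
by apply: val_inj; case: (d i) => [[|[|//]] ?].
Qed.

(** The isomorphism of op d (D y) with the reversal of D y preserves the top cell; it
    therefore carries the action of op d on inclusions of disks to the exchange
    of sources and targets in the reversal. *)
Lemma sgn_op d x y : sval y = (sval x).+1 ->
  sgn (fixes_disks (opK d) (opK d)) x y = reversed d (sval x).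
Proof.
move=> yx; have xy : sval x < sval y by rewrite yx.
set FD := fixes_disks _ _; have [s sI] := op_induced d.
pose t z : ofunctor (Theta_of (sval (D z))) (rev_ocat (reversed d) (Theta_of (sval (D z)))) :=
  ocomp (s (D z) : ofunctor _ _) (fun_of (from_disk FD z)).
(* Having a retraction, t z cannot send the top cell to one of lower dimension. *)
have tu z K : sval z <= K -> t z K (gen (single (sval z)) K 0) = gen (single (sval z)) K 0.
  move=> zK; set u := gen _ _ _.
  have [t' t't] : exists t' : ofunctor (rev_ocat (reversed d) (Theta_of (sval (D z)))) (Theta_of (sval (D z))),
      ocomp t' (t z) = oid _.
    have [s' [s's _]] := sI (D z).
    exists (ocomp (fun_of (to_disk FD z)) (s' : ofunctor _ _)).
    apply: ofunctor_eq => k c; rewrite -[RHS](congr1 (fun F : ofunctor _ _ => F k c) (to_from FD z)).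
    rewrite !ocompE; congr (fmap _ _).
    exact: (congr1 (fun F : ofunctor _ _ => F k (fun_of (from_disk FD z) k c)) s's).
  have tt : t' K (t z K u) = u := congr1 (fun F : ofunctor _ _ => F K u) t't.
  have [b [i [iz e]]] := disk_cells (t z K u) zK.
  have [iz'|zi] := ltnP i (sval z); last by rewrite e bd_gen_disk.
  have : dimle i u.
    rewrite -tt e; have := fmap_dimle t' (k := i) (x := bd b i u).
    by apply; apply/rev_dimle; exact: dimle_bd.
  by move=> /(disk_not_dimle zK); lia.
(* Naturality of s at the source inclusion. *)
have N : ocomp (t y) (fun_of (disk_act FD (arrow false x y))) =
         ocomp (rev_ofunctor (reversed d) (fun_of (arrow false x y))) (t x).
  pose f := arrow false x y; pose sm z : ofunctor (Theta_of (sval (op d (D z))))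
    (rev_ocat (reversed d) (Theta_of (sval (D z)))) := s (D z).
  apply: ofunctor_eq => k c.
  transitivity (sm y k (fun_of (fhom (op d) f) k (fun_of (from_disk FD x) k c))).
    exact: (congr1 (fun h : hom (D x) (op d (D y)) => sm y k (fun_of h k c)) (esym (disk_actE FD f))).
  exact: (congr1 (fun h : ofunctor (Theta_of (sval (op d (D x))))
    (rev_ocat (reversed d) (Theta_of (sval (D y)))) => h k (fun_of (from_disk FD x) k c)) (ntP s f)).
have F_f := @invertible_faithful _ (op d) (op d) (opK d).
have [K [xK yK]] : exists K, sval x <= K /\ sval y <= K by exists (sval y); rewrite leqnn ltnW.
rewrite (disk_act_sgn FD F_f false xy) in N.
pose u (z : diskdim n) : ar (Theta_of (single (sval z))) K := gen (single (sval z)) K 0.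
have lhs : t y K (fun_of (arrow (false (+) sgn FD x y) x y) K (u x)) =
    bd (false (+) sgn FD x y (+) reversed d (sval x)) (sval x) (u y).
  transitivity (t y K (bd (false (+) sgn FD x y) (sval x) (u y))).
    by congr (t y K _); exact: arrowE xK yK.
  apply: etrans (fmap_bd (t y) _ _ _) _.
  apply: etrans (@rev_bd (reversed d) (Theta_of (sval (D y))) K _ _ _) _.
  exact: (congr1 (@bd (Theta_of (sval (D y))) K _ _) (tu y K yK)).
have rhs : fun_of (arrow false x y) K (t x K (u x)) = bd false (sval x) (u y).
  apply: etrans (arrowE false xK yK).
  by congr (fmap _ _); exact: tu xK.
have := congr1 (fun h : ofunctor (Theta_of (sval (D x)))
  (rev_ocat (reversed d) (Theta_of (sval (D y)))) => h K (u x)) N.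
move=> e; have {e} := etrans (esym lhs) (etrans e rhs).
case/(disk_bd_inj (ltnW xy) (ltnW xy) yK)=> _ [|]; last lia.
by case: (sgn _ _ _); case: (reversed _ _).
Qed.

(** * Classification of automorphisms *)

Lemma reversed_inj (d d' : Z2n n) :
  (forall x y : diskdim n, sval y = (sval x).+1 -> reversed d (sval x) = reversed d' (sval x)) ->
  d = d'.
Proof.
move=> h; apply: funext => -[i hi].
have [i0 bi] : 0 < i /\ bounded_by n i by case/andP: (hi); rewrite /bounded_by; case: (n).
have bi' : bounded_by n i.-1 by apply: bounded_by_leq bi; exact: leq_pred.
have := h (exist _ _ bi') (exist _ _ bi) (esym (prednK i0)).
rewrite /reversed /= prednK // insubT.
have E (a b : 'Z_2) : (a == 1%R) = (b == 1%R) -> a = b.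
  by case: a => [[|[|//]] ?]; case: b => [[|[|//]] ?] // _; exact: val_inj.
exact: E.
Qed.

(** The i-arrows are reversed by F when it exchanges the two inclusions of the
    (i-1)-disk into the i-disk. *)
Lemma op_classification (F G : functor (Theta n) (Theta n)) :
  fcomp G F = fid _ -> fcomp F G = fid _ -> exists d, F = op d.
Proof.
move=> GF FG.
pose d : Z2n n := fun i => if `[< exists x y : diskdim n,
  [/\ sval y = sval i, sval y = (sval x).+1 & sgn (fixes_disks GF FG) x y] >] then 1%R else 0%R.
exists d; apply: (same_sgn_eq (GF := GF) (FG := FG) (GF' := opK d) (FG' := opK d)) => x y xy.
rewrite sgn_op // /reversed -xy.
have hy : (0 < sval y) && (if n is Some m then sval y <= m else true).
  have : bounded_by n (sval y) := svalP y.
  by rewrite /bounded_by xy; move: (sval x) => k; case: (n).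
rewrite insubT /d /=; case: asboolP => [[x' [y' [y'y x'y' s]]]|no].
  rewrite eqxx.
  have ey : y' = y by apply: diskdim_eq; rewrite y'y.
  have ex : x' = x by apply: diskdim_eq; apply: succn_inj; rewrite -xy -x'y' y'y.
  by rewrite -ex -ey s.
by apply: contra_notF no => s; exists x, y; rewrite xy.
Qed.

Lemma op_inj d d' : op d = op d' -> d = d'.
Proof.
move=> e; apply: reversed_inj => x y xy.
rewrite -(sgn_op d xy) -(sgn_op d' xy).
move: (opK d) (opK d'); rewrite e => p q.
by rewrite (Prop_irrelevance p q).
Qed.

(** A natural transformation intertwines the actions on disks, hence only relates
    automorphisms of equal signature. *)
Lemma nattrans_op d d' : nattrans (op d) (op d') -> d = d'.
Proof.
move=> s; apply: reversed_inj => x y xy.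
rewrite -(sgn_op d xy) -(sgn_op d' xy).
apply: (nattrans_disk _ _ _ _ s y).2 => //; exact: invertible_faithful (opK _).
Qed.

Lemma op_nattrans_unique d d' (s t : nattrans (op d) (op d')) : s = t.
Proof. exact: (nattrans_unique (opK d) (opK d) s t (opK d') (opK d')). Qed.

Local Notation AutTheta := (Aut (Theta n)).

Lemma autoeq_op (F : AutTheta) : exists d, op d = sval F.
Proof.
have [G [GF FG]] := equivalence_invertible (@Theta_gaunt n) (svalP F).
by have [d ->] := op_classification GF FG; exists d.
Qed.

Lemma Aut_hom_eq (F G : AutTheta) : hom F G -> F = G.
Proof.
move=> s; apply: autoeq_eq; have [d dE] := autoeq_op F; have [d' dE'] := autoeq_op G.
move: (s : nattrans (sval F) (sval G)); rewrite -dE -dE' => {}s.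
by rewrite (nattrans_op s).
Qed.

Lemma Aut_thin (F G : AutTheta) (s t : hom F G) : s = t.
Proof.
have [d dE] := autoeq_op F; have [d' dE'] := autoeq_op G.
suff thin (u v : nattrans (sval F) (sval G)) : u = v by exact: thin.
by move: u v; rewrite -dE -dE'; exact: op_nattrans_unique.
Qed.

Lemma Aut_arr_eq (F G F' G' : AutTheta) (s : hom F G) (t : hom F' G') :
  F = F' -> G = G' -> arr_eq s t.
Proof.
by move=> e e'; case: _ / e t => t; case: _ / e' t => t; rewrite (Aut_thin s t).
Qed.

(** * The isomorphism of monoidal categories *)

Definition op_aut (d : disc (Z2n n)) : AutTheta :=
  exist _ (op d) (invertible_equivalence (ex_intro _ (op d) (conj (opK d) (opK d)))).

Definition op_functor : functor (disc (Z2n n)) AutTheta :=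
  @Functor _ _ op_aut (fun _ _ e => castm (congr1 op_aut e)) (fun=> erefl)
    (fun _ _ _ _ _ => esym (castm_comp _ _ _)).

Definition op_sm : smfunctor (disc_sm (Z2n n)) (Aut_sm (Theta n)).
Proof.
exists op_functor.
- by apply: autoeq_eq; exact: op0.
- by move=> x y; apply: autoeq_eq; exact: opD.
- by move=> *; apply: Aut_arr_eq; apply: autoeq_eq; exact: opD.
Defined.

Definition op_index (F : AutTheta) : disc (Z2n n) := sval (cid (autoeq_op F)).

Lemma op_indexK F : op_aut (op_index F) = F.
Proof. by apply: autoeq_eq; exact: svalP (cid (autoeq_op F)). Qed.

Lemma op_autK d : op_index (op_aut d) = d.
Proof. by apply: op_inj; exact: (congr1 sval (op_indexK (op_aut d))). Qed.

Definition index_functor : functor AutTheta (disc (Z2n n)).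
Proof.
exists op_index (fun _ _ s => congr1 op_index (Aut_hom_eq s)).
- by move=> F /=; exact: Prop_irrelevance.
- by move=> F F' F'' s t /=; exact: Prop_irrelevance.
Defined.

Lemma op_indexD (F G : Aut_sm (Theta n)) :
  op_index (tens (Aut_sm (Theta n)) (F, G)) = (op_index F + op_index G)%R.
Proof.
apply: op_inj; apply: etrans (congr1 sval (op_indexK _)) _.
apply: etrans (esym (opD _ _)).
by congr fcomp; apply/esym/(congr1 sval (op_indexK _)).
Qed.

Lemma op_index0 : op_index (sunit (Aut_sm (Theta n))) = 0%R.
Proof. by apply: op_inj; apply: etrans (congr1 sval (op_indexK _)) _; exact: (esym op0). Qed.

Definition index_sm : smfunctor (Aut_sm (Theta n)) (disc_sm (Z2n n)).
Proof.
exists index_functor.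
- exact: op_index0.
- exact: op_indexD.
- by move=> *; apply: disc_arr_eq; exact: op_indexD.
Defined.

End Op.

Theorem theorem4p5p5 (n : option nat) :
  exists Op : smfunctor (disc_sm (Z2n n)) (Aut_sm (Theta n)),
    (forall d : Z2n n, unique (@induced_op n d) (sval (smf Op d)))
    /\ is_smiso Op.
Proof.
exists (op_sm n); split=> [d|].
  by split; [exact: op_induced | move=> F; exact: induced_op_unique (op_induced d)].
exists (index_sm n); split.
  have e : fob (fcomp (index_sm n) (op_sm n)) = fob (fid (disc_sm (Z2n n))).
    by apply: funext => d; exact: (@op_autK n d).
  by apply: (functor_eq (e := e)) => a b f /=; exact: (@Prop_irrelevance (_ = _ :> Z2n n)).
have e : fob (fcomp (op_sm n) (index_sm n)) = fob (fid (Aut_sm (Theta n))).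
  by apply: funext => F; exact: op_indexK.
by apply: (functor_eq (e := e)) => a b f; exact: Aut_thin.
Qed.
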